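(* Fix an integer $d\geq 2$, let $F_1,\ldots,F_d\in\mathrm{dom}(D)$ be Rademacher functionals satisfying $\mathbb{E}[F_i]=0$ and $\mathbb{E}[\|DF_i\|^4_{\ell^4(\mathbb{N})}]<\infty$ for all $i\in\{1,\ldots,d\}$ and define the random vector $\mathbf{F}:=(F_1,\ldots,F_d)$. Moreover, let $\Sigma=(\sigma_{ij})_{i,j=1}^d$ be a positive semi-definite symmetric $(d\times d)$-matrix and $\mathbf{N}$ a centred $d$-dimensional Gaussian random vector with covariance matrix $\Sigma$. Then $$d_4(\mathbf{F},\mathbf{N}) \leq \frac d2\Big(\sum_{i,j=1}^d\mathbb{E}\big[(\sigma_{ij}-\langle DF_j,-DL^{-1}F_i\rangle_{\ell^2(\mathbb{N})})^2\big]\Big)^{1/2}+\frac53\,\mathbb{E}\Big[\Big\langle\Big(\sum_{j=1}^d|DF_j|\Big)^3,\sum_{i=1}^d|DL^{-1}F_i|\Big\rangle_{\ell^2(\mathbb{N})}\Big].$$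
   Context: Rademacher sequence: $\Omega=\{-1,+1\}^{\mathbb{N}}$ with the product $\sigma$-field and $P=(\frac12\delta_{-1}+\frac12\delta_{+1})^{\otimes\mathbb{N}}$; $X_n(\omega)=\omega_n$. A Rademacher functional is a random variable $F=F(X)$ on this space. $\Delta_n=\{(i_1,\dots,i_n)\in\mathbb{N}^n: i_k\ne i_l\text{ for }k\neq l\}$; $\ell_0^2(\mathbb{N})^{\circ n}$ is the set of symmetric square-summable functions on $\mathbb{N}^n$ vanishing outside $\Delta_n$. For $f\in\ell_0^2(\mathbb{N})^{\circ q}$, $J_q(f)=q!\sum_{1\le i_1<\dots<i_q<\infty}f(i_1,\dots,i_q)X_{i_1}\cdots X_{i_q}$, and $J_0(c)=c$. Every $F\in L^2(\Omega)$ has a unique decomposition $F=\mathbb{E}[F]+\sum_{n\ge1}J_n(f_n)$ with $f_n\in\ell_0^2(\mathbb{N})^{\circ n}$. $F\in\mathrm{dom}(D)$ iff $\sum_{n\geq1}n\,n!\|f_n\|^2_{\ell^2(\mathbb{N})^{\otimes n}}<\infty$, and then $DF=(D_kF)_{k\in\mathbb{N}}$ with $D_kF=\sum_{n\ge1}nJ_{n-1}(f_n(\cdot,k))$; pathwise $D_kF(\omega)=\frac12(F(\omega_k^+)-F(\omega_k^-))$, where $\omega_k^\pm$ is $\omega$ with its $k$th coordinate replaced by $\pm1$. For centred $F=\sum_{n\ge1}J_n(f_n)\in L^2(\Omega)$, $L^{-1}F=-\sum_{n\ge1}\frac1nJ_n(f_n)$. Products, powers and absolute values of sequences are componentwise,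 and $\langle u,v\rangle_{\ell^2(\mathbb{N})}=\sum_ku_kv_k$. Distance: for $h:\mathbb{R}^d\to\mathbb{R}$ put $M_k(h)=\max_{1\le i_1,\dots,i_k\le d}\sup_{x\in\mathbb{R}^d}|\frac{\partial^k}{\partial x_{i_1}\cdots\partial x_{i_k}}h(x)|$. Then $d_4(\mathbf{Z},\mathbf{N})=\sup_g|\mathbb{E}g(\mathbf{Z})-\mathbb{E}g(\mathbf{N})|$, the supremum running over all $g:\mathbb{R}^d\to\mathbb{R}$ having continuous partial derivatives up to order $4$ and satisfying $M_i(g)\le1$ for $i\in\{1,2,3,4\}$. *)

(* Defs.v *)
From HB Require Import structures.
From mathcomp Require Import all_boot all_order all_algebra.
From mathcomp Require Import all_classical all_reals all_analysis.

Set Implicit Arguments.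
Unset Strict Implicit.
Unset Printing Implicit Defensive.

Import Order.TTheory GRing.Theory Num.Theory.
Import numFieldNormedType.Exports.

Local Open Scope classical_set_scope.
Local Open Scope ring_scope.

(* {-1,+1}^N is encoded by nat -> bool, true standing for +1 and false for -1.
   The product sigma-field is the one generated by the coordinate events. *)
Definition coord_events : set (set (nat -> bool)) :=
  [set A | exists n (B : set bool), A = [set w | B (w n)]].

Notation Omega := (g_sigma_algebraType coord_events).

Definition X (R : realType) (n : nat) (w : Omega) : R :=
  if (w : nat -> bool) n then 1 else -1.

(* P is the product measure (1/2 delta_{-1} + 1/2 delta_{+1})^{(x) N}: the
   product formula on the boxes, which form a pi-system generating the
   sigma-field, determines P. *)
Definition is_rademacher (R : realType) (P : probability Omega R) : Prop :=
  forall (n : nat) (B : nat -> set bool),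
    P [set w : Omega | forall i, (i < n)%N -> B i ((w : nat -> bool) i)] =
    (\prod_(i < n) bernoulli_prob (2^-1 : R) (B i))%E.

Section rademacher_functionals.
Context (R : realType) (P : probability Omega R).

Definition cvg_L2 (u : nat -> Omega -> R) (G : Omega -> R) : Prop :=
  G \in Lfun P 2%:E /\
  'N[P]_2%:E[EFin \o (u n \- G)%R]%E @[n --> \oo] --> 0%E.

(* A version of the limit in L^2(P), which is unique up to almost sure
   equality; the default value is only used when there is no limit. *)
Definition lim_L2 (u : nat -> Omega -> R) : Omega -> R :=
  xget (cst 0) [set G | cvg_L2 u G].

Definition sqnorm (n : nat) (f : n.-tuple nat -> R) : \bar R :=
  (\esum_(t in [set: n.-tuple nat]) ((f t) ^+ 2)%:E)%E.

(* \ell_0^2(N)^{\circ n}; t lies in Delta_n iff it is duplicate-free. *)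
Definition l02 (n : nat) : set (n.-tuple nat -> R) :=
  [set f | [/\ forall t t' : n.-tuple nat, perm_eq t t' -> f t = f t',
               forall t : n.-tuple nat, ~~ uniq t -> f t = 0
             & (sqnorm f < +oo)%E]].

(* The infinite sum is the limit in L^2(P) of the sums over
   i_1 < ... < i_q < N. For q = 0 it is the constant f [tuple]. *)
Definition J (q : nat) (f : q.-tuple nat -> R) : Omega -> R :=
  lim_L2 (fun N w => q`!%:R *
    \sum_(t : q.-tuple 'I_N | sorted ltn (map val t))
      f [tuple of map val t] * \prod_(i <- t) X R (val i) w).

Definition kernels := forall n : nat, n.-tuple nat -> R.

(* F = E[F] + sum_(n >= 1) J_n(f_n) in L^2(P), with f_n in l02 for n >= 1;
   the component f 0 plays no role anywhere. *)
Definition chaos (F : Omega -> R) (f : kernels) : Prop :=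
  (forall n, (0 < n)%N -> l02 (f n)) /\
  cvg_L2 (fun N w => fine 'E_P[F] + \sum_(1 <= n < N) J (f n) w) F.

Definition chaos_kernels (F : Omega -> R) : kernels :=
  xget (fun _ _ => 0) [set f | chaos F f].

Definition dom_D (F : Omega -> R) : Prop :=
  exists2 f : kernels, chaos F f &
    (\sum_(1 <= n <oo) (n * n`!)%:R%:E * sqnorm (f n) < +oo)%E.

(* D_k F = sum_(n >= 1) n J_{n-1}(f_n(., k)), with n shifted by one. *)
Definition D (F : Omega -> R) (k : nat) : Omega -> R :=
  lim_L2 (fun N w => \sum_(0 <= n < N) n.+1%:R *
    J (fun t : n.-tuple nat => chaos_kernels F [tuple of rcons t k]) w).

Definition Linv (F : Omega -> R) : Omega -> R :=
  lim_L2 (fun N w => - \sum_(1 <= n < N) n%:R^-1 * J (@chaos_kernels F n) w).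

End rademacher_functionals.

Definition l2inner (R : realType) (u v : nat -> R) : R :=
  limn (series (fun k => u k * v k)).

(* Same pairing, in [0, +oo], for nonnegative sequences. *)
Definition l2inner_ge0 (R : realType) (u v : nat -> R) : \bar R :=
  (\sum_(0 <= k <oo) (u k * v k)%:E)%E.

Section test_functions.
Context (R : realType) (d : nat).
Implicit Types g h : 'rV[R]_d -> R.

Definition partial (s : seq 'I_d) h : 'rV[R]_d -> R :=
  foldr (fun i g x => 'D_(delta_mx 0 i) g x) h s.

Definition C_upto (n : nat) g : Prop :=
  forall s : seq 'I_d, (size s <= n)%N ->
    continuous (partial s g) /\
    ((size s < n)%N -> forall i x, derivable (partial s g) x (delta_mx 0 i)).

Definition M (k : nat) h : \bar R :=
  (\big[maxe/0]_(s : k.-tuple 'I_d)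
    ereal_sup [set `|partial s h x|%:E | x in [set: 'rV[R]_d]])%E.

Definition d4 (d1 d2 : measure_display)
    (T1 : measurableType d1) (T2 : measurableType d2)
    (P1 : probability T1 R) (P2 : probability T2 R)
    (Y : 'I_d -> T1 -> R) (Z : 'I_d -> T2 -> R) : \bar R :=
  ereal_sup
    [set `|'E_P1[fun w => g (\row_i Y i w)] - 'E_P2[fun w => g (\row_i Z i w)]|%E
    | g in [set g | C_upto 4 g /\
                    forall i, (1 <= i <= 4)%N -> (M i g <= 1)%E]].

End test_functions.

(* The library's normal_prob m 0 is not the degenerate normal law. *)
Definition normal_law (R : realType) (m s : R) (A : set R) : \bar R :=
  if s == 0 then \d_m A else normal_prob m s A.

Definition gaussian_vector (R : realType) (d : nat) (dT : measure_display)
    (T : measurableType dT) (Q : probability T R) (N : 'I_d -> T -> R) : Prop :=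
  forall a : 'I_d -> R, exists m s : R, forall A : set R, measurable A ->
    Q ((fun w => \sum_i a i * N i w) @^-1` A) = normal_law m s A.

Definition psd (R : realType) (d : nat) (S : 'M[R]_d) : Prop :=
  forall v : 'rV[R]_d, 0 <= (v *m S *m v^T) 0 0.

(* Main.v *)
(** Let [grad k F = X_k (F - F o tau_k) / 2], where [tau_k] flips the k-th
    coordinate. Since [tau_k] preserves [P], [D_k F = grad k F] almost surely and
    [E (F G) = sum_k E (grad k G * grad k (- L^-1 F))] for centred [F].
    Take [F = F_i] and [G = d_i g (a F + b y)]. The trapezoidal rule between [w] and
    [tau_k w], whose two endpoints have the same law, gives
    [sum_i E (F_i d_i g) = a sum_ij E (d_ij g * Gamma_ij) + r] with [|r| <= 2 |a|^3 T]
    and [Gamma_ij = <DF_j, - D L^-1 F_i>], where [T] is the third-moment term.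
    The Gaussian vector is replaced by a scaled sum [S_n] of random signs, which
    satisfies the Gaussian identity [E (S_i phi_i (S)) = sum_j sigma_ij E (d_j phi_i (S))]
    up to [O (n^(-1/2))] and converges to [N] in law. Along [a F + b S_n] with
    [a^2 + b^2 = 1], from [(0, 1)] to [(1, 0)], the two Hessian terms compensate up
    to [sigma - Gamma], and the increments of [E g (a F + b S_n)] sum up to at most
    [1/2 sum_ij E |sigma_ij - Gamma_ij| + 1/2 T + O (n^(-1/2))]. *)

Require Import Defs.
From HB Require Import structures.
From mathcomp Require Import all_boot all_order all_algebra.
From mathcomp Require Import all_classical all_reals all_analysis.
From mathcomp Require Import measurable_realfun ring lra.

Set Implicit Arguments.
Unset Strict Implicit.
Unset Printing Implicit Defensive.
Import Order.TTheory GRing.Theory Num.Theory.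
Import numFieldNormedType.Exports.
Local Open Scope classical_set_scope.
Local Open Scope ring_scope.

(** * Square-integrable random variables *)

(** The law of [N] is given only through its linear combinations, whereas the path needs a Gaussian
    integration by parts for functions of the whole vector, independent of [F]. Random signs supply
    both by finite averages: independence is an outer [avg] over sign choices, and the identity
    follows sign by sign from Taylor expansions. Convergence to [N] is checked on cosines and
    transferred to Lipschitz functions by trigonometric approximation, whose quadratically growing
    error is controlled by the common covariance. Constants: a flip moves [a F] by [2 |a|] times the
    gradient; the trapezoidal error [1/2 |v|^3], halved once more in [grad], gives [2 |a|^3], whose
    integral over [0, 1] is [1/2], below [5/3]. The rule is applied to [d_i g] and needs Lipschitz
    third derivatives of [g], hence order four. Cauchy-Schwarz over the [d^2] pairs produces
    [d / 2]. [D] and [L^-1] are unspecified versions of L^2 limits, so the analysis is done on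
    [grad], which is defined pointwise, and the versions are compared only at the end. *)

Lemma discr_le (R : realType) (a b c : R) : 0 <= a -> 0 <= b ->
  (forall t, 0 <= a + 2 * t * c + t ^+ 2 * b) -> c ^+ 2 <= a * b.
Proof.
move=> a0 b0 H; have [b00|bn0] := eqVneq b 0.
  have [->|c0] := eqVneq c 0; first by rewrite expr0n /= mulr_ge0.
  (* For [b = 0] the polynomial is affine in [t], and at this point its value is -1. *)
  have := H (- (a + 1) / (2 * c)); rewrite b00 mulr0 addr0.
  rewrite (_ : 2 * _ * c = - (a + 1)); last by field.
  lra.
have bp : 0 < b by rewrite lt_def bn0.
have := H (- c / b).
rewrite (_ : _ + _ = a - c ^+ 2 / b); last by field.
by rewrite subr_ge0 ler_pdivrMr.
Qed.

Section expectation.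
Context {dT : measure_display} {T : measurableType dT} {R : realType}.
Variable P : probability T R.
Implicit Types f g h : T -> R.

Definition itg f := P.-integrable setT (EFin \o f).
Definition mean f : R := (\int[P]_w f w)%R.

Lemma itg_mf f : itg f -> measurable_fun setT f.
Proof. by move=> /measurable_int /measurable_EFinP. Qed.

Lemma eq_itg f g : f =1 g -> itg f -> itg g.
Proof. by move=> /funext ->. Qed.

Lemma eq_mean f g : f =1 g -> mean f = mean g.
Proof. by move=> /funext ->. Qed.

Lemma itgD f g : itg f -> itg g -> itg (fun w => f w + g w).
Proof.
move=> itf ig; rewrite /itg.
rewrite (_ : _ \o _ = (EFin \o f) \+ (EFin \o g))%E //.
exact: integrableD.
Qed.

Lemma itgZ c f : itg f -> itg (fun w => c * f w).
Proof. by move=> itf; apply: (integrableZl measurableT c itf). Qed.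

Lemma itgN f : itg f -> itg (fun w => - f w).
Proof. by move=> /(itgZ (-1)); apply: eq_itg => w; rewrite mulN1r. Qed.

Lemma itgB f g : itg f -> itg g -> itg (fun w => f w - g w).
Proof. by move=> itf ig; apply: itgD => //; apply: itgN. Qed.

Lemma itg_cst c : itg (fun=> c).
Proof. exact: finite_measure_integrable_cst. Qed.

Lemma itg_sum I (r : seq I) (p : pred I) (f : I -> T -> R) :
  (forall i, p i -> itg (f i)) -> itg (fun w => \sum_(i <- r | p i) f i w).
Proof.
move=> H; elim: r => [|i r IH].
  by apply: eq_itg (itg_cst 0) => w; rewrite big_nil.
case pi : (p i); last by apply: eq_itg IH => w; rewrite big_cons pi.
by apply: eq_itg (itgD (H _ pi) IH) => w; rewrite big_cons pi.
Qed.

Lemma itg_le f g : measurable_fun setT f -> (forall w, `|f w| <= g w) ->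
  itg g -> itg f.
Proof.
move=> mf fg; apply: le_integrable => //; first exact/measurable_EFinP.
by move=> w _ /=; rewrite lee_fin (le_trans (fg w)) // ler_norm.
Qed.

Lemma itg_norm f : itg f -> itg (fun w => `|f w|).
Proof. exact: integrable_norm. Qed.

Lemma itg_bnd f g C : measurable_fun setT g -> (forall w, `|g w| <= C) ->
  itg f -> itg (fun w => g w * f w).
Proof.
move=> mg gC itf; apply: (@itg_le _ (fun w => C * `|f w|)).
- by apply: measurable_funM => //; apply: itg_mf.
- by move=> w; rewrite normrM ler_wpM2r.
- by apply: itgZ; apply: itg_norm.
Qed.

Lemma meanD f g : itg f -> itg g ->
  mean (fun w => f w + g w) = mean f + mean g.
Proof. by move=> itf ig; rewrite /mean RintegralD. Qed.

Lemma meanZ c f : itg f -> mean (fun w => c * f w) = c * mean f.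
Proof. by move=> itf; rewrite /mean RintegralZl. Qed.

Lemma meanN f : itg f -> mean (fun w => - f w) = - mean f.
Proof.
move=> itf; rewrite -mulN1r -meanZ //.
by apply: eq_mean => w; rewrite mulN1r.
Qed.

Lemma meanB f g : itg f -> itg g ->
  mean (fun w => f w - g w) = mean f - mean g.
Proof. by move=> itf ig; rewrite /mean RintegralB. Qed.

Lemma mean_cst c : mean (fun=> c) = c.
Proof. by rewrite /mean Rintegral_cst //= probability_setT /= mulr1. Qed.

Lemma mean_sum I (r : seq I) (p : pred I) (f : I -> T -> R) :
  (forall i, p i -> itg (f i)) ->
  mean (fun w => \sum_(i <- r | p i) f i w) = \sum_(i <- r | p i) mean (f i).
Proof.
move=> H; elim: r => [|i r IH].
  by rewrite big_nil -[RHS](mean_cst 0); apply: eq_mean => w; rewrite big_nil.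
rewrite big_cons -IH; case pi : (p i); last first.
  by apply: eq_mean => w; rewrite big_cons pi.
rewrite -meanD; [|exact: H|exact: itg_sum].
by apply: eq_mean => w; rewrite big_cons pi.
Qed.

Lemma le_mean f g : itg f -> itg g -> (forall w, f w <= g w) ->
  mean f <= mean g.
Proof. by move=> itf ig fg; apply: le_Rintegral => // w _; apply: fg. Qed.

Lemma mean_ge0 f : (forall w, 0 <= f w) -> 0 <= mean f.
Proof. by move=> f0; apply: Rintegral_ge0 => w _; apply: f0. Qed.

Lemma ler_norm_mean f : itg f -> `|mean f| <= mean (fun w => `|f w|).
Proof. by move=> itf; apply: le_normr_Rintegral. Qed.

Lemma mean_EFin f : itg f -> (\int[P]_w (f w)%:E)%E = (mean f)%:E.
Proof.
move=> itf; rewrite /mean /Rintegral fineK //.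
exact: (integrable_fin_num measurableT itf).
Qed.

Lemma ge0_itg f : measurable_fun setT f -> (forall w, 0 <= f w) ->
  (\int[P]_w (f w)%:E < +oo)%E -> itg f.
Proof.
move=> mf f0 fi; apply/integrableP; split; first exact/measurable_EFinP.
by under eq_integral do rewrite /= ger0_norm //.
Qed.

Lemma ae_eq_mean f g : measurable_fun setT f -> measurable_fun setT g ->
  {ae P, forall w, f w = g w} -> mean f = mean g.
Proof.
move=> mf mg [N [mN PN H]]; rewrite /mean /Rintegral; congr fine.
apply: ae_eq_integral => //.
- by apply/measurable_EFinP.
- by apply/measurable_EFinP.
by exists N; split => // w /= Hw; apply: H => /= fg; apply: Hw => _; rewrite fg.
Qed.

(** Concrete functions with squared norms: there is no quotient by null sets, and norm estimates
    stay polynomial inequalities between reals. *)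
Definition L2 f := measurable_fun setT f /\ itg (fun w => f w ^+ 2).
Definition n2 f : R := mean (fun w => f w ^+ 2).

Lemma L2mf f : L2 f -> measurable_fun setT f. Proof. by case. Qed.

Lemma eq_L2 f g : f =1 g -> L2 f -> L2 g.
Proof. by move=> /funext ->. Qed.

Lemma eq_n2 f g : f =1 g -> n2 f = n2 g.
Proof. by move=> /funext ->. Qed.

Lemma n2_ge0 f : 0 <= n2 f.
Proof. by apply: mean_ge0 => w; apply: sqr_ge0. Qed.

Lemma L2M f g : L2 f -> L2 g -> itg (fun w => f w * g w).
Proof.
move=> [mf lf] [mg ig]; apply: (itg_le _ _ (itgD lf ig)).
  exact: measurable_funM.
by move=> w; rewrite ler_norml; apply/andP; split; nra.
Qed.

Lemma L2_le f g : measurable_fun setT f -> (forall w, `|f w| <= `|g w|) ->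
  L2 g -> L2 f.
Proof.
move=> mf fg [mg ig]; split => //; apply: (itg_le _ _ ig).
  exact: measurable_funX.
by move=> w; rewrite normrX -[leRHS]real_normK ?num_real // ler_pXn2r ?nnegrE.
Qed.

Lemma L2Z c f : L2 f -> L2 (fun w => c * f w).
Proof.
move=> [mf lf]; split; first exact: measurable_funM.
by apply: eq_itg (itgZ (c ^+ 2) lf) => w; rewrite exprMn.
Qed.

Lemma L2D f g : L2 f -> L2 g -> L2 (fun w => f w + g w).
Proof.
move=> lf lg; split.
  by apply: measurable_funD; apply: L2mf.
apply: eq_itg (itgD (itgD lf.2 (itgZ 2 (L2M lf lg))) lg.2) => w /=.
by rewrite sqrrD mulr2n; ring.
Qed.

Lemma L2N f : L2 f -> L2 (fun w => - f w).
Proof. by move=> /(L2Z (-1)); apply: eq_L2 => w; rewrite mulN1r. Qed.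

Lemma L2B f g : L2 f -> L2 g -> L2 (fun w => f w - g w).
Proof. by move=> lf lg; apply: L2D => //; apply: L2N. Qed.

Lemma L2cst c : L2 (fun=> c).
Proof. by split=> //; apply: itg_cst. Qed.

Lemma L2_sum I (r : seq I) (p : pred I) (f : I -> T -> R) :
  (forall i, p i -> L2 (f i)) -> L2 (fun w => \sum_(i <- r | p i) f i w).
Proof.
move=> H; elim: r => [|i r IH].
  by apply: eq_L2 (L2cst 0) => w; rewrite big_nil.
case pi : (p i); last by apply: eq_L2 IH => w; rewrite big_cons pi.
by apply: eq_L2 (L2D (H _ pi) IH) => w; rewrite big_cons pi.
Qed.

Lemma L2_itg f : L2 f -> itg f.
Proof.
by move=> lf; apply: eq_itg (L2M lf (L2cst 1)) => w; rewrite mulr1.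
Qed.

Lemma L2_norm f : L2 f -> L2 (fun w => `|f w|).
Proof.
move=> lf; apply: (L2_le _ _ lf).
  by have mf := L2mf lf; exact: measurableT_comp.
by move=> w; rewrite normr_id.
Qed.

Lemma L2_bnd f g C : measurable_fun setT g -> (forall w, `|g w| <= C) ->
  L2 f -> L2 (fun w => g w * f w).
Proof.
move=> mg gC lf; apply: (L2_le _ _ (L2Z C lf)).
  by apply: measurable_funM => //; apply: L2mf.
move=> w; rewrite !normrM ler_wpM2r //.
by rewrite (le_trans (gC w)) // ler_norm.
Qed.

Lemma n2Z c f : L2 f -> n2 (fun w => c * f w) = c ^+ 2 * n2 f.
Proof.
move=> lf; rewrite /n2 -meanZ; last exact: lf.2.
by apply: eq_mean => w; rewrite exprMn.
Qed.

Lemma n2N f : n2 (fun w => - f w) = n2 f.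
Proof. by rewrite /n2; apply: eq_mean => w; rewrite sqrrN. Qed.

Lemma n2BC f g : n2 (fun w => f w - g w) = n2 (fun w => g w - f w).
Proof. by apply: eq_mean => w; rewrite -sqrrN opprB. Qed.

Lemma n2D f g : L2 f -> L2 g ->
  n2 (fun w => f w + g w) = n2 f + 2 * mean (fun w => f w * g w) + n2 g.
Proof.
move=> lf lg; rewrite /n2 -meanZ; last exact: L2M.
rewrite -meanD; [|exact: lf.2|by apply: itgZ; exact: L2M].
rewrite -meanD.
- by apply: eq_mean => w; rewrite sqrrD mulr2n; ring.
- by apply: itgD; [exact: lf.2|apply: itgZ; exact: L2M].
- exact: lg.2.
Qed.

Lemma n2D_le f g : L2 f -> L2 g ->
  n2 (fun w => f w + g w) <= 2 * n2 f + 2 * n2 g.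
Proof.
move=> lf lg; have : 0 <= n2 (fun w => f w + - g w) by apply: n2_ge0.
rewrite n2D //; last exact: L2N.
rewrite n2D // n2N (_ : mean (fun w => f w * - g w) = - mean (fun w => f w * g w)).
  lra.
rewrite -meanN; last exact: L2M.
by apply: eq_mean => w; rewrite mulrN.
Qed.

Lemma n2B_le f g h : L2 f -> L2 g -> L2 h ->
  n2 (fun w => f w - h w) <=
  2 * n2 (fun w => f w - g w) + 2 * n2 (fun w => g w - h w).
Proof.
move=> lf lg lh.
have := n2D_le (L2B lf lg) (L2B lg lh); apply: le_trans.
by rewrite le_eqVlt; apply/orP; left; apply/eqP/eq_n2 => w; ring.
Qed.

Lemma le_n2 f g : L2 f -> L2 g -> (forall w, `|f w| <= `|g w|) -> n2 f <= n2 g.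
Proof.
move=> lf lg fg; apply: le_mean; [exact: lf.2|exact: lg.2|].
move=> w; rewrite -[leLHS]real_normK ?num_real // -[leRHS]real_normK ?num_real //.
by rewrite ler_pXn2r ?nnegrE.
Qed.

Lemma cauchy_schwarz f g : L2 f -> L2 g ->
  mean (fun w => f w * g w) ^+ 2 <= n2 f * n2 g.
Proof.
move=> lf lg; apply: discr_le; try exact: n2_ge0.
move=> t; have : 0 <= n2 (fun w => f w + t * g w) by apply: n2_ge0.
rewrite n2D //; last exact: L2Z.
rewrite n2Z // (_ : mean (fun w => f w * (t * g w)) = t * mean (fun w => f w * g w)).
  by rewrite mulrA.
rewrite -meanZ; last exact: L2M.
by apply: eq_mean => w; ring.
Qed.

(* [\sum_k n2 (u k + t * v k)] is a nonnegative quadratic polynomial in [t]. *)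
Lemma cauchy_schwarz_sum (I : Type) (r : seq I) (u v : I -> T -> R) :
  (forall i, L2 (u i)) -> (forall i, L2 (v i)) ->
  (\sum_(i <- r) mean (fun w => u i w * v i w)) ^+ 2 <=
  (\sum_(i <- r) n2 (u i)) * \sum_(i <- r) n2 (v i).
Proof.
move=> Lu Lv; apply: discr_le; try by apply: sumr_ge0 => i _; exact: n2_ge0.
move=> t; rewrite !mulr_sumr -!big_split /=; apply: sumr_ge0 => i _.
have : 0 <= n2 (fun w => u i w + t * v i w) by apply: n2_ge0.
rewrite n2D ?n2Z //; last exact: L2Z.
rewrite (_ : mean (fun w => u i w * (t * v i w)) = t * mean (fun w => u i w * v i w)).
  by rewrite mulrA.
rewrite -meanZ; last exact: L2M.
by apply: eq_mean => w; ring.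
Qed.

Lemma mean_sqr_le f : L2 f -> mean f ^+ 2 <= n2 f.
Proof.
move=> lf; have := cauchy_schwarz lf (L2cst 1).
rewrite (_ : n2 (fun=> 1) = 1) ?mulr1; last first.
  by rewrite -[RHS]mean_cst; apply: eq_mean => w; rewrite expr1n.
by rewrite (_ : mean (fun w => _) = mean f) //; apply: eq_mean => w; rewrite mulr1.
Qed.

Lemma n2_eq0 f : L2 f -> n2 f = 0 -> {ae P, forall w, f w = 0}.
Proof.
move=> lf f0.
have : (\int[P]_w `|(f w ^+ 2)%:E| = 0)%E.
  under eq_integral do rewrite /= ger0_norm ?sqr_ge0 //.
  by rewrite mean_EFin; [rewrite -/(n2 f) f0|exact: lf.2].
move=> /(ae_eq_integral_abs _ measurableT) [].
  by apply/measurable_EFinP/measurable_funX/L2mf.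
move=> N [mN PN H]; exists N; split => // w /= Hw.
apply: H => /= fg; apply: Hw; have := fg I => -[] /eqP.
by rewrite sqrf_eq0 => /eqP.
Qed.

Lemma ae_n2_eq0 f : measurable_fun setT f -> {ae P, forall w, f w = 0} -> n2 f = 0.
Proof.
move=> mf H; rewrite -(mean_cst 0); apply: ae_eq_mean => //.
  exact: measurable_funX.
by case: H => N [mN PN H]; exists N; split => // w /= Hw; apply: H => /= fw; apply: Hw; rewrite fw expr0n.
Qed.

End expectation.

Lemma nneseries_le_bnd (R : realType) (u : nat -> \bar R) (C : \bar R) :
  (forall k, 0 <= u k)%E -> (forall n, \sum_(0 <= k < n) u k <= C)%E ->
  (\sum_(0 <= k <oo) u k <= C)%E.
Proof.
move=> u0 H; apply: lime_le; first by apply: is_cvg_nneseries.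
by apply: nearW => n; exact: H.
Qed.

Lemma is_cvg_series_abs_bnd (R : realType) (v : nat -> R) (C : R) :
  (forall n, \sum_(0 <= k < n) `|v k| <= C) -> cvgn (series v).
Proof.
move=> H; apply: normed_cvg; apply: nondecreasing_is_cvgn.
  by apply/nondecreasing_seqP => n; rewrite -subr_ge0 seriesSB normr_ge0.
by exists C => _ [n _ <-]; exact: H.
Qed.

(** * Completeness of L^2 *)

Section completeness.
Context {dT : measure_display} {T : measurableType dT} {R : realType}.
Variable P : probability T R.
Local Notation L2 := (L2 P).
Local Notation n2 := (n2 P).
Local Notation mean := (mean P).

Lemma ae_and (A B : T -> Prop) :
  {ae P, forall w, A w} -> {ae P, forall w, B w} ->
  {ae P, forall w, A w /\ B w}.
Proof. by move=> HA HB; apply: filterS2 HA HB. Qed.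

Lemma ae_forall (A : nat -> T -> Prop) :
  (forall k, {ae P, forall w, A k w}) -> {ae P, forall w, forall k, A k w}.
Proof. by move=> H; apply/ae_foralln. Qed.

(* Absolute convergence of the series of increments along a fast subsequence. *)
Lemma ae_cvg_fast (v : nat -> T -> R) : (forall k, L2 (v k)) ->
  (forall k, n2 (fun w => v k.+1 w - v k w) <= 4^-1 ^+ k) ->
  {ae P, forall w, cvgn (v ^~ w)}.
Proof.
move=> Lv Hv.
pose f k w := (`|v k.+1 w - v k w|)%:E.
have Li k : L2 (fun w => v k.+1 w - v k w) by apply: L2B.
have mf k : measurable_fun setT (f k).
  apply/measurable_EFinP; exact: L2mf (L2_norm (Li k)).
have f0 k w : (0 <= f k w)%E by rewrite lee_fin.
(* By Cauchy-Schwarz the k-th increment has first absolute moment at most 2^-k, and these sum to at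
   most 2. *)
have If : (\int[P]_w (\sum_(0 <= k <oo) f k w) <= 2%:E)%E.
  rewrite integral_nneseries //.
  apply: nneseries_le_bnd => [k|n]; first by apply: integral_ge0.
  apply: (@le_trans _ _ (\sum_(0 <= k < n) (2^-1 ^+ k)%:E)%E).
    apply: lee_sum => k _; rewrite mean_EFin; last by apply/itg_norm/L2_itg.
    rewrite lee_fin -[leRHS]ger0_norm ?exprn_ge0 // -sqrtr_sqr -exprM mulnC.
    rewrite exprM (_ : 2^-1 ^+ 2 = 4^-1 :> R); last by field.
    rewrite -[leLHS]ger0_norm; last by apply: mean_ge0.
    rewrite -sqrtr_sqr ler_sqrt ?exprn_ge0 //.
    apply: le_trans (Hv k); apply: le_trans (mean_sqr_le (L2_norm (Li k))) _.
    by apply: le_n2 => [||w]; [exact: L2_norm| |rewrite normr_id].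
  rewrite sumEFin lee_fin.
  have -> : \sum_(0 <= k < n) 2^-1 ^+ k = 2 - 2 * 2^-1 ^+ n :> R.
    elim: n => [|n IH]; first by rewrite big_nil expr0; ring.
    by rewrite big_nat_recr //= IH exprS; field.
  by rewrite lerBlDr lerDl mulr_ge0 // exprn_ge0.
have If2 : P.-integrable setT (fun w => \sum_(0 <= k <oo) f k w)%E.
  apply/integrableP; split; first exact: ge0_emeasurable_sum.
  under eq_integral do rewrite gee0_abs ?nneseries_ge0 //.
  by apply: le_lt_trans If _; rewrite ltry.
have := integrable_ae measurableT If2; apply: filterS => w /(_ I) Sw.
have : cvgn (series (fun k => v k.+1 w - v k w)).
  apply: (@is_cvg_series_abs_bnd _ _ (fine (\sum_(0 <= k <oo) f k w)%E)) => n.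
  rewrite -lee_fin fineK // -sumEFin.
  by apply: nneseries_lim_ge => *; exact: f0.
move=> H; have -> : v ^~ w =
    (fun n => v 0%N w + series (fun k => v k.+1 w - v k w) n).
  by apply/funext => n; rewrite /series /= telescope_sumr // addrC subrK.
by apply: is_cvgD => //; exact: is_cvg_cst.
Qed.

Lemma limn_einf_le_cst (u : nat -> \bar R) c : (forall n, u n <= c)%E ->
  (limn_einf u <= c)%E.
Proof.
move=> H; rewrite limn_einf_lim; apply: lime_le; first exact: is_cvg_einfs.
apply: nearW => n; apply: le_trans (H n); rewrite /einfs /sdrop.
by apply: ereal_inf_lbound; exists n => //=.
Qed.

(** A fast subsequence converges almost surely, and Fatou's lemma along it turns the Cauchy bounds
    into bounds on the distance to its limit. *)
Lemma L2_complete (u : nat -> T -> R) : (forall n, L2 (u n)) ->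
  (forall e, 0 < e -> exists N, forall m n, (N <= m)%N -> (N <= n)%N ->
     n2 (fun w => u m w - u n w) < e) ->
  exists2 G, L2 G & forall e, 0 < e -> exists N, forall n, (N <= n)%N ->
     n2 (fun w => u n w - G w) < e.
Proof.
move=> Lu Cu.
have [phi Hphi] : {phi : nat -> nat & forall k m n, (phi k <= m)%N ->
    (phi k <= n)%N -> n2 (fun w => u m w - u n w) < 4^-1 ^+ k}.
  apply: (@choice _ _ (fun k N => forall m n, (N <= m)%N ->
    (N <= n)%N -> n2 (fun w => u m w - u n w) < 4^-1 ^+ k)) => k.
  by apply: Cu; rewrite exprn_gt0.
(* The ranks [phi] need not be monotone; their partial sums dominate all the earlier ones. *)
pose psi k := (\sum_(i < k.+1) phi i)%N.
have phi_psi j k : (j <= k)%N -> (phi j <= psi k)%N.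
  by move=> jk; rewrite /psi (bigD1 (Ordinal (jk : (j < k.+1)%N))) //= leq_addr.
pose v k := u (psi k).
have Lv k : L2 (v k) by exact: Lu.
have aev : {ae P, forall w, cvgn (v ^~ w)}.
  apply: ae_cvg_fast => // k; apply/ltW/Hphi; exact: phi_psi.
(* The upper limit is defined and measurable everywhere, and it is the limit wherever the
   subsequence converges. *)
pose G w := fine (limn_esup (fun k => (v k w)%:E)).
have mG : measurable_fun setT G.
  apply: measurableT_comp; first exact: fine_measurable.
  apply: measurable_fun_limn_esup => k.
  by apply/measurable_EFinP; exact: L2mf (Lv k).
have GE : {ae P, forall w, v ^~ w @ \oo --> G w}.
  apply: filterS aev => w /cvg_ex[l vl].
  have H : (fun k => (v k w)%:E) @ \oo --> l%:E by apply/fine_cvgP; split; [exact: nearW|].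
  suff -> : G w = l by [].
  rewrite /G is_cvg_limn_esupE; last by apply/cvg_ex; exists l%:E.
  by rewrite (cvg_lim _ H).
(* Fatou's lemma for [(u n - v (j + k)) ^+ 2] as j grows. The shift by k keeps every index of the
   subsequence beyond [phi k]. *)
have key k n : (phi k <= n)%N ->
    (\int[P]_w ((u n w - G w) ^+ 2)%:E <= (4^-1 ^+ k)%:E)%E.
  move=> kn; pose h j w := ((u n w - v (j + k)%N w) ^+ 2)%:E.
  have mh j : measurable_fun setT (h j).
    apply/measurable_EFinP/measurable_funX/measurable_funB; exact: L2mf.
  have h0 j w : (0 <= h j w)%E by rewrite lee_fin sqr_ge0.
  apply: le_trans (_ : _ <= limn_einf (fun j => \int[P]_w h j w))%E _; last first.
    apply: limn_einf_le_cst => j; rewrite mean_EFin ?lee_fin; last first.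
      by have [] := L2B (Lu n) (Lv (j + k)%N).
    by apply/ltW/Hphi => //; apply: phi_psi; rewrite leq_addl.
  apply: le_trans (fatou P measurableT mh _); last by move=> *; exact: h0.
  apply: ae_ge0_le_integral => //.
  - by move=> w _; rewrite lee_fin sqr_ge0.
  - apply/measurable_EFinP/measurable_funX/measurable_funB => //; exact: L2mf.
  - move=> w _; rewrite limn_einf_lim; apply: lime_ge; first exact: is_cvg_einfs.
    apply: nearW => m; apply: le_ereal_inf_tmp => _ [j _ <-]; exact: h0.
  - rewrite (_ : (fun x => _) = (fun w => - limn_esup (fun j => - h j w))%E).
      apply: measurableT_comp => //; apply: measurable_fun_limn_esup => j.
      exact: measurableT_comp.
    by apply/funext => w; rewrite -limn_einfN; congr limn_einf; apply/funext => j; rewrite /comp oppeK.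
  apply: filterS GE => w vG _.
  have H : (fun j => h j w) @ \oo --> ((u n w - G w) ^+ 2)%:E.
    apply/fine_cvgP; split; first exact: nearW.
    rewrite /comp /h /= expr2.
    under eq_fun do rewrite expr2.
    have H : (fun j => u n w - v (j + k)%N w) @ \oo --> u n w - G w.
      by apply: cvgB; [exact: cvg_cst|rewrite (cvg_shiftn k (fun j => v j w))].
    exact: cvgM.
  rewrite is_cvg_limn_einfE; last by apply/cvg_ex; eexists; exact: H.
  by rewrite (cvg_lim _ H).
have Ld n k : (phi k <= n)%N -> L2 (fun w => u n w - G w).
  move=> kn; have mB : measurable_fun setT (fun w => u n w - G w).
    by apply: measurable_funB => //; exact: L2mf.
  split=> //; apply: ge0_itg; first exact: measurable_funX.
    by move=> w; exact: sqr_ge0.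
  by apply: le_lt_trans (key _ _ kn) _; rewrite ltry.
exists G => [|e e0].
  have := L2B (Lu (phi 0%N)) (Ld _ _ (leqnn (phi 0%N))).
  by apply: eq_L2 => w; rewrite subKr.
have [k ke] : exists k, 4^-1 ^+ k < e.
  have /cvgrPdist_lt /(_ e e0) [k _ /(_ k (leqnn k))] :
      (fun k => geometric 1 (4^-1 : R) k) @ \oo --> (0 : R).
    by apply: cvg_geometric; rewrite ger0_norm ?invr_ge0 //; lra.
  rewrite /geometric /= mul1r sub0r normrN ger0_norm ?exprn_ge0 // => ke.
  by exists k.
exists (phi k) => n kn; apply: le_lt_trans ke.
have := key _ _ kn; rewrite mean_EFin ?lee_fin //; exact: (Ld _ _ kn).2.
Qed.

End completeness.

(** * Discrete gradients and Walsh polynomials *)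

Definition flip (k : nat) (w : Omega) : Omega :=
  fun i => (w : nat -> bool) i (+) (i == k).

Lemma flipK k : involutive (flip k).
Proof. by move=> w; apply/funext => i; rewrite /flip -addbA addbb addbF. Qed.

Lemma flip_neq k (w : Omega) i : i != k -> (flip k w : nat -> bool) i = (w : nat -> bool) i.
Proof. by rewrite /flip => /negbTE ->; rewrite addbF. Qed.

Lemma measurable_coord n (B : set bool) :
  measurable ([set w | B ((w : nat -> bool) n)] : set Omega).
Proof. by apply: sub_sigma_algebra; exists n, B. Qed.

Lemma measurable_flip k : measurable_fun [set: Omega] (flip k).
Proof.
apply: (@measurability _ _ Omega Omega setT (flip k) coord_events) => // _ [_ [n [B ->]] <-].
rewrite setTI; have [->|nk] := eqVneq n k.
  rewrite (_ : _ @^-1` _ = [set w : Omega | (negb @^-1` B) ((w : nat -> bool) k)]).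
    exact: measurable_coord.
  by apply/seteqP; split => w; rewrite /flip /= eqxx addbT.
rewrite (_ : _ @^-1` _ = [set w : Omega | B ((w : nat -> bool) n)]).
  exact: measurable_coord.
by apply/seteqP; split => w /=; rewrite flip_neq.
Qed.

HB.instance Definition _ k :=
  isMeasurableFun.Build _ _ Omega Omega (flip k) (measurable_flip k).

(** The events on which [is_rademacher] prescribes P. Unlike single coordinate events they are
    closed under intersection, as the uniqueness theorem for measures requires. *)
Definition box_events : set (set Omega) :=
  [set A | exists n (B : nat -> set bool),
     A = [set w : Omega | forall i, (i < n)%N -> B i ((w : nat -> bool) i)]].

Lemma measurable_box A : box_events A -> measurable A.
Proof.
move=> [n [B ->]].
rewrite (_ : [set w | _] = \bigcap_(i < n) [set w : Omega | B i ((w : nat -> bool) i)]) //.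
by apply: bigcap_measurableType => i _; exact: measurable_coord.
Qed.

Lemma box_generates : (measurable : set (set Omega)) = <<s box_events>>.
Proof.
apply/seteqP; split => A.
  apply: smallest_sub; first exact: smallest_sigma_algebra.
  move=> _ [n [B ->]]; apply: sub_sigma_algebra.
  exists n.+1, (fun i => if i == n then B else setT).
  apply/seteqP; split => w /= H.
    by move=> i _; case: eqP => [->|].
  by have := H n (leqnn _); rewrite eqxx.
by apply: smallest_sub; [exact: sigma_algebra_measurable|exact: measurable_box].
Qed.

Lemma box_setI : setI_closed box_events.
Proof.
move=> _ _ [n [B ->]] [m [C ->]].
exists (maxn n m), (fun i => [set b | ((i < n)%N -> B i b) /\ ((i < m)%N -> C i b)]).
apply/seteqP; split => w /=.
  by move=> [HB HC] i _; split; [exact: HB|exact: HC].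
move=> H; split => i im.
  by apply: (H i _).1 => //; rewrite leq_max im.
by apply: (H i _).2 => //; rewrite leq_max im orbT.
Qed.

Lemma bernoulli_half_negb (R : realType) (B : set bool) :
  bernoulli_prob (2^-1 : R) (negb @^-1` B) = bernoulli_prob (2^-1 : R) B.
Proof.
have h01 : (0 <= (2^-1 : R) <= 1)%R by apply/andP; split; lra.
rewrite /bernoulli_prob h01.
have H b : (bernoulli_pmf (2^-1 : R) b)%:E = (2^-1)%:E.
  by rewrite /bernoulli_pmf; case: b; congr EFin; lra.
under eq_fsbigr do rewrite H.
under [RHS]eq_fsbigr do rewrite H.
rewrite (reindex_fsbig negb (negb @^-1` B) B) //.
split => //; first by move=> x y _ _ /negb_inj.
by move=> x Bx; exists (~~ x); rewrite /= ?negbK.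
Qed.

Section rademacher.
Context {R : realType} (P : probability Omega R) (hP : is_rademacher P).
Local Notation L2 := (L2 P).
Local Notation n2 := (n2 P).
Local Notation mean := (mean P).
Local Notation itg := (itg P).
Implicit Types F G : Omega -> R.

(** A fair sign is symmetric, so P and its image under the flip agree on boxes, which determine a
    probability. *)
Lemma flip_preserves k A : measurable A -> P (flip k @^-1` A) = P A.
Proof.
move=> mA; apply/esym.
apply: (measure_unique box_events (fun=> setT) box_generates box_setI _ _ P
  (pushforward P (flip k))) => //.
- move=> _; exists 0%N, (fun=> setT); apply/seteqP; split => w //=.
- by apply/seteqP; split => w // _; exists 0%N.
- move=> _ [n [B ->]]; rewrite /pushforward.
  pose B' i := if i == k then negb @^-1` B i else B i.
  transitivity (P [set w : Omega | forall i, (i < n)%N -> B' i ((w : nat -> bool) i)]).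
    apply: etrans (hP n B) _; rewrite hP; apply: eq_bigr => i _; rewrite /B'; case: eqP => // _.
    by rewrite bernoulli_half_negb.
  congr (P _); apply/seteqP; split => w /= H i ni; have := H i ni; rewrite /B' /flip;
    by case: eqP => _; rewrite ?addbT ?addbF.
- by move=> _; apply: le_lt_trans (@probability_le1 _ _ _ P _ measurableT) _; rewrite ltry.
Qed.

Lemma ge0_integral_flip k (f : Omega -> \bar R) :
  measurable_fun setT f -> (forall w, 0 <= f w)%E ->
  (\int[P]_w f (flip k w) = \int[P]_w f w)%E.
Proof.
move=> mf f0.
have := @ge0_integral_pushforward _ _ _ _ R (flip k) (measurable_flip k) P
  setT f measurableT mf (fun w _ => f0 w).
rewrite preimage_setT => <-; apply: eq_measure_integral => A mA _.
exact: flip_preserves.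
Qed.

Lemma measurable_fun_flip k F : measurable_fun setT F ->
  measurable_fun setT (F \o flip k).
Proof. by move=> mF; apply: measurableT_comp => //; exact: measurable_flip. Qed.

Lemma itg_flip k F : itg F -> itg (F \o flip k).
Proof.
move=> iF; have mF := itg_mf iF; case/integrableP : iF => _ HF.
apply/integrableP; split; first by apply/measurable_EFinP; exact: measurable_fun_flip mF.
rewrite (ge0_integral_flip k (f := fun w => `|(F w)%:E|%E)) //.
by apply: measurableT_comp => //; exact/measurable_EFinP.
Qed.

Lemma mean_flip k F : measurable_fun setT F -> mean (F \o flip k) = mean F.
Proof.
move=> mF; rewrite /mean /Rintegral; congr fine.
rewrite integralE [RHS]integralE; congr (_ - _)%E.
  rewrite -[RHS](ge0_integral_flip k) //.
    by apply: eq_integral => w _; rewrite !funeposE.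
  by apply: measurable_funepos; exact/measurable_EFinP.
rewrite -[RHS](ge0_integral_flip k) //.
  by apply: eq_integral => w _; rewrite !funenegE.
by apply: measurable_funeneg; exact/measurable_EFinP.
Qed.

Lemma L2_flip k F : L2 F -> L2 (F \o flip k).
Proof. by move=> [mF iF]; split; [exact: measurable_fun_flip|exact: (itg_flip k iF)]. Qed.

Lemma n2_flip k F : L2 F -> n2 (F \o flip k) = n2 F.
Proof. by move=> LF; apply: (mean_flip k (F := fun w => F w ^+ 2)); exact: itg_mf LF.2. Qed.

Local Notation X := (X R).

Lemma X_flip k w : X k (flip k w) = - X k w.
Proof. by rewrite /Defs.X /flip eqxx addbT; case: (_ k); rewrite ?opprK. Qed.

Lemma X_flip_neq j k w : j != k -> X j (flip k w) = X j w.
Proof. by move=> jk; rewrite /Defs.X flip_neq. Qed.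

Lemma measurable_X k : measurable_fun setT (X k).
Proof.
apply: measurable_fun_ifT => //; apply: (measurable_fun_bool true).
by rewrite setTI; exact: (measurable_coord k [set true]).
Qed.

Lemma X_sqr k w : X k w * X k w = 1.
Proof. by rewrite /Defs.X; case: ifP => _; rewrite ?mulr1 // mulrNN mulr1. Qed.

Lemma normX k w : `|X k w| = 1.
Proof. by rewrite /Defs.X; case: ifP => _; rewrite ?normrN normr1. Qed.

Lemma L2_X k F : L2 F -> L2 (fun w => X k w * F w).
Proof. by apply: (L2_bnd (C := 1)) => [|w]; [exact: measurable_X|rewrite normX]. Qed.

Lemma n2_X k F : n2 (fun w => X k w * F w) = n2 F.
Proof. by apply: eq_mean => w; rewrite exprMn expr2 X_sqr mul1r. Qed.

(** * Walsh functions *)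

Definition chi (s : seq nat) (w : Omega) : R := \prod_(i <- s) X i w.

Lemma measurable_chi s : measurable_fun setT (chi s).
Proof.
elim: s => [|k s IH].
  by rewrite (_ : chi _ = fun=> 1) //; apply/funext => w; rewrite /chi big_nil.
rewrite (_ : chi _ = fun w => X k w * chi s w); last first.
  by apply/funext => w; rewrite /chi big_cons.
by apply: measurable_funM => //; exact: measurable_X.
Qed.

Lemma chi_sqr s w : chi s w * chi s w = 1.
Proof. by rewrite /chi -big_split /= big1 // => i _; rewrite X_sqr. Qed.

Lemma norm_chi s w : `|chi s w| = 1.
Proof. by rewrite /chi normr_prod big1 // => i _; rewrite normX. Qed.

Lemma chi_flip k s w : uniq s ->
  chi s (flip k w) = if k \in s then - chi s w else chi s w.
Proof.
rewrite /chi; elim: s => [|j s IH] /=; first by rewrite !big_nil.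
move=> /andP[js us]; rewrite !big_cons inE IH // eq_sym.
have [jk|jk] := eqVneq j k; last by rewrite X_flip_neq //=; case: ifP => // _; rewrite mulrN.
by rewrite -{1 2 3}jk (negbTE js) X_flip mulNr.
Qed.

Lemma L2_chi s : L2 (chi s).
Proof.
have := L2_bnd (measurable_chi s) (C := 1) _ (L2cst P 1).
move=> H; apply: (eq_L2 _ (H _)) => w; first by rewrite mulr1.
by rewrite norm_chi.
Qed.

Lemma sorted_neq s t : sorted ltn s -> sorted ltn t -> s != t ->
  exists k, (k \in s) != (k \in t).
Proof.
move=> ss st; apply: contraNP => H; apply/eqP.
apply: (irr_sorted_eq ltn_trans ltnn) => // k.
by apply/eqP/negP => /negP K; apply: H; exists k.
Qed.

Lemma sorted_uniq_ltn s : sorted ltn s -> uniq s.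
Proof. exact: (sorted_uniq ltn_trans ltnn). Qed.

(** If the sets differ, flipping a coordinate that belongs to exactly one of them changes the sign
    of the product but not its mean. *)
Lemma mean_chi2 s t : sorted ltn s -> sorted ltn t ->
  mean (fun w => chi s w * chi t w) = (s == t)%:R.
Proof.
move=> ss st; have [->|st'] := eqVneq s t.
  by rewrite -[RHS](mean_cst P); apply: eq_mean => w; rewrite chi_sqr.
have [k kst] := sorted_neq ss st st'.
have := mean_flip k (itg_mf (L2M (L2_chi s) (L2_chi t))).
set m := mean (fun w => chi s w * chi t w).
rewrite (_ : mean _ = - m); first by move=> H /=; lra.
rewrite /m -meanN; last exact: L2M (L2_chi s) (L2_chi t).
apply: eq_mean => w /=; rewrite !chi_flip ?sorted_uniq_ltn //.
by move: kst; case: (k \in s); case: (k \in t) => //= _; rewrite ?mulNr ?mulrN.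
Qed.

Definition grad (k : nat) F w : R := 2^-1 * (X k w * (F w - F (flip k w))).

(** The factor [X k] absorbs the sign change of the difference. Because gradients do not see the
    k-th sign, a flip inside an expectation will act only on the Hessian factor beside them. *)
Lemma grad_flip k F w : grad k F (flip k w) = grad k F w.
Proof. by rewrite /grad X_flip flipK; ring. Qed.

Lemma gradD k F G w : grad k (fun w => F w + G w) w = grad k F w + grad k G w.
Proof. by rewrite /grad; ring. Qed.

Lemma gradB k F G w : grad k (fun w => F w - G w) w = grad k F w - grad k G w.
Proof. by rewrite /grad; ring. Qed.

Lemma gradZ k c F w : grad k (fun w => c * F w) w = c * grad k F w.
Proof. by rewrite /grad; ring. Qed.

Lemma gradN k F w : grad k (fun w => - F w) w = - grad k F w.
Proof. by rewrite /grad; ring. Qed.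

Lemma grad_cst k c w : grad k (fun=> c) w = 0.
Proof. by rewrite /grad; ring. Qed.

Lemma grad_sum I (r : seq I) (p : pred I) k (F : I -> Omega -> R) w :
  grad k (fun w => \sum_(i <- r | p i) F i w) w =
  \sum_(i <- r | p i) grad k (F i) w.
Proof.
by rewrite /grad -sumrB !mulr_sumr.
Qed.

Lemma L2_grad k F : L2 F -> L2 (grad k F).
Proof. by move=> LF; apply/L2Z/L2_X/L2B => //; exact: L2_flip. Qed.

Lemma n2_grad_le k F : L2 F -> n2 (grad k F) <= n2 F.
Proof.
move=> LF; have LFk := L2_flip k LF.
rewrite /grad n2Z; last by apply/L2_X/L2B.
rewrite n2_X.
have := n2D_le LF (L2N LFk); rewrite n2N (n2_flip k LF) => H.
have -> : (2^-1 ^+ 2 : R) = 4^-1 by field.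
rewrite mulrC ler_pdivrMr //; apply: le_trans H _; lra.
Qed.

Lemma grad_chi k s w : uniq s ->
  grad k (chi s) w = if k \in s then X k w * chi s w else 0.
Proof. by move=> us; rewrite /grad chi_flip //; case: ifP => _; [field|ring]. Qed.

(** The factors [X k] cancel and leave half the mean of [chi s] times [G - G o flip k]. Since
    [chi s] is odd under the flip, both halves contribute the same amount. *)
Lemma mean_grad_chi k s G : uniq s -> k \in s -> L2 G ->
  mean (fun w => grad k G w * (X k w * chi s w)) = mean (fun w => chi s w * G w).
Proof.
move=> us ks LG; have LGk := L2_flip k LG.
have H := mean_flip k (itg_mf (L2M (L2_chi s) LG)).
have e : mean ((fun w => chi s w * G w) \o flip k) =
    - mean (fun w => chi s w * (G \o flip k) w).
  rewrite -meanN; last exact: (L2M (L2_chi s) LGk).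
  by apply: eq_mean => w /=; rewrite chi_flip // ks mulNr.
transitivity (mean (fun w => 2^-1 * (chi s w * G w) +
   - 2^-1 * (chi s w * (G \o flip k) w))).
  apply: eq_mean => w; rewrite /grad /=.
  transitivity (2^-1 * (chi s w * (G w - G (flip k w))) * (X k w * X k w)); first ring.
  by rewrite X_sqr; ring.
rewrite meanD; try (by apply: itgZ; exact: (L2M (L2_chi s))).
rewrite !meanZ; try exact: (L2M (L2_chi s)).
by move: H; rewrite e => H; lra.
Qed.

Definition walsh (r : seq (seq nat)) (c : seq nat -> R) w : R :=
  \sum_(s <- r) c s * chi s w.

(** Strictly increasing lists represent finite sets of coordinates, one list per set, so that
    distinct indices give orthonormal Walsh functions. *)
Definition walsh_index (r : seq (seq nat)) := uniq r && all (sorted ltn) r.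

Lemma L2_walsh r c : L2 (walsh r c).
Proof. by apply: L2_sum => s _; apply/L2Z/L2_chi. Qed.

Lemma walsh_index_sorted r s : walsh_index r -> s \in r -> sorted ltn s.
Proof. by move=> /andP[_ /allP H] /H. Qed.

Lemma walsh_index_filter (p : pred (seq nat)) r :
  walsh_index r -> walsh_index [seq s <- r | p s].
Proof.
move=> /andP[ur sr]; rewrite /walsh_index filter_uniq //=.
by apply/allP => s; rewrite mem_filter => /andP[_ /(allP sr)].
Qed.

Lemma mean_chi_walsh r c s : walsh_index r -> sorted ltn s ->
  mean (fun w => chi s w * walsh r c w) = if s \in r then c s else 0.
Proof.
move=> wr ss.
transitivity (\sum_(t <- r) c t * (s == t)%:R).
  transitivity (mean (fun w => \sum_(t <- r) c t * (chi s w * chi t w))).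
    by apply: eq_mean => w; rewrite /walsh mulr_sumr; apply: eq_bigr => t _; ring.
  rewrite mean_sum; last by move=> t _; apply: itgZ; apply: L2M; exact: L2_chi.
  rewrite big_seq [RHS]big_seq; apply: eq_bigr => t tr.
  rewrite meanZ; last by apply: L2M; exact: L2_chi.
  by rewrite mean_chi2 // (walsh_index_sorted wr).
case: ifP => [sr|/negbT sr].
  rewrite (bigD1_seq s) //=; last by case/andP: wr.
  rewrite eqxx mulr1 big1 ?addr0 // => t /negbTE.
  by rewrite eq_sym => ->; rewrite mulr0.
rewrite big_seq big1 // => t tr; case: eqP => [e|]; last by rewrite mulr0.
by rewrite e tr in sr.
Qed.

Lemma n2_walsh r c : walsh_index r -> n2 (walsh r c) = \sum_(s <- r) c s ^+ 2.
Proof.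
move=> wr.
transitivity (mean (fun w => \sum_(s <- r) c s * (chi s w * walsh r c w))).
  apply: eq_mean => w; rewrite expr2 {1}/walsh mulr_suml.
  by apply: eq_bigr => s _; rewrite mulrA.
rewrite mean_sum; last by move=> s _; apply: itgZ; apply: L2M; [exact: L2_chi|exact: L2_walsh].
rewrite big_seq [RHS]big_seq; apply: eq_bigr => s sr.
rewrite meanZ; last by apply: L2M; [exact: L2_chi|exact: L2_walsh].
by rewrite mean_chi_walsh ?(walsh_index_sorted wr) // sr expr2.
Qed.

Lemma grad_walsh k r c w : walsh_index r ->
  grad k (walsh r c) w = X k w * walsh [seq s <- r | k \in s] c w.
Proof.
move=> wr; rewrite /walsh grad_sum big_filter mulr_sumr [RHS]big_mkcond /=.
rewrite big_seq [RHS]big_seq; apply: eq_bigr => s sr; rewrite gradZ.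
rewrite grad_chi; last exact/sorted_uniq_ltn/(walsh_index_sorted wr).
by case: ifP => _; [ring|rewrite mulr0].
Qed.

Lemma n2_grad_walsh k r c : walsh_index r ->
  n2 (grad k (walsh r c)) = \sum_(s <- r | k \in s) c s ^+ 2.
Proof.
move=> wr; rewrite (eq_n2 _ (fun w => grad_walsh k c w wr)) n2_X.
by rewrite n2_walsh ?walsh_index_filter // big_filter.
Qed.

Lemma sum_mem (s : seq nat) K : \sum_(0 <= k < K) (k \in s)%:R =
  (size [seq k <- iota 0 K | k \in s])%:R :> R.
Proof.
rewrite -natr_sum size_filter -sum1_count [in RHS]big_mkcond /index_iota subn0.
by congr (_%:R); apply: eq_bigr => k _; case: ifP.
Qed.

Lemma sum_mem_le (s : seq nat) K :
  \sum_(0 <= k < K) (k \in s)%:R <= (size s)%:R :> R.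
Proof.
rewrite sum_mem ler_nat uniq_leq_size ?filter_uniq ?iota_uniq // => k.
by rewrite mem_filter => /andP[].
Qed.

Lemma sum_mem_eq (s : seq nat) K : uniq s -> all (gtn K) s ->
  \sum_(0 <= k < K) (k \in s)%:R = (size s)%:R :> R.
Proof.
move=> us /allP sK; apply/eqP; rewrite eq_le sum_mem_le /= sum_mem ler_nat.
rewrite uniq_leq_size // => k ks; rewrite mem_filter ks mem_iota /=.
exact: sK.
Qed.

(** Each set is counted once for every coordinate it contains: the energy has the number operator as
    weight. *)
Lemma sum_n2_grad_walsh K r c : walsh_index r ->
  \sum_(0 <= k < K) n2 (grad k (walsh r c)) <=
  \sum_(s <- r) (size s)%:R * c s ^+ 2.
Proof.
move=> wr; under eq_bigr do rewrite n2_grad_walsh // big_mkcond /=.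
rewrite exchange_big /=; apply: ler_sum => s _.
rewrite (eq_bigr (fun k => (k \in s)%:R * c s ^+ 2)); last first.
  by move=> k _; case: ifP; rewrite ?mul1r ?mul0r.
by rewrite -mulr_suml ler_wpM2r ?sqr_ge0 ?sum_mem_le.
Qed.

(* Walsh coefficients of [- L^-1 F], given those of [F]. *)
Definition invsize (c : seq nat -> R) s := c s / (size s)%:R.

(** The weight [size s] meets the factor [(size s)^-2], so the gradient energy of [- L^-1 F] is
    bounded by the variance of [F] alone. *)
Lemma sum_n2_grad_invsize K r c : walsh_index r ->
  \sum_(0 <= k < K) n2 (grad k (walsh r (invsize c))) <= n2 (walsh r c).
Proof.
move=> wr; apply: le_trans (sum_n2_grad_walsh K (invsize c) wr) _.
rewrite n2_walsh //; apply: ler_sum => s _; rewrite /invsize.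
have [->|s0] := eqVneq (size s) 0%N; first by rewrite mul0r sqr_ge0.
rewrite exprMn mulrCA ler_piMr ?sqr_ge0 // expr2 mulrA divff ?pnatr_eq0 //.
by rewrite mul1r invf_le1 ?ltr0n ?lt0n // ler1n lt0n.
Qed.

(** Every [k] in [s] contributes the same term [c s / size s] times the mean of [chi s * G], and
    there are [size s] such [k]. The empty set has no such [k]: this is where centring enters. *)
Lemma walsh_ibp K r c G : walsh_index r -> [::] \notin r ->
  (forall s, s \in r -> all (gtn K) s) -> L2 G ->
  mean (fun w => walsh r c w * G w) =
  \sum_(0 <= k < K) mean (fun w => grad k G w * grad k (walsh r (invsize c)) w).
Proof.
move=> wr r0 rK LG.
have us s : s \in r -> uniq s by move=> sr; exact/sorted_uniq_ltn/(walsh_index_sorted wr).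
transitivity (\sum_(s <- r) c s * mean (fun w => chi s w * G w)).
  transitivity (mean (fun w => \sum_(s <- r) c s * (chi s w * G w))).
    by apply: eq_mean => w; rewrite /walsh mulr_suml; apply: eq_bigr => s _; rewrite mulrA.
  rewrite mean_sum; last by move=> s _; apply: itgZ; apply: L2M => //; exact: L2_chi.
  by apply: eq_bigr => s _; rewrite meanZ //; apply: L2M => //; exact: L2_chi.
rewrite (eq_bigr (fun k => \sum_(s <- r) (k \in s)%:R *
    (invsize c s * mean (fun w => chi s w * G w)))); last first.
  move=> k _.
  transitivity (mean (fun w => \sum_(s <- r | k \in s)
      invsize c s * (grad k G w * (X k w * chi s w)))).
    apply: eq_mean => w; rewrite grad_walsh // /walsh big_filter mulr_sumr mulr_sumr.
    by apply: eq_bigr => s _; ring.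
  have LX s : itg (fun w => grad k G w * (X k w * chi s w)).
    by apply: L2M; [exact: L2_grad|apply: L2_X; exact: L2_chi].
  rewrite mean_sum; last by move=> s _; exact: itgZ.
  rewrite big_mkcond /= big_seq [RHS]big_seq; apply: eq_bigr => s sr.
  case: ifP => ks; last by rewrite mul0r.
  by rewrite meanZ // mean_grad_chi ?mul1r // us.
rewrite exchange_big /= big_seq [RHS]big_seq; apply: eq_bigr => s sr.
rewrite -mulr_suml sum_mem_eq ?us ?rK // /invsize mulrA.
have s0 : size s != 0%N by apply: contraNneq r0 => /size0nil <-.
by congr (_ * _); field; rewrite pnatr_eq0.
Qed.

End rademacher.

(** * Convergence in L^2 *)

Lemma eq_cvgn (R : realType) (u v : nat -> R) (l : R) : u =1 v ->
  u @ \oo --> l -> v @ \oo --> l.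
Proof. by move=> /funext ->. Qed.

Lemma cvgnM (R : realType) (u v : nat -> R) (a b : R) :
  u @ \oo --> a -> v @ \oo --> b -> (fun n => u n * v n) @ \oo --> a * b.
Proof. by move=> ua vb; exact: cvgM. Qed.

Lemma cvgnD (R : realType) (u v : nat -> R) (a b : R) :
  u @ \oo --> a -> v @ \oo --> b -> (fun n => u n + v n) @ \oo --> a + b.
Proof. by move=> ua vb; exact: cvgD. Qed.

Lemma cvgnB (R : realType) (u v : nat -> R) (a b : R) :
  u @ \oo --> a -> v @ \oo --> b -> (fun n => u n - v n) @ \oo --> a - b.
Proof. by move=> ua vb; exact: cvgB. Qed.

Lemma cvgnC (R : realType) (a : R) : (fun _ : nat => a) @ \oo --> a.
Proof. exact: cvg_cst. Qed.
Arguments cvgnC {R} a.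

Lemma cvgn_sqrt (R : realType) (u : nat -> R) (a : R) :
  u @ \oo --> a -> (fun n => Num.sqrt (u n)) @ \oo --> Num.sqrt a.
Proof. by move=> ua; apply: continuous_cvg => //; exact: sqrt_continuous. Qed.

Lemma cvgn_unique (R : realType) (u : nat -> R) (a b : R) :
  u @ \oo --> a -> u @ \oo --> b -> a = b.
Proof. by move=> ua ub; rewrite -(cvg_lim _ ua) // -(cvg_lim _ ub). Qed.

Lemma cvgn_sum (R : realType) (I : Type) (r : seq I) (u : I -> nat -> R) (a : I -> R) :
  (forall i, u i @ \oo --> a i) ->
  (fun n => \sum_(i <- r) u i n) @ \oo --> \sum_(i <- r) a i.
Proof.
move=> ua; elim: r => [|i r IH].
  by rewrite big_nil; apply: eq_cvgn (cvgnC 0) => n; rewrite big_nil.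
rewrite big_cons; apply: eq_cvgn (cvgnD (ua i) IH) => n.
by rewrite big_cons.
Qed.

Section L2_convergence.
Context {dT : measure_display} {T : measurableType dT} {R : realType}.
Variable P : probability T R.
Local Notation L2 := (L2 P).
Local Notation n2 := (n2 P).
Local Notation mean := (mean P).
Implicit Types (f g h G H : T -> R) (u v : nat -> T -> R).

Lemma Lnorm2_sqrt f : L2 f -> ('N[P]_2%:E[EFin \o f] = (Num.sqrt (n2 f))%:E)%E.
Proof.
move=> Lf; rewrite unlock /Lnorm.
under eq_integral do rewrite /= powR_mulrn // real_normK ?num_real //.
rewrite mean_EFin; last exact: Lf.2.
by rewrite poweR_EFin powR12_sqrt // n2_ge0.
Qed.

Lemma Lfun2P f : f \in Lfun P 2%:E <-> L2 f.
Proof.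
split=> [fL|Lf].
  split; last exact: Lfun2_integrable_sqr.
  by move: fL => /andP[]; rewrite inE.
rewrite inE; apply/andP; split; first by rewrite inE; exact: Lf.1.
by rewrite inE /finite_norm /= Lnorm2_sqrt // ltry.
Qed.

Definition cvL2 u G := L2 G /\ n2 (fun w => u n w - G w) @[n --> \oo] --> (0 : R).

Lemma cvL2_eps u G : L2 G ->
  (forall e, 0 < e -> exists N, forall n, (N <= n)%N -> n2 (fun w => u n w - G w) < e) ->
  cvL2 u G.
Proof.
move=> LG H; split=> //; apply/cvgrPdist_lt => e e0.
have [N HN] := H e e0; exists N => // n /= Nn.
by rewrite sub0r normrN ger0_norm ?n2_ge0 // HN.
Qed.

Lemma cvL2_elim u G : cvL2 u G -> forall e, 0 < e -> exists N, forall n, (N <= n)%N ->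
  n2 (fun w => u n w - G w) < e.
Proof.
move=> [LG /cvgrPdist_lt H] e e0; have [N _ HN] := H e e0; exists N => n Nn.
have := HN n Nn; by rewrite sub0r normrN ger0_norm ?n2_ge0.
Qed.

Lemma cvg_L2P (P' := P) u G : (forall n, L2 (u n)) ->
  (G \in Lfun P' 2%:E /\ ('N[P']_2%:E[EFin \o (u n \- G)%R] @[n --> \oo] --> 0)%E)
  <-> cvL2 u G.
Proof.
move=> Lu; split=> -[] GL H.
  have LG : L2 G by apply/Lfun2P.
  split=> //.
  have H2 : Num.sqrt (n2 (fun w => u n w - G w)) @[n --> \oo] --> (0 : R).
    move: H; under eq_fun do rewrite (Lnorm2_sqrt (L2B (Lu _) LG)).
    by move=> /fine_cvgP[_].
  have := cvgnM H2 H2; rewrite mulr0; apply: eq_cvgn => n.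
  by rewrite -expr2 sqr_sqrtr ?n2_ge0.
split; first exact/Lfun2P.
under eq_fun do rewrite (Lnorm2_sqrt (L2B (Lu _) GL)).
apply/fine_cvgP; split; first exact: nearW.
rewrite /comp /=.
have := cvgn_sqrt H.
by rewrite sqrtr0.
Qed.

Lemma cvL2_unique u G H : (forall n, L2 (u n)) -> cvL2 u G -> cvL2 u H ->
  n2 (fun w => G w - H w) = 0.
Proof.
move=> Lu cG cH; apply/eqP; rewrite eq_le n2_ge0 andbT.
apply/ler_addgt0Pl => e e0; rewrite addr0.
have e4 : 0 < e / 4 by lra.
have [N HN] := cvL2_elim cG e4; have [M HM] := cvL2_elim cH e4.
pose n := maxn N M.
have h1 := HN n (leq_maxl _ _); have h2 := HM n (leq_maxr _ _).
have := n2B_le cG.1 (Lu n) cH.1; rewrite (n2BC P G (u n)) => h3; lra.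
Qed.

(** Needed because sequences built from versions of L^2 limits agree only up to null sets, and those
    built from shifted kernels only from some rank on. *)
Lemma near0_cvL2 u v G : (forall n, L2 (u n)) -> (forall n, L2 (v n)) ->
  (exists N, forall n, (N <= n)%N -> n2 (fun w => v n w - u n w) = 0) ->
  cvL2 u G -> cvL2 v G.
Proof.
move=> Lu Lv [N HN] cG; apply: cvL2_eps; first exact: cG.1.
move=> e e0; have e2 : 0 < e / 2 by lra.
have [M HM] := cvL2_elim cG e2; exists (maxn N M) => n.
rewrite geq_max => /andP[Nn Mn].
have := n2B_le (Lv n) (Lu n) cG.1; rewrite HN //; have := HM n Mn; lra.
Qed.

Lemma cvL2_cst G : L2 G -> cvL2 (fun=> G) G.
Proof.
move=> LG; apply: cvL2_eps => // e e0; exists 0%N => n _.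
rewrite (_ : n2 _ = 0) //; rewrite -(mean_cst P 0); apply: eq_mean => w.
by rewrite subrr expr0n.
Qed.

Lemma cvL2D u v G H : (forall n, L2 (u n)) -> (forall n, L2 (v n)) ->
  cvL2 u G -> cvL2 v H -> cvL2 (fun n w => u n w + v n w) (fun w => G w + H w).
Proof.
move=> Lu Lv cG cH; apply: cvL2_eps; first exact: L2D cG.1 cH.1.
move=> e e0; have e2 : 0 < e / 4 by lra.
have [M HM] := cvL2_elim cG e2; have [N HN] := cvL2_elim cH e2.
exists (maxn N M) => n; rewrite geq_max => /andP[Nn Mn].
have h1 := HM n Mn; have h2 := HN n Nn.
have := n2D_le (L2B (Lu n) cG.1) (L2B (Lv n) cH.1).
rewrite (eq_n2 P (g := fun w => u n w + v n w - (G w + H w))); first lra.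
by move=> w; ring.
Qed.

Lemma cvL2Z c u G : (forall n, L2 (u n)) ->
  cvL2 u G -> cvL2 (fun n w => c * u n w) (fun w => c * G w).
Proof.
move=> Lu [LG cG]; split; first exact: L2Z.
have := cvgnM (cvgnC (c ^+ 2)) cG; rewrite mulr0; apply: eq_cvgn => n; rewrite -n2Z; last exact: L2B.
by apply: eq_n2 => w; ring.
Qed.

Lemma cvL2N u G : (forall n, L2 (u n)) ->
  cvL2 u G -> cvL2 (fun n w => - u n w) (fun w => - G w).
Proof.
move=> Lu [LG cG]; split; first exact: L2N.
move: cG; apply: eq_cvgn => n.
by rewrite -n2N; apply: eq_n2 => w; ring.
Qed.

Lemma cvL2_sum (I : eqType) (r : seq I) (u : I -> nat -> T -> R) (G : I -> T -> R) :
  (forall i, i \in r -> (forall n, L2 (u i n)) /\ cvL2 (u i) (G i)) ->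
  cvL2 (fun n w => \sum_(i <- r) u i n w) (fun w => \sum_(i <- r) G i w).
Proof.
elim: r => [|i r IH] Hr.
  rewrite (_ : (fun n w => _) = (fun (n : nat) (w : T) => 0)); last first.
    by apply/funext => n; apply/funext => w; rewrite big_nil.
  rewrite (_ : (fun w => _) = (fun (w : T) => 0)); last first.
    by apply/funext => w; rewrite big_nil.
  exact/cvL2_cst/L2cst.
rewrite (_ : (fun n w => _) = (fun n w => u i n w + \sum_(i <- r) u i n w)); last first.
  by apply/funext => n; apply/funext => w; rewrite big_cons.
rewrite (_ : (fun w => \sum_(_ <- _) _) = (fun w => G i w + \sum_(i <- r) G i w)); last first.
  by apply/funext => w; rewrite big_cons.
have Hr' j : j \in r -> (forall n, L2 (u j n)) /\ cvL2 (u j) (G j).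
  by move=> jr; apply: Hr; rewrite inE jr orbT.
have [Lu cu] := Hr i (mem_head _ _).
apply: cvL2D => //; last exact: IH.
move=> n; rewrite (_ : (fun w => _) = (fun w => \sum_(j <- r | j \in r) u j n w)).
  by apply: L2_sum => j /Hr' [].
by apply/funext => w; rewrite big_seq.
Qed.

Lemma cvg_mean_mul u G H : (forall n, L2 (u n)) -> L2 H -> cvL2 u G ->
  mean (fun w => u n w * H w) @[n --> \oo] --> mean (fun w => G w * H w).
Proof.
move=> Lu LH [LG cG].
suff K : (mean (fun w => u n w * H w) - mean (fun w => G w * H w)) @[n --> \oo] --> (0 : R).
  have := cvgnD K (cvgnC (mean (fun w => G w * H w))); rewrite add0r.
  by apply: eq_cvgn => n; rewrite subrK.
apply/norm_cvg0P.
have K : Num.sqrt (n2 (fun w => u n w - G w) * n2 H) @[n --> \oo] --> (0 : R).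
  have cM := cvgnM cG (cvgnC (n2 H)); rewrite mul0r in cM.
  by have := cvgn_sqrt cM; rewrite sqrtr0.
apply: (squeeze_cvgr _ (cvg_cst 0) K); apply: nearW => n /=.
rewrite normr_ge0 /= -sqrtr_sqr ler_sqrt; last by rewrite mulr_ge0 ?n2_ge0.
rewrite -meanB; [|exact: L2M|exact: L2M].
apply: le_trans (cauchy_schwarz (L2B (Lu n) LG) LH).
by rewrite (eq_mean P (g := fun w => (u n w - G w) * H w)) // => w; ring.
Qed.

Lemma cvg_n2 u G : (forall n, L2 (u n)) -> cvL2 u G ->
  n2 (u n) @[n --> \oo] --> n2 G.
Proof.
move=> Lu cG; have LG := cG.1.
have K := cvg_mean_mul Lu LG cG.
have := cvgnB (cvgnD cG.2 (cvgnM (cvgnC (2 : R)) K)) (cvgnC (n2 G)).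
rewrite (_ : 0 + 2 * _ - _ = n2 G); last first.
  rewrite (eq_mean P (g := fun w => G w ^+ 2)) -/(n2 G); first ring.
  by move=> w; rewrite expr2.
apply: eq_cvgn => n; rewrite n2D ?n2N //; last exact: L2N.
rewrite (_ : mean (fun w => u n w * - G w) = - mean (fun w => u n w * G w)); first ring.
by rewrite -meanN; [apply: eq_mean => w; ring|exact: L2M].
Qed.

Lemma le_n2_lim u v G H : (forall n, L2 (u n)) -> (forall n, L2 (v n)) ->
  cvL2 u G -> cvL2 v H -> (forall n, n2 (u n) <= n2 (v n)) -> n2 G <= n2 H.
Proof.
move=> Lu Lv cG cH uv; apply: ler_cvg_to (cvg_n2 Lu cG) (cvg_n2 Lv cH) _.
exact: nearW.
Qed.

Lemma cvg_mean u G : (forall n, L2 (u n)) -> cvL2 u G ->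
  mean (u n) @[n --> \oo] --> mean G.
Proof.
move=> Lu cG; have := cvg_mean_mul Lu (L2cst P 1) cG.
rewrite (eq_mean P (g := G)); last by move=> w; rewrite mulr1.
apply: eq_cvgn => n.
by apply: eq_mean => w; rewrite mulr1.
Qed.

Lemma cvL2_shift u G : cvL2 u G -> cvL2 (fun n => u n.+1) G.
Proof.
move=> [LG cG]; split=> //.
by rewrite (cvg_shiftS (fun n => n2 (fun w => u n w - G w))).
Qed.

Lemma cauchy_cvL2 u : (forall n, L2 (u n)) ->
  (forall e, 0 < e -> exists N, forall m n, (N <= m)%N -> (m <= n)%N ->
     n2 (fun w => u n w - u m w) < e) ->
  exists G, cvL2 u G.
Proof.
move=> Lu H; have [|G LG HG] := L2_complete Lu; last by exists G; exact: cvL2_eps.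
move=> e e0; have [N HN] := H e e0; exists N => m n Nm Nn.
have [mn|/ltnW nm] := leqP m n; last exact: HN.
by rewrite n2BC; exact: HN.
Qed.

Lemma cvL2_cauchy u G : (forall n, L2 (u n)) -> cvL2 u G ->
  forall e, 0 < e -> exists N, forall m n, (N <= m)%N -> (m <= n)%N ->
     n2 (fun w => u n w - u m w) < e.
Proof.
move=> Lu cG e e0; have e4 : 0 < e / 4 by lra.
have [N HN] := cvL2_elim cG e4; exists N => m n Nm mn.
have h1 := HN m Nm; have h2 := HN n (leq_trans Nm mn).
have := n2B_le (Lu n) cG.1 (Lu m); rewrite (n2BC P G); lra.
Qed.

End L2_convergence.

Section grad_convergence.
Context {R : realType} (P : probability Omega R) (hP : is_rademacher P).

Lemma cvL2_grad k (u : nat -> Omega -> R) G : (forall n, L2 P (u n)) ->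
  cvL2 P u G -> cvL2 P (fun n => grad k (u n)) (grad k G).
Proof.
move=> Lu cG; apply: cvL2_eps; first exact: L2_grad cG.1.
move=> e e0; have [N HN] := cvL2_elim cG e0; exists N => n Nn.
apply: le_lt_trans (HN n Nn).
apply: le_trans (n2_grad_le hP k (L2B (Lu n) cG.1)).
by rewrite (eq_n2 P (g := grad k (fun w => u n w - G w))) // => w; rewrite gradB.
Qed.

Lemma cvg_L2_cvL2 (u : nat -> Omega -> R) G : (forall n, L2 P (u n)) ->
  cvg_L2 P u G <-> cvL2 P u G.
Proof. exact: cvg_L2P. Qed.

(** Only existence of a limit matters: [xget] then returns one of its versions. All that is known of
    [J], [D] and [Linv] comes from here. *)
Lemma lim_L2_cvL2 (u : nat -> Omega -> R) G : (forall n, L2 P (u n)) ->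
  cvL2 P u G -> cvL2 P u (lim_L2 P u).
Proof.
move=> Lu /(cvg_L2_cvL2 _ Lu) cG; apply/(cvg_L2_cvL2 _ Lu).
by apply: (@xgetPex _ _ [set G | cvg_L2 P u G]); exists G.
Qed.

End grad_convergence.

(** * Chaos expansions *)

Section index_lists.

(** The tuples summed in the N-th partial sum of [J], turned into plain lists so that indices of
    different orders can be mixed in one Walsh polynomial. *)
Definition idx (q N : nat) : seq (seq nat) :=
  [seq map val (val t) | t <- [seq t <- enum {: q.-tuple 'I_N} | sorted ltn (map val (val t))]].

Lemma mem_idx q N s :
  (s \in idx q N) = [&& size s == q, sorted ltn s & all (gtn N) s].
Proof.
apply/mapP/and3P => [[t]|[/eqP sq ss sN]].
  rewrite mem_filter => /andP[st _] ->; rewrite size_map size_tuple eqxx st; split=> //.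
  by apply/allP => _ /mapP[i _ ->]; exact: ltn_ord.
(* [inord] needs an inhabited ordinal type; for N = 0 only the empty list remains. *)
case: N sN => [|N] sN.
  have s0 : s = [::] by case: s sN {sq ss} => [|x s] //= /andP[].
  have q0 : q = 0%N by rewrite -sq s0.
  have sz : size ([::] : seq 'I_0) == q by rewrite q0.
  by exists (Tuple sz); rewrite ?s0 // mem_filter mem_enum.
have sz : size (map (@inord N) s) == q by rewrite size_map sq.
have e : map val (map (@inord N) s) = s.
  rewrite -map_comp map_id_in // => i si /=.
  by rewrite inordK //; exact: (allP sN).
by exists (Tuple sz); rewrite /= ?e // mem_filter /= e ss mem_enum.
Qed.

Lemma uniq_idx q N : uniq (idx q N).
Proof.
rewrite map_inj_uniq; first by apply: filter_uniq; exact: enum_uniq.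
by move=> t u tu; apply/val_inj/(inj_map val_inj).
Qed.

Lemma walsh_index_idx q N : walsh_index (idx q N).
Proof.
rewrite /walsh_index uniq_idx; apply/allP => s.
by rewrite mem_idx => /and3P[].
Qed.

Lemma idx_mono q N M : (N <= M)%N -> {subset idx q N <= idx q M}.
Proof.
move=> NM s; rewrite !mem_idx => /and3P[-> -> sN] /=.
by apply/allP => i /(allP sN) /= iN; exact: leq_trans iN NM.
Qed.

End index_lists.

Section kernels.
Context {R : realType}.

(** A kernel read on lists. The default tuple of zeros is reached only for lists of the wrong
    length, which never occur in [idx q N]. *)
Definition seqker (q : nat) (f : q.-tuple nat -> R) (s : seq nat) : R :=
  f (insubd (nseq_tuple q 0%N) s).

Lemma seqker_val q (f : q.-tuple nat -> R) (t : q.-tuple nat) : seqker f t = f t.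
Proof. by rewrite /seqker; congr f; apply/val_inj; rewrite val_insubd size_tuple eqxx. Qed.

Lemma seqker_perm q (f : q.-tuple nat -> R) s s' : l02 f ->
  size s = q -> perm_eq s s' -> seqker f s = seqker f s'.
Proof.
move=> [fp _ _] sq pss; apply: fp.
by rewrite !val_insubd -(perm_size pss) sq eqxx.
Qed.

Lemma seqker_nuniq q (f : q.-tuple nat -> R) s : l02 f ->
  size s = q -> ~~ uniq s -> seqker f s = 0.
Proof. by move=> [_ fu _] sq us; apply: fu; rewrite val_insubd sq eqxx. Qed.

Definition kercoef (q : nat) (f : q.-tuple nat -> R) (s : seq nat) : R :=
  q`!%:R * seqker f s.

Lemma sum_sqnorm_le q (f : q.-tuple nat -> R) (l : seq (q.-tuple nat)) : uniq l ->
  ((\sum_(t <- l) f t ^+ 2)%:E <= sqnorm f)%E.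
Proof.
move=> ul; apply: esum_ge; exists [set` l]; first by split=> //; exact: finite_seq.
by rewrite -fsbig_seq // sumEFin.
Qed.

Definition perm_tuples (q : nat) (r : seq (seq nat)) : seq (q.-tuple nat) :=
  flatten [seq map (insubd (nseq_tuple q 0%N)) (permutations s) | s <- r].

Lemma mem_perm_tuples q r t : all (fun s => size s == q) r ->
  t \in perm_tuples q r -> exists2 s, s \in r & perm_eq s (val t).
Proof.
move=> /allP rq /flatten_mapP[s sr /mapP[u]]; rewrite mem_permutations => us ->.
by exists s => //; rewrite val_insubd -(eqP (rq s sr)) (perm_size us) eqxx perm_sym.
Qed.

Lemma uniq_perm_tuples q r : all (fun s => size s == q) r -> walsh_index r ->
  uniq (perm_tuples q r).
Proof.
rewrite /walsh_index; elim: r => [//|s r IH] /= /andP[sq rq] /andP[/andP[sr ur] /andP[ss ar]].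
rewrite cat_uniq; apply/and3P; split.
- rewrite map_inj_in_uniq ?permutations_uniq // => u v.
  rewrite !mem_permutations => us vs /(congr1 val).
  by rewrite !val_insubd (perm_size us) (perm_size vs) sq.
- apply/hasPn => t /(mem_perm_tuples rq)[s' s'r s't]; apply/negP => /mapP[u].
  rewrite mem_permutations => us tu.
  have {tu} tu : val t = u by rewrite tu val_insubd (perm_size us) sq.
  move: s't; rewrite tu => /perm_trans /(_ us) s's.
  have : s' = s.
    apply: (irr_sorted_eq ltn_trans ltnn) => //; first exact: (allP ar).
    exact: perm_mem.
  by move=> e; rewrite -e s'r in sr.
- by apply: IH => //; rewrite ur.
Qed.

(** A symmetric kernel takes the same value on the q! rearrangements of an increasing list, and
    different increasing lists have disjoint sets of rearrangements. The left side is thus a finite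
    part of the sum over all tuples. *)
Lemma sum_seqker_le q (f : q.-tuple nat -> R) N : l02 f ->
  ((q`!%:R * \sum_(s <- idx q N) seqker f s ^+ 2)%:E <= sqnorm f)%E.
Proof.
move=> lf.
have rq : all (fun s => size s == q) (idx q N).
  by apply/allP => s; rewrite mem_idx => /and3P[].
apply: le_trans (sum_sqnorm_le f (uniq_perm_tuples rq (walsh_index_idx q N))).
rewrite lee_fin /perm_tuples big_flatten /= big_map mulr_sumr.
rewrite big_seq [leRHS]big_seq; apply: ler_sum => s sN.
have sq : size s = q by apply/eqP/(allP rq).
have us : uniq s by move: sN; rewrite mem_idx => /and3P[_ /sorted_uniq_ltn].
rewrite big_map.
rewrite (eq_big_seq (fun=> seqker f s ^+ 2)); last first.
  by move=> u; rewrite mem_permutations perm_sym => su; rewrite (seqker_perm lf sq su).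
by rewrite big_const_seq count_predT size_permutations // sq iter_addr_0 mulr_natl.
Qed.

Lemma sum_kercoef_le q (f : q.-tuple nat -> R) N : l02 f ->
  ((\sum_(s <- idx q N) kercoef f s ^+ 2)%:E <= q`!%:R%:E * sqnorm f)%E.
Proof.
move=> lf; have := sum_seqker_le N lf.
rewrite -(@lee_pmul2l _ q`!%:R%:E) // ?lte_fin ?ltr0n ?fact_gt0 //.
apply: le_trans; rewrite -EFinM lee_fin mulrA mulr_sumr.
by apply: ler_sum => s _; rewrite /kercoef exprMn expr2.
Qed.

End kernels.

(** * Multiple integrals as L^2 limits of Walsh polynomials *)

Section multiple_integrals.
Context {R : realType} (P : probability Omega R) (hP : is_rademacher P).
Local Notation L2 := (L2 P).
Local Notation n2 := (n2 P).
Local Notation mean := (mean P).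
Local Notation cvL2 := (cvL2 P).

Lemma partial_JE q (f : q.-tuple nat -> R) :
  (fun N w => q`!%:R * \sum_(t : q.-tuple 'I_N | sorted ltn (map val t))
      f [tuple of map val t] * \prod_(i <- t) X R (val i) w) =
  (fun N => walsh (idx q N) (kercoef f)).
Proof.
apply/funext => N; apply/funext => w; rewrite /walsh big_map big_filter.
rewrite big_enum_cond mulr_sumr; apply: eq_big => [t|t _]; first by [].
by rewrite /kercoef -mulrA -(seqker_val f) /chi big_map.
Qed.

Lemma walsh_sub r r' (c : seq nat -> R) w : walsh_index r -> walsh_index r' ->
  {subset r <= r'} ->
  walsh r' c w - walsh r c w = walsh [seq s <- r' | s \notin r] c w.
Proof.
move=> wr wr' rr'; rewrite /walsh (bigID (mem r)) /= big_filter.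
rewrite (_ : \sum_(s <- r' | s \in r) _ = \sum_(s <- r) c s * chi s w).
  by rewrite addrC addrK.
rewrite -big_filter; apply/perm_big/uniq_perm.
- by rewrite filter_uniq //; case/andP: wr'.
- by case/andP: wr.
- move=> s; rewrite mem_filter; case sr: (s \in r) => //=.
  by rewrite (rr' _ sr).
Qed.

Lemma n2_walsh_sub r r' (c : seq nat -> R) : walsh_index r -> walsh_index r' ->
  {subset r <= r'} ->
  n2 (fun w => walsh r' c w - walsh r c w) =
  \sum_(s <- r') c s ^+ 2 - \sum_(s <- r) c s ^+ 2.
Proof.
move=> wr wr' rr'.
rewrite (eq_n2 P (fun w => walsh_sub c w wr wr' rr')).
rewrite (n2_walsh hP) ?walsh_index_filter // big_filter.
rewrite [\sum_(s <- r') _](bigID (mem r)) /=.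
rewrite (_ : \sum_(s <- r' | s \in r) _ = \sum_(s <- r) c s ^+ 2).
  by rewrite addrC addrK.
rewrite -big_filter; apply/perm_big/uniq_perm.
- by rewrite filter_uniq //; case/andP: wr'.
- by case/andP: wr.
- move=> s; rewrite mem_filter; case sr: (s \in r) => //=.
  by rewrite (rr' _ sr).
Qed.

(** By orthogonality the squared distance of two partial sums is the difference of their sums of
    squares, which form a bounded nondecreasing sequence. *)
Lemma walsh_cauchy (r : nat -> seq (seq nat)) (c : seq nat -> R) C :
  (forall N, walsh_index (r N)) ->
  (forall N M, (N <= M)%N -> {subset r N <= r M}) ->
  (forall N, \sum_(s <- r N) c s ^+ 2 <= C) ->
  exists G, cvL2 (fun N => walsh (r N) c) G.
Proof.
move=> wr rm rC; apply: cauchy_cvL2; first by move=> N; exact: L2_walsh.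
pose a N := \sum_(s <- r N) c s ^+ 2.
have am : {homo a : n m / (n <= m)%N >-> n <= m}.
  move=> n m nm; rewrite -subr_ge0 /a -n2_walsh_sub //; last exact: rm.
  exact: n2_ge0.
have ca : cvgn a.
  by apply: nondecreasing_is_cvgn; [exact: am|exists C => _ [n _ <-]; exact: rC].
move=> e e0; move: (ca) => /cvgrPdist_lt /(_ e e0) [N _ HN].
exists N => m n Nm mn; rewrite n2_walsh_sub //; last exact: rm.
have lea k : a k <= limn a.
  by apply: nondecreasing_cvgn_le => //; exact: am.
have := HN m Nm; rewrite /= ger0_norm; last by rewrite subr_ge0.
have := lea n; rewrite -/(a n) -/(a m); lra.
Qed.

Lemma J_cvL2 q (f : q.-tuple nat -> R) : l02 f ->
  cvL2 (fun N => walsh (idx q N) (kercoef f)) (J P f).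
Proof.
move=> lf; rewrite /J partial_JE.
have [|||G] := @walsh_cauchy (idx q) (kercoef f) (fine (q`!%:R%:E * sqnorm f)%E).
- by move=> N; exact: walsh_index_idx.
- by move=> N M; exact: idx_mono.
- move=> N; rewrite -lee_fin fineK; first exact: sum_kercoef_le.
  have [_ _ fi] := lf; rewrite fin_numM // ge0_fin_numE // esum_ge0 // => t _.
  by rewrite lee_fin sqr_ge0.
by move=> cG; apply: lim_L2_cvL2 cG => N; exact: L2_walsh.
Qed.

Lemma L2_J q (f : q.-tuple nat -> R) : l02 f -> L2 (J P f).
Proof. by move=> /J_cvL2 []. Qed.

Lemma l02Z q (f : q.-tuple nat -> R) c : l02 f -> l02 (fun t => c * f t).
Proof.
move=> [fp fu fi]; split.
- by move=> t t' /fp ->.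
- by move=> t /fu ->; rewrite mulr0.
- apply: (@le_lt_trans _ _ ((c ^+ 2)%:E * sqnorm f)%E); last first.
    by rewrite lte_mul_pinfty // lee_fin sqr_ge0.
  apply: ge_ereal_sup => _ [A [fA _] <-].
  rewrite fsbig_finite //= sumEFin.
  rewrite (eq_bigr (fun t => c ^+ 2 * f t ^+ 2)); last by move=> t _; rewrite exprMn.
  rewrite -mulr_sumr EFinM lee_wpmul2l ?lee_fin ?sqr_ge0 //.
  by apply: esum_ge; exists A => //; rewrite fsbig_finite //= sumEFin.
Qed.

(** Both sides are versions of the same L^2 limit, so the equality holds only up to a null set. *)
Lemma JZ q (f : q.-tuple nat -> R) c : l02 f ->
  n2 (fun w => J P (fun t => c * f t) w - c * J P f w) = 0.
Proof.
move=> lf; have H := J_cvL2 (l02Z c lf).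
have K := cvL2Z c (fun N => L2_walsh _ _ _) (J_cvL2 lf).
apply: (cvL2_unique _ H _) => [N|]; first exact: L2_walsh.
move: K; congr cvL2; apply/funext => N; apply/funext => w.
rewrite /walsh mulr_sumr; apply: eq_bigr => s _.
by rewrite /kercoef /seqker; ring.
Qed.

Lemma mean_J q (f : q.-tuple nat -> R) : l02 f -> (0 < q)%N -> mean (J P f) = 0.
Proof.
move=> lf q0; have := cvg_mean (fun N => L2_walsh _ _ _) (J_cvL2 lf).
have e N : mean (walsh (idx q N) (kercoef f)) = 0.
  have := mean_chi_walsh hP (kercoef f) (walsh_index_idx q N) (isT : sorted ltn [::]).
  rewrite mem_idx /= eq_sym -[q == 0%N]negbK -lt0n q0 /= => <-.
  by apply: eq_mean => w; rewrite /chi big_nil mul1r.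
by move=> H; apply: cvgn_unique (eq_cvgn (v := fun=> 0) e H) (cvgnC 0).
Qed.

End multiple_integrals.

(** * Truncated chaos expansions *)

Section chaos_expansion.
Context {R : realType} (P : probability Omega R) (hP : is_rademacher P).
Local Notation L2 := (L2 P).
Local Notation n2 := (n2 P).
Local Notation mean := (mean P).
Local Notation cvL2 := (cvL2 P).
Implicit Types (F : Omega -> R) (f g : kernels R).

Definition idxs (l : seq nat) (M : nat) := flatten [seq idx n M | n <- l].

Lemma mem_idxs l M s :
  (s \in idxs l M) = [&& size s \in l, sorted ltn s & all (gtn M) s].
Proof.
apply/flatten_mapP/and3P => [[n nl]|[sl ss sM]].
  by rewrite mem_idx => /and3P[/eqP -> -> ->].
by exists (size s) => //; rewrite mem_idx eqxx ss sM.
Qed.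

Lemma walsh_index_idxs l M : uniq l -> walsh_index (idxs l M).
Proof.
move=> ul; rewrite /walsh_index; apply/andP; split; last first.
  by apply/allP => s; rewrite mem_idxs => /and3P[].
elim: l ul => [//|n l IH] /= /andP[nl ul].
rewrite /idxs /= cat_uniq uniq_idx IH // andbT; apply/hasPn => s.
rewrite -/(idxs l M) mem_idxs => /and3P[sl _ _]; rewrite mem_idx.
by apply/negP => /and3P[/eqP e _ _]; rewrite -e sl in nl.
Qed.

Lemma big_idxs l M (a : seq nat -> R) :
  \sum_(s <- idxs l M) a s = \sum_(n <- l) \sum_(s <- idx n M) a s.
Proof. by rewrite /idxs big_flatten big_map. Qed.

(** The chaos order is read off the length of the list. One coefficient function then serves all
    orders, and the division by the order in [L^-1] becomes [invsize]. *)
Definition allcoef f (s : seq nat) : R := kercoef (@f (size s)) s.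

Lemma allcoefE f n M s : s \in idx n M -> allcoef f s = kercoef (@f n) s.
Proof. by rewrite mem_idx => /and3P[/eqP e _ _]; subst n. Qed.

Lemma walsh_idxs f l M w :
  walsh (idxs l M) (allcoef f) w =
  \sum_(n <- l) walsh (idx n M) (kercoef (@f n)) w.
Proof.
rewrite /walsh big_idxs; apply: eq_bigr => n _; apply: eq_big_seq => s /allcoefE.
by move=> ->.
Qed.

Lemma walsh_idxs_invsize f l M w :
  walsh (idxs l M) (invsize (allcoef f)) w =
  \sum_(n <- l) n%:R^-1 * walsh (idx n M) (kercoef (@f n)) w.
Proof.
rewrite /walsh big_idxs; apply: eq_bigr => n _; rewrite mulr_sumr.
apply: eq_big_seq => s sn; rewrite /invsize (allcoefE f sn).
by move: sn; rewrite mem_idx => /and3P[/eqP -> _ _]; ring.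
Qed.

Lemma n2_invsize_le r c : walsh_index r ->
  n2 (walsh r (invsize c)) <= n2 (walsh r c).
Proof.
move=> wr; rewrite !n2_walsh //; apply: ler_sum => s _; rewrite /invsize.
have [->|s0] := eqVneq (size s) 0%N; first by rewrite invr0 mulr0 expr0n sqr_ge0.
rewrite exprMn ler_piMr ?sqr_ge0 // expr_le1 ?invr_ge0 //.
by rewrite invf_le1 ?ltr0n ?lt0n // ler1n lt0n.
Qed.

Lemma L2_walshN r (c : seq nat -> R) r' (c' : seq nat -> R) :
  L2 (fun w => walsh r c w - walsh r' c' w).
Proof. by apply: L2B; exact: L2_walsh. Qed.

Definition Jsum f N w : R := \sum_(1 <= n < N) J P (@f n) w.
Definition Jsum_inv f N w : R := \sum_(1 <= n < N) n%:R^-1 * J P (@f n) w.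

Lemma mem_index_iota1 n N : n \in index_iota 1 N -> (0 < n)%N.
Proof. by rewrite mem_index_iota => /andP[]. Qed.

Variable f : kernels R.
Hypothesis l02f : forall n, (0 < n)%N -> l02 (@f n).

Lemma Jsum_cvL2 N :
  cvL2 (fun M => walsh (idxs (index_iota 1 N) M) (allcoef f)) (Jsum f N).
Proof.
rewrite (_ : (fun M => _) = (fun M w => \sum_(n <- index_iota 1 N)
    walsh (idx n M) (kercoef (@f n)) w)); last first.
  by apply/funext => M; apply/funext => w; rewrite walsh_idxs.
apply: cvL2_sum => n /mem_index_iota1 n0; split; last exact/J_cvL2/l02f.
by move=> M; exact: L2_walsh.
Qed.

Lemma Jsum_inv_cvL2 N :
  cvL2 (fun M => walsh (idxs (index_iota 1 N) M) (invsize (allcoef f))) (Jsum_inv f N).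
Proof.
rewrite (_ : (fun M => _) = (fun M w => \sum_(n <- index_iota 1 N)
    n%:R^-1 * walsh (idx n M) (kercoef (@f n)) w)); last first.
  by apply/funext => M; apply/funext => w; rewrite walsh_idxs_invsize.
apply: cvL2_sum => n /mem_index_iota1 n0; split.
  by move=> M; apply: L2Z; exact: L2_walsh.
by apply: cvL2Z; [move=> M; exact: L2_walsh|exact/J_cvL2/l02f].
Qed.

Lemma L2_Jsum N : L2 (Jsum f N). Proof. by have [] := Jsum_cvL2 N. Qed.
Lemma L2_Jsum_inv N : L2 (Jsum_inv f N). Proof. by have [] := Jsum_inv_cvL2 N. Qed.

(** On Walsh coefficients [L^-1] divides by an order at least 1. Hence the series of [L^-1 F] is
    Cauchy because that of [F] converges. *)
Lemma n2_Jsum_inv_le N N' : (N <= N')%N ->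
  n2 (fun w => Jsum_inv f N' w - Jsum_inv f N w) <=
  n2 (fun w => Jsum f N' w - Jsum f N w).
Proof.
move=> NN'.
have cB (u v : nat -> Omega -> R) G H : (forall n, L2 (u n)) -> (forall n, L2 (v n)) ->
    cvL2 u G -> cvL2 v H -> cvL2 (fun n w => u n w - v n w) (fun w => G w - H w).
  move=> Lu Lv cG cH; apply: (cvL2D Lu (fun n => L2N (Lv n)) cG).
  exact: cvL2N.
have LW c l : forall M, L2 (walsh (idxs l M) c) by move=> M; exact: L2_walsh.
apply: (le_n2_lim _ _ (cB _ _ _ _ (LW _ _) (LW _ _) (Jsum_inv_cvL2 N') (Jsum_inv_cvL2 N))
  (cB _ _ _ _ (LW _ _) (LW _ _) (Jsum_cvL2 N') (Jsum_cvL2 N))).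
- by move=> M; exact: L2_walshN.
- by move=> M; exact: L2_walshN.
move=> M.
have w1 := walsh_index_idxs M (iota_uniq 1 (N - 1)).
have w2 := walsh_index_idxs M (iota_uniq 1 (N' - 1)).
have sub : {subset idxs (index_iota 1 N) M <= idxs (index_iota 1 N') M}.
  move=> s; rewrite !mem_idxs => /and3P[+ -> ->]; rewrite !andbT !mem_index_iota.
  by move=> /andP[-> sN] /=; exact: leq_trans sN NN'.
rewrite (eq_n2 P (fun w => walsh_sub _ w w1 w2 sub)).
rewrite (eq_n2 P (fun w => walsh_sub (allcoef f) w w1 w2 sub)).
exact/n2_invsize_le/walsh_index_filter.
Qed.

Lemma mean_Jsum_inv N : mean (Jsum_inv f N) = 0.
Proof.
rewrite /Jsum_inv (eq_mean P (g := fun w => \sum_(n <- index_iota 1 N | n \in index_iota 1 N)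
  n%:R^-1 * J P (@f n) w)); last by move=> w; rewrite [LHS]big_seq.
rewrite mean_sum => [|n /mem_index_iota1 n0]; last first.
  exact/itgZ/L2_itg/L2_J/l02f.
rewrite big1 // => n /mem_index_iota1 n0; rewrite meanZ ?mean_J ?mulr0 //.
- exact: l02f.
- exact/L2_itg/L2_J/l02f.
Qed.

(** A Walsh function of order n has weight n in the gradient energy, and its squared coefficients
    sum to at most n! times [sqnorm]: this matches the series defining [dom_D]. *)
Lemma grad_sum_bound N K C :
  (\sum_(1 <= n < N) (n * n`!)%:R%:E * sqnorm (@f n) <= C%:E)%E ->
  \sum_(0 <= k < K) n2 (grad k (Jsum f N)) <= C.
Proof.
move=> HC.
have LW l : forall M, L2 (walsh (idxs l M) (allcoef f)) by move=> M; exact: L2_walsh.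
have H : \sum_(0 <= k < K) n2 (grad k (walsh (idxs (index_iota 1 N) M) (allcoef f)))
    @[M --> \oo] --> \sum_(0 <= k < K) n2 (grad k (Jsum f N)).
  apply: cvgn_sum => k; apply: cvg_n2; first by move=> M; exact/L2_grad.
  by apply: cvL2_grad => //; exact: Jsum_cvL2.
apply: (ler_cvg_to H (cvgnC C)); apply: nearW => M.
apply: le_trans (sum_n2_grad_walsh _ _ _ _) _ => //.
  by apply: walsh_index_idxs; exact: iota_uniq.
rewrite -lee_fin; apply: le_trans HC; rewrite big_idxs -sumEFin.
rewrite big_seq [leRHS]big_seq; apply: lee_sum => n /mem_index_iota1 n0.
apply: (@le_trans _ _ (n%:R%:E * (\sum_(s <- idx n M) kercoef (@f n) s ^+ 2)%:E)%E).
  rewrite -EFinM lee_fin mulr_sumr big_seq [leRHS]big_seq.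
  apply: ler_sum => s sn; rewrite (allcoefE f sn).
  by move: sn; rewrite mem_idx => /and3P[/eqP -> _ _].
rewrite natrM EFinM -muleA lee_wpmul2l ?lee_fin //.
exact/sum_kercoef_le/l02f.
Qed.

Section shifted_kernel.
Variables (k n : nat).
Let fk : n.-tuple nat -> R := fun t => f [tuple of rcons t k].

Lemma seqker_shift s : size s = n -> seqker fk s = seqker (@f n.+1) (rcons s k).
Proof.
move=> sn; rewrite /seqker /fk; congr (@f _ _); apply/val_inj.
by rewrite /= !val_insubd sn eqxx size_rcons sn eqxx.
Qed.

Definition add_sorted (s : seq nat) := sort leq (k :: s).

Lemma add_sorted_perm s : perm_eq (add_sorted s) (k :: s).
Proof. by rewrite /add_sorted perm_sort. Qed.

Lemma add_sorted_sorted s : sorted ltn s -> k \notin s -> sorted ltn (add_sorted s).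
Proof.
move=> ss ks; rewrite ltn_sorted_uniq_leq sort_uniq /= ks sorted_uniq_ltn //=.
exact: (sort_sorted leq_total).
Qed.

(** Inserting [k] is a bijection onto the increasing lists containing [k]; its inverse is the
    removal of [k]. *)
Lemma perm_idx_shift N : (k < N)%N ->
  perm_eq [seq s <- idx n.+1 N | k \in s]
    [seq add_sorted s | s <- [seq s <- idx n N | k \notin s]].
Proof.
move=> kN; apply: uniq_perm.
- exact/filter_uniq/uniq_idx.
- rewrite map_inj_in_uniq; first exact/filter_uniq/uniq_idx.
  move=> s t; rewrite !mem_filter !mem_idx => /andP[_ /and3P[_ ss _]] /andP[_ /and3P[_ st _]] e.
  apply: (irr_sorted_eq ltn_trans ltnn) => //; apply: perm_mem.
  rewrite -(perm_cons k); rewrite -(permPl (add_sorted_perm s)) e.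
  exact: add_sorted_perm.
move=> s; rewrite mem_filter mem_idx; apply/andP/mapP.
  move=> [ks /and3P[/eqP sn ss sN]].
  have us := sorted_uniq_ltn ss.
  exists (rem k s).
    rewrite mem_filter mem_idx mem_rem_uniq // inE eqxx /= size_rem // sn eqxx /=.
    rewrite (subseq_sorted ltn_trans (rem_subseq k s)) //=.
    by apply/allP => i /mem_rem /(allP sN).
  apply: (irr_sorted_eq ltn_trans ltnn) => //.
    apply: add_sorted_sorted; last by rewrite mem_rem_uniq // inE eqxx.
    exact: (subseq_sorted ltn_trans (rem_subseq k s)).
  apply: perm_mem; rewrite perm_sym (permPl (add_sorted_perm _)) perm_sym.
  exact: perm_to_rem.
move=> [t]; rewrite mem_filter mem_idx => /andP[kt /and3P[/eqP tn st tN]] ->.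
have pt := add_sorted_perm t; split.
  by rewrite (perm_mem pt) mem_head.
rewrite (perm_size pt) /= tn eqxx add_sorted_sorted //=.
by rewrite (perm_all _ pt) /= kN tN.
Qed.

Lemma grad_walsh_idx N w : (k < N)%N ->
  grad k (walsh (idx n.+1 N) (kercoef (@f n.+1))) w =
  n.+1%:R * walsh (idx n N) (kercoef fk) w.
Proof.
move=> kN; rewrite grad_walsh ?walsh_index_idx //.
rewrite /walsh (perm_big _ (perm_idx_shift kN)) big_map big_filter !mulr_sumr.
(* Lists already containing [k] contribute nothing, since the kernel vanishes on tuples with a
   repetition. *)
rewrite [RHS](bigID (fun s => k \notin s)) /= [X in _ + X]big1_seq ?addr0; last first.
  move=> s /andP[]; rewrite negbK => ks; rewrite mem_idx => /and3P[/eqP sn _ _].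
  rewrite /kercoef seqker_shift // (seqker_nuniq (l02f (ltn0Sn n))) ?size_rcons ?sn //.
    by rewrite mulr0 mul0r mulr0.
  by rewrite rcons_uniq ks.
rewrite big_seq_cond [RHS]big_seq_cond; apply: eq_bigr => s /andP[].
rewrite mem_idx => /and3P[/eqP sn ss sN] ks.
have -> : chi (add_sorted s) w = X R k w * chi s w.
  by rewrite /chi (perm_big _ (add_sorted_perm s)) big_cons.
rewrite /kercoef seqker_shift // factS natrM.
rewrite (@seqker_perm _ _ (@f n.+1) (add_sorted s) (rcons s k)) //; last 3 first.
- exact: l02f.
- by rewrite (perm_size (add_sorted_perm s)) /= sn.
- by rewrite (permPl (add_sorted_perm s)) perm_sym perm_rcons.
transitivity (n.+1%:R * n`!%:R * seqker (@f n.+1) (rcons s k) * chi s w * (X R k w * X R k w)).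
  ring.
by rewrite X_sqr; ring.
Qed.

(** The partial sums for the shifted kernel converge because, for N > k and up to the factor n + 1,
    they are gradients of the partial sums of [J] for the original kernel. *)
Lemma J_shift_cvL2 :
  cvL2 (fun N => walsh (idx n N) (kercoef fk)) (J P fk) /\
  n2 (fun w => n.+1%:R * J P fk w - grad k (J P (@f n.+1)) w) = 0.
Proof.
have LW q c : forall M, L2 (walsh (idx q M) c) by move=> M; exact: L2_walsh.
have H : cvL2 (fun N => grad k (walsh (idx n.+1 N) (kercoef (@f n.+1))))
    (grad k (J P (@f n.+1))).
  by apply: cvL2_grad => //; exact/J_cvL2/l02f.
have LgW : forall N, L2 (grad k (walsh (idx n.+1 N) (kercoef (@f n.+1)))).
  by move=> N; exact: L2_grad.
have K : cvL2 (fun N => walsh (idx n N) (kercoef fk))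
    (fun w => n.+1%:R^-1 * grad k (J P (@f n.+1)) w).
  have := cvL2Z (n.+1%:R^-1) LgW H; apply: near0_cvL2 => //.
    by move=> N; exact: L2Z.
  exists k.+1 => N kN; rewrite -(mean_cst P 0); apply: eq_mean => w.
  by rewrite grad_walsh_idx // mulKf ?pnatr_eq0 // subrr expr0n.
have cJ : cvL2 (fun N => walsh (idx n N) (kercoef fk)) (J P fk).
  by rewrite /J partial_JE; apply: lim_L2_cvL2 K.
split=> //.
have := cvL2_unique (LW _ _) cJ K.
move=> e; rewrite (eq_n2 P (g := fun w => n.+1%:R *
    (J P fk w - n.+1%:R^-1 * grad k (J P (@f n.+1)) w))); last first.
  by move=> w; rewrite mulrBr mulVKf ?pnatr_eq0.
by rewrite n2Z ?e ?mulr0 //; apply: L2B; [exact: cJ.1|exact: K.1].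
Qed.

End shifted_kernel.

End chaos_expansion.

(** * The operators [D] and [L^-1] as discrete gradient and L^2 limit *)

Section chaos_functionals.
Context {R : realType} (P : probability Omega R) (hP : is_rademacher P).
Local Notation L2 := (L2 P).
Local Notation n2 := (n2 P).
Local Notation mean := (mean P).
Local Notation cvL2 := (cvL2 P).
Implicit Types (F : Omega -> R) (f g : kernels R).

Lemma fine_expectation F : fine 'E_P[F] = mean F.
Proof. by rewrite unlock. Qed.

Lemma n2_sum0 (I : Type) (r : seq I) (p : pred I) (u : I -> Omega -> R) :
  (forall i, p i -> L2 (u i) /\ n2 (u i) = 0) ->
  n2 (fun w => \sum_(i <- r | p i) u i w) = 0.
Proof.
move=> H; elim: r => [|i r IH].
  by rewrite -[RHS](mean_cst P 0); apply: eq_mean => w; rewrite big_nil expr0n.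
case pi : (p i); last by rewrite -[RHS]IH; apply: eq_n2 => w; rewrite big_cons pi.
have [Li ni] := H i pi; apply/eqP; rewrite eq_le n2_ge0 andbT.
have := n2D_le Li (L2_sum r (fun i pi => (H i pi).1)).
rewrite IH ni mulr0 addr0; apply: le_trans.
by rewrite (eq_n2 P (g := fun w => u i w + \sum_(i <- r | p i) u i w)) // => w; rewrite big_cons pi.
Qed.

Lemma L2_affine_Jsum f c : (forall n, (0 < n)%N -> l02 (@f n)) -> forall N,
  L2 (fun w => c + Jsum P f N w).
Proof. by move=> lf N; apply: L2D; [exact: L2cst|exact: L2_Jsum]. Qed.

Lemma chaos_cvL2 F f : chaos P F f ->
  (forall n, (0 < n)%N -> l02 (@f n)) /\ cvL2 (fun N w => mean F + Jsum P f N w) F.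
Proof.
move=> [lf]; rewrite fine_expectation => cF; split=> //.
by apply/cvg_L2_cvL2 => // N; exact: L2_affine_Jsum.
Qed.

Lemma cvL2_chaos F f : (forall n, (0 < n)%N -> l02 (@f n)) ->
  cvL2 (fun N w => mean F + Jsum P f N w) F -> chaos P F f.
Proof.
move=> lf cF; split=> //; rewrite fine_expectation.
by apply/cvg_L2_cvL2 => // N; exact: L2_affine_Jsum.
Qed.

Lemma chaos_kernelsP F f : chaos P F f -> chaos P F (chaos_kernels P F).
Proof. by move=> cF; apply: (@xgetPex _ _ [set f | chaos P F f]); exists f. Qed.

Lemma chaos_grad_cvL2 F f k : chaos P F f ->
  cvL2 (fun N => grad k (Jsum P f N)) (grad k F).
Proof.
move=> /chaos_cvL2 [lf cF].
have := cvL2_grad hP k (L2_affine_Jsum _ lf) cF.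
congr cvL2; apply/funext => N; apply/funext => w.
by rewrite gradD grad_cst add0r.
Qed.

(** [grad k] is a contraction of L^2, so it acts termwise on a chaos expansion, where it gives the
    terms of [D]. [D] uses the kernels selected by [chaos_kernels]; like [f] they expand [F], so the
    limit is the same gradient. *)
Lemma D_grad F f k : chaos P F f ->
  L2 (D P F k) /\ n2 (fun w => D P F k w - grad k F w) = 0.
Proof.
move=> cF; have cg := chaos_kernelsP cF; have [lg _] := chaos_cvL2 cg.
pose u n w : R := n.+1%:R * J P (fun t : n.-tuple nat => chaos_kernels P F [tuple of rcons t k]) w.
have Lu n : L2 (u n) by apply: L2Z; have [[]] := J_shift_cvL2 hP lg k n.
have Lgn n : L2 (grad k (J P (@chaos_kernels R P F n.+1))).
  by apply: L2_grad => //; apply: L2_J => //; exact: lg.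
have Lgs N : L2 (grad k (Jsum P (chaos_kernels P F) N)).
  by apply: L2_grad => //; exact: L2_Jsum.
have cu : cvL2 (fun N w => \sum_(0 <= n < N) u n w) (grad k F).
  apply: near0_cvL2 (cvL2_shift (chaos_grad_cvL2 k cg)) => [N|N|].
  - exact: Lgs.
  - by apply: L2_sum => n _; exact: Lu.
  exists 0%N => N _.
  rewrite (eq_n2 P (g := fun w => \sum_(0 <= n < N) (u n w -
     grad k (J P (@chaos_kernels R P F n.+1)) w))).
    apply: n2_sum0 => n _; split; first by apply: L2B.
    by have [] := J_shift_cvL2 hP lg k n.
  by move=> w; rewrite sumrB /Jsum grad_sum big_add1.
have LU N : L2 (fun w => \sum_(0 <= n < N) u n w).
  by apply: L2_sum => n _; exact: Lu.
have cD : cvL2 (fun N w => \sum_(0 <= n < N) u n w) (D P F k) by exact: lim_L2_cvL2 cu.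
by split; [exact: cD.1|exact: cvL2_unique cD cu].
Qed.

Lemma Linv_cvL2 F f : chaos P F f ->
  cvL2 (fun N w => - Jsum_inv P (chaos_kernels P F) N w) (Linv P F).
Proof.
move=> cF; have cg := chaos_kernelsP cF; have [lg cU] := chaos_cvL2 cg.
have LV N : L2 (fun w => - Jsum_inv P (chaos_kernels P F) N w).
  by apply: L2N; exact: L2_Jsum_inv.
have [G cG] : exists G, cvL2 (fun N w => - Jsum_inv P (chaos_kernels P F) N w) G.
  apply: cauchy_cvL2 => // e e0.
  have [N HN] := cvL2_cauchy (L2_affine_Jsum _ lg) cU e0.
  exists N => m n Nm mn; apply: le_lt_trans (HN m n Nm mn).
  rewrite (eq_n2 P (g := fun w => - (Jsum_inv P (chaos_kernels P F) n w -
     Jsum_inv P (chaos_kernels P F) m w))); last by move=> w; ring.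
  rewrite n2N; apply: le_trans (n2_Jsum_inv_le hP lg mn) _.
  by rewrite le_eqVlt; apply/orP; left; apply/eqP/eq_n2 => w; ring.
exact: lim_L2_cvL2 cG.
Qed.

Lemma mean_Linv F f : chaos P F f -> mean (Linv P F) = 0.
Proof.
move=> cF; have cg := chaos_kernelsP cF; have [lg _] := chaos_cvL2 cg.
have LV N : L2 (fun w => - Jsum_inv P (chaos_kernels P F) N w).
  by apply: L2N; exact: L2_Jsum_inv.
have := cvg_mean LV (Linv_cvL2 cF).
have e N : mean (fun w => - Jsum_inv P (chaos_kernels P F) N w) = 0.
  by rewrite meanN ?mean_Jsum_inv ?oppr0 //; apply/L2_itg/L2_Jsum_inv.
by move=> H; apply: cvgn_unique (eq_cvgn (v := fun=> 0) e H) (cvgnC 0).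
Qed.

(** An explicit expansion of [L^-1 F] makes the identification of [D] with the discrete gradient
    available for it too. *)
Lemma chaos_Linv F f : chaos P F f ->
  chaos P (Linv P F) (fun n t => - n%:R^-1 * chaos_kernels P F t).
Proof.
move=> cF; have cg := chaos_kernelsP cF; have [lg _] := chaos_cvL2 cg.
have lg' n : (0 < n)%N -> l02 (fun t : n.-tuple nat => - n%:R^-1 * chaos_kernels P F t).
  by move=> n0; apply: l02Z; exact: lg.
apply: cvL2_chaos => //.
apply: near0_cvL2 (Linv_cvL2 cF) => [N|N|].
- by apply: L2N; exact: L2_Jsum_inv.
- exact: L2_affine_Jsum.
exists 0%N => N _; rewrite (mean_Linv cF).
rewrite (eq_n2 P (g := fun w => \sum_(n <- index_iota 1 N | n \in index_iota 1 N)
   (J P (fun t : n.-tuple nat => - n%:R^-1 * chaos_kernels P F t) w -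
    (- n%:R^-1 * J P (@chaos_kernels R P F n) w)))).
  apply: n2_sum0 => n /mem_index_iota1 n0; split; last by apply: JZ => //; exact: lg.
  by apply: L2B; [apply: L2_J => //; exact: lg'|apply: L2Z; apply: L2_J => //; exact: lg].
move=> w; rewrite add0r -big_seq sumrB /Jsum /Jsum_inv opprK -sumrN; congr (_ + _).
by apply: eq_bigr => n _; rewrite mulNr opprK.
Qed.

Lemma D_Linv_grad F f k : chaos P F f ->
  L2 (D P (Linv P F) k) /\ n2 (fun w => D P (Linv P F) k w - grad k (Linv P F) w) = 0.
Proof. by move=> /chaos_Linv /D_grad; apply. Qed.

(** The same index list and the same coefficients serve [F] and [- L^-1 F], so the exact identity
    for Walsh polynomials can be passed to the limit on both sides at once. *)
Lemma walsh_approx F f e : chaos P F f -> 0 < e ->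
  exists r c, [/\ walsh_index r, [::] \notin r,
    n2 (fun w => F w - mean F - walsh r c w) < e &
    n2 (fun w => - Linv P F w - walsh r (invsize c) w) < e].
Proof.
move=> cF e0; have cg := chaos_kernelsP cF; have [lg cU] := chaos_cvL2 cg.
have e4 : 0 < e / 4 by lra.
have LV N : L2 (fun w => - Jsum_inv P (chaos_kernels P F) N w).
  by apply: L2N; exact: L2_Jsum_inv.
have [N1 H1] := cvL2_elim cU e4.
have [N2 H2] := cvL2_elim (Linv_cvL2 cF) e4.
pose N := maxn N1 N2.
have [M1 K1] := cvL2_elim (Jsum_cvL2 hP lg N) e4.
have [M2 K2] := cvL2_elim (Jsum_inv_cvL2 hP lg N) e4.
pose M := maxn M1 M2.
exists (idxs (index_iota 1 N) M), (allcoef (chaos_kernels P F)); split.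
- by apply: walsh_index_idxs; exact: iota_uniq.
- by rewrite mem_idxs mem_index_iota.
- have h1 := H1 N (leq_maxl _ _); have k1 := K1 M (leq_maxl _ _).
  have := n2B_le (L2B cU.1 (L2cst P (mean F))) (L2_Jsum hP lg N) (L2_walsh P
     (idxs (index_iota 1 N) M) (allcoef (chaos_kernels P F))).
  rewrite (n2BC P (Jsum P _ N)).
  rewrite (eq_n2 P (f := fun w => F w - mean F - Jsum P (chaos_kernels P F) N w)
    (g := fun w => F w - (mean F + Jsum P (chaos_kernels P F) N w))); last by move=> w; ring.
  by rewrite (n2BC P F); lra.
- have h1 := H2 N (leq_maxr _ _); have k1 := K2 M (leq_maxr _ _).
  have LL : L2 (fun w => - Linv P F w) by apply: L2N; exact: (Linv_cvL2 cF).1.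
  have := n2B_le LL (L2_Jsum_inv hP lg N) (L2_walsh P
     (idxs (index_iota 1 N) M) (invsize (allcoef (chaos_kernels P F)))).
  rewrite (n2BC P (Jsum_inv P _ N)).
  rewrite (eq_n2 P (f := fun w => - Linv P F w - Jsum_inv P (chaos_kernels P F) N w)
    (g := fun w => - Jsum_inv P (chaos_kernels P F) N w - Linv P F w)); last by move=> w; ring.
  by lra.
Qed.

(** The kernels witnessing [dom_D] may differ from the selected ones. The bound is stated for
    [grad], which mentions neither. *)
Lemma dom_D_grad_bound F : dom_D P F ->
  exists C, forall K, \sum_(0 <= k < K) n2 (grad k F) <= C.
Proof.
move=> [f cF fin]; have [lf cU] := chaos_cvL2 cF.
have s0 n : (0 <= (n * n`!)%:R%:E * sqnorm (@f n))%E.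
  rewrite mule_ge0 ?lee_fin //; apply: esum_ge0 => t _.
  by rewrite lee_fin sqr_ge0.
exists (fine (\sum_(1 <= n <oo) (n * n`!)%:R%:E * sqnorm (@f n))%E) => K.
have H : (fun N => \sum_(0 <= k < K) n2 (grad k (Jsum P f N))) @ \oo -->
    \sum_(0 <= k < K) n2 (grad k F).
  apply: cvgn_sum => k; apply: cvg_n2; last exact: chaos_grad_cvL2.
  by move=> N; apply: L2_grad => //; exact: L2_Jsum.
apply: (ler_cvg_to H (cvgnC _)); apply: nearW => N.
apply: grad_sum_bound => //; rewrite fineK; last first.
  by rewrite ge0_fin_numE // nneseries_ge0.
by apply: nneseries_lim_ge => *; exact: s0.
Qed.

End chaos_functionals.

(** * Integration by parts *)

Section integration_by_parts.
Context {R : realType} (P : probability Omega R) (hP : is_rademacher P).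
Local Notation L2 := (L2 P).
Local Notation n2 := (n2 P).
Local Notation mean := (mean P).

Lemma sqr_sum3_le (x a b c : R) : x = a + b + c ->
  x ^+ 2 <= 3 * (a ^+ 2 + b ^+ 2 + c ^+ 2).
Proof.
move=> ->; have h1 := sqr_ge0 (a - b); have h2 := sqr_ge0 (a - c).
have h3 := sqr_ge0 (b - c); nra.
Qed.

Lemma seq_bound (r : seq (seq nat)) : exists K, forall s, s \in r -> all (gtn K) s.
Proof.
elim: r => [|s r [K HK]]; first by exists 0%N.
exists (maxn K (\max_(i <- s) i).+1) => t; rewrite inE => /predU1P[->|/HK /allP H].
  apply/allP => i si /=; rewrite leq_max; apply/orP; right; rewrite ltnS.
  exact: leq_bigmax_seq.
by apply/allP => i ti /=; rewrite leq_max orbC; apply/orP; right; exact: (H i ti).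
Qed.

(** The sum stops at a fixed K, while the Walsh approximations of [F] involve ever more coordinates.
    The excess is bounded by Cauchy-Schwarz: the energy of [G] beyond K times the energy of the
    approximation of [- L^-1 F], itself at most a variance. *)
Lemma ibp_error F f G K : chaos P F f -> mean F = 0 -> L2 G ->
  forall tail, (forall K', (K <= K')%N -> \sum_(K <= k < K') n2 (grad k G) <= tail) ->
  (mean (fun w => F w * G w) -
   \sum_(0 <= k < K) mean (fun w => grad k G w * grad k (fun w => - Linv P F w) w)) ^+ 2
  <= 6 * tail * n2 F.
Proof.
move=> cF F0 LG tail Ht.
have LF : L2 F := (chaos_cvL2 hP cF).2.1.
have LLF : L2 (Linv P F) := (Linv_cvL2 hP cF).1.
have LV : L2 (fun w => - Linv P F w) by exact: L2N.
have t0 : 0 <= tail by have := Ht K (leqnn _); rewrite big_geq.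
pose A := \sum_(0 <= k < K) n2 (grad k G).
(* [C] collects the coefficients of [eta] in the three bounds [b1], [b2], [b3] below. K and the tail
   are fixed first, so [eta] can be chosen after [C]. *)
pose C := 3 * (n2 G + A * K%:R + tail * 2).
have A0 : 0 <= A by apply: sumr_ge0 => k _; exact: n2_ge0.
have C0 : 0 <= C.
  by rewrite /C mulr_ge0 // !addr_ge0 ?n2_ge0 // ?mulr_ge0.
apply/ler_addgt0Pl => e e0.
pose eta := e / (C + 1).
have eta0 : 0 < eta by rewrite divr_gt0 // ltr_wpDl.
have Ce : C * eta <= e.
  rewrite /eta mulrCA ler_piMr ?(ltW e0) // ler_pdivrMr ?ltr_wpDl // mul1r; lra.
have [r [c [wr r0 h1 h2]]] := walsh_approx hP cF eta0.
have [Kp HKp] := seq_bound r.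
pose K' := maxn K Kp.
have KK' : (K <= K')%N by rewrite leq_maxl.
have rK' s : s \in r -> all (gtn K') s.
  by move=> /HKp /allP H; apply/allP => i /H /= iK; rewrite leq_max iK orbT.
have ibp := walsh_ibp hP c wr r0 rK' LG.
have Lp := L2_walsh P r c; have Lpt := L2_walsh P r (invsize c).
pose p := walsh r c; pose pt := walsh r (invsize c).
have LFp : L2 (fun w => F w - p w) by exact: L2B.
have Lg k H : L2 H -> L2 (grad k H) by exact: L2_grad.
(* Three errors: approximating [F], approximating [- L^-1 F] in the first K gradients, and the
   coordinates beyond K. *)
have dec : mean (fun w => F w * G w) -
   \sum_(0 <= k < K) mean (fun w => grad k G w * grad k (fun w => - Linv P F w) w) =
   mean (fun w => (F w - p w) * G w) +
   (- \sum_(0 <= k < K) mean (fun w => grad k G w * grad k (fun w => - Linv P F w - pt w) w)) +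
   \sum_(K <= k < K') mean (fun w => grad k G w * grad k pt w).
  have e1 : mean (fun w => (F w - p w) * G w) = mean (fun w => F w * G w) - mean (fun w => p w * G w).
    rewrite -meanB; [|exact: L2M|exact: L2M].
    by apply: eq_mean => w; rewrite mulrBl.
  have e2 : \sum_(0 <= k < K) mean (fun w => grad k G w * grad k (fun w => - Linv P F w - pt w) w) =
     \sum_(0 <= k < K) mean (fun w => grad k G w * grad k (fun w => - Linv P F w) w) -
     \sum_(0 <= k < K) mean (fun w => grad k G w * grad k pt w).
    rewrite -sumrB; apply: eq_bigr => k _; rewrite -meanB; try by apply: L2M; exact: Lg.
    by apply: eq_mean => w; rewrite gradB mulrBr.
  have e3 : \sum_(0 <= k < K') mean (fun w => grad k G w * grad k pt w) =
     \sum_(0 <= k < K) mean (fun w => grad k G w * grad k pt w) +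
     \sum_(K <= k < K') mean (fun w => grad k G w * grad k pt w).
    by rewrite (big_cat_nat (leq0n K) KK').
  rewrite e1 e2 ibp e3; ring.
apply: le_trans (sqr_sum3_le dec) _; rewrite sqrrN.
have b1 : mean (fun w => (F w - p w) * G w) ^+ 2 <= eta * n2 G.
  apply: le_trans (cauchy_schwarz LFp LG) _; rewrite ler_wpM2r ?n2_ge0 //.
  rewrite (eq_n2 P (g := fun w => F w - mean F - p w)); first exact: ltW.
  by move=> w; rewrite F0 subr0.
have b2 : (\sum_(0 <= k < K) mean (fun w => grad k G w * grad k (fun w => - Linv P F w - pt w) w)) ^+ 2
    <= A * (K%:R * eta).
  apply: le_trans (cauchy_schwarz_sum _ (fun k => Lg k _ LG) (fun k => Lg k _ (L2B LV Lpt))) _.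
  rewrite ler_wpM2l // (_ : K%:R * eta = \sum_(0 <= k < K) eta); last first.
    by rewrite big_const_nat subn0 iter_addr_0 mulr_natl.
  apply: ler_sum => k _; apply: le_trans (n2_grad_le hP k (L2B LV Lpt)) _; exact: ltW.
have b3 : (\sum_(K <= k < K') mean (fun w => grad k G w * grad k pt w)) ^+ 2
    <= tail * (2 * n2 F + 2 * eta).
  apply: le_trans (cauchy_schwarz_sum _ (fun k => Lg k _ LG) (fun k => Lg k _ Lpt)) _.
  apply: ler_pM => //; [|by apply: sumr_ge0 => k _; exact: n2_ge0|exact: Ht|].
    by apply: sumr_ge0 => k _; exact: n2_ge0.
  apply: (@le_trans _ _ (n2 p)).
    apply: le_trans (sum_n2_grad_invsize hP K' c wr).
    by rewrite (big_cat_nat (leq0n K) KK') //= lerDr; apply: sumr_ge0 => k _; exact: n2_ge0.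
  have := n2D_le LF (L2N LFp); rewrite n2N.
  rewrite (eq_n2 P (f := fun w => F w + - (F w - p w)) (g := p)); last by move=> w; ring.
  rewrite (eq_n2 P (f := fun w => F w - p w) (g := fun w => F w - mean F - p w)); last first.
    by move=> w; rewrite F0 subr0.
  move: h1; rewrite -/p; lra.
apply: le_trans (_ : 3 * (eta * n2 G + A * (K%:R * eta) + tail * (2 * n2 F + 2 * eta)) <= _).
  by rewrite ler_wpM2l // !lerD.
have : 3 * (eta * n2 G + A * (K%:R * eta) + tail * (2 * n2 F + 2 * eta)) =
  C * eta + 6 * tail * n2 F by rewrite /C; ring.
by move=> ->; rewrite lerD2r.
Qed.

Lemma bounded_sum_tail (a : nat -> R) C : (forall k, 0 <= a k) ->
  (forall K, \sum_(0 <= k < K) a k <= C) ->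
  forall e, 0 < e -> exists K0, forall K K', (K0 <= K)%N -> (K <= K')%N ->
    \sum_(K <= k < K') a k <= e.
Proof.
move=> a0 aC e e0.
pose s K := \sum_(0 <= k < K) a k.
have am : {homo s : n m / (n <= m)%N >-> n <= m}.
  by move=> n m nm; rewrite /s (big_cat_nat (leq0n n) nm) //= lerDl sumr_ge0.
have cs : cvgn s by apply: nondecreasing_is_cvgn; [exact: am|exists C => _ [n _ <-]; exact: aC].
have les k : s k <= limn s by apply: nondecreasing_cvgn_le => //; exact: am.
move: (cs) => /cvgrPdist_lt /(_ e e0) [N _ HN].
exists N => K K' NK KK'; have := HN K NK; rewrite /= ger0_norm ?subr_ge0 //.
have := les K'; rewrite /s (big_cat_nat (leq0n K) KK') //=; lra.
Qed.

Lemma ibp F f G C : chaos P F f -> mean F = 0 -> L2 G ->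
  (forall K, \sum_(0 <= k < K) n2 (grad k G) <= C) ->
  (fun K => \sum_(0 <= k < K)
     mean (fun w => grad k G w * grad k (fun w => - Linv P F w) w)) @ \oo -->
  mean (fun w => F w * G w).
Proof.
move=> cF F0 LG HC; apply/cvgrPdist_le => e e0.
(* This tail makes the error [6 * d * n2 F] at most [e ^+ 2]; adding 1 keeps the denominator
   positive when [F] vanishes. *)
pose d := e ^+ 2 / (6 * n2 F + 1).
have nF : 0 <= n2 F := n2_ge0 P F.
have d0 : 0 < d by rewrite divr_gt0 ?exprn_gt0 //; lra.
have [K0 HK0] := bounded_sum_tail (fun k => n2_ge0 P (grad k G)) HC d0.
exists K0 => // K /= KK0.
have := ibp_error cF F0 LG (fun K' => HK0 K K' KK0).
set x := _ - _ => hx.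
rewrite -(@ler_pXn2r _ 2) // ?nnegrE ?(ltW e0) // real_normK ?num_real //.
apply: le_trans hx _.
rewrite (_ : 6 * d * n2 F = (6 * n2 F) * e ^+ 2 / (6 * n2 F + 1)); last by rewrite /d; ring.
rewrite ler_pdivrMr; last lra.
by rewrite mulrC ler_wpM2l ?sqr_ge0 //; lra.
Qed.

End integration_by_parts.

(** * Taylor and trapezoidal estimates *)

Section line_calculus.
Context {R : realType}.
Implicit Types f df : R -> R.

(** The endpoints are unordered because increments along a coordinate may have either sign. *)
Lemma mvt_segment f df (a b : R) : (forall x : R, is_derive x (1 : R) f (df x)) ->
  exists c, [/\ f b - f a = df c * (b - a), Num.min a b <= c & c <= Num.max a b].
Proof.
move=> fd.
have cf x : {for x, continuous f}.
  by apply: differentiable_continuous; apply/derivable1_diffP; have [] := fd x.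
have ws u v : {within `[u, v], continuous f} by apply: continuous_subspaceT.
have [ab|ba|<-] := ltgtP a b.
- have [c] := MVT ab (fun x _ => fd x) (ws _ _).
  by rewrite in_itv /= => /andP[ac cb] E; exists c; split=> //; exact: ltW.
- have [c] := MVT ba (fun x _ => fd x) (ws _ _).
  rewrite in_itv /= => /andP[bc ca] E; exists c; split; try exact: ltW.
  by rewrite -[LHS]opprB E; ring.
- by exists a; split=> //; rewrite !subrr mulr0.
Qed.

(** Used to differentiate along lines and under an expectation, in both cases from an explicit
    remainder bound. *)
Lemma is_derive_quadratic f (x l C : R) :
  (forall s, `|f (x + s) - f x - s * l| <= C * s ^+ 2) -> is_derive x 1 f l.
Proof.
move=> H.
have C0 : 0 <= C by have := le_trans (normr_ge0 _) (H 1); rewrite expr1n mulr1.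
have K : h^-1 *: (f (h *: 1 + x) - f x) @[h --> 0^'] --> l.
  apply/cvgrPdist_le => e e0; near=> h.
  have h0 : h != 0 by near: h; exact: nbhs_dnbhs_neq.
  have hp : 0 < `|h| by rewrite normr_gt0.
  have -> : l - h^-1 *: (f (h *: 1 + x) - f x) = - (h^-1 * (f (x + h) - f x - h * l)).
    rewrite scaler1 (addrC h x) /GRing.scale /=; field; exact: h0.
  rewrite normrN normrM normfV ler_pdivrMl //.
  apply: le_trans (H h) _; rewrite -[h ^+ 2]real_normK ?num_real //.
  rewrite expr2 mulrCA ler_wpM2l //.
  apply: (@le_trans _ _ ((C + 1) * `|h|)); first by rewrite ler_wpM2r // lerDl.
  rewrite -ler_pdivlMl; last by rewrite ltr_wpDl.
  near: h; apply/dnbhs0_le; rewrite mulrC divr_gt0 // ltr_wpDl //.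
split; first by apply/cvg_ex; exists l.
by apply/cvg_lim.
Unshelve. all: by end_near. Qed.

End line_calculus.

Section coordinate_calculus.
Context {R : realType} (d : nat).
Implicit Types (h : 'rV[R]_d -> R) (dh : 'I_d -> 'rV[R]_d -> R) (x v : 'rV[R]_d).

(** Bounds by 1 on all partial derivatives are dual to the l^1 norm, which also produces the sums
    over j of [|DF_j|] in the third-moment term. *)
Definition norm1 v : R := \sum_j `|v 0 j|.

Lemma norm1_ge0 v : 0 <= norm1 v.
Proof. by apply: sumr_ge0. Qed.

Lemma norm1Z c v : norm1 (c *: v) = `|c| * norm1 v.
Proof. by rewrite /norm1 mulr_sumr; apply: eq_bigr => j _; rewrite mxE normrM. Qed.

Definition lip1 h := forall x v, `|h (x + v) - h x| <= norm1 v.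

Lemma lip1_sub h x y : lip1 h -> `|h x - h y| <= norm1 (x - y).
Proof. by move=> H; have := H y (x - y); rewrite addrCA subrr addr0. Qed.

Definition has_partials h dh := forall i x, is_derive x (delta_mx 0 i) h (dh i x).

Lemma coordinate_mvt h dh i x t : has_partials h dh ->
  exists c, h (x + t *: delta_mx 0 i) - h x = t * dh i (x + c *: delta_mx 0 i) /\ `|c| <= `|t|.
Proof.
move=> hd; pose f s := h (x + s *: delta_mx 0 i).
have fd (s : R) : is_derive s 1 f (dh i (x + s *: delta_mx 0 i)).
  have [H1 H2] := hd i (x + s *: delta_mx 0 i).
  have e : (fun k : R => k^-1 *: (f (k *: (1 : R) + s) - f s)) =
      (fun k => k^-1 *: (h (k *: delta_mx 0 i + (x + s *: delta_mx 0 i)) - h (x + s *: delta_mx 0 i))).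
    apply/funext => k; rewrite /f; congr (_ *: (h _ - _)).
    by rewrite scaler1 scalerDl addrCA addrA.
  by split; [rewrite /derivable e|rewrite /derive e].
have [c [E c1 c2]] := mvt_segment 0 t fd.
exists c; split; first by move: E; rewrite /f scale0r addr0 subr0 mulrC.
move: c1 c2; rewrite minEle maxEle ler_norml; case: (leP 0 t) => t0 c1 c2.
  by rewrite (ger0_norm t0); apply/andP; split; lra.
by rewrite (ltr0_norm t0); apply/andP; split; lra.
Qed.

(** Corners of the path from 0 to [v] that moves one coordinate at a time. The hypotheses give
    derivatives only along the axes. *)
Definition psum (r : seq 'I_d) v : 'rV[R]_d := \sum_(j <- r) v 0 j *: delta_mx 0 j.

Lemma psum_full v : psum (index_enum _) v = v.
Proof. by rewrite [RHS]row_sum_delta. Qed.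

Lemma psum_cons j r v x : x + psum (j :: r) v = (x + psum r v) + v 0 j *: delta_mx 0 j.
Proof. by rewrite /psum big_cons addrCA addrC. Qed.

Lemma lip1_partials h dh : has_partials h dh ->
  (forall i x, `|dh i x| <= 1) -> lip1 h.
Proof.
move=> hd db x v; rewrite -{1}(psum_full v) /norm1.
elim: (index_enum _) => [|j r IH]; first by rewrite /psum !big_nil addr0 subrr normr0.
rewrite psum_cons big_cons.
have [c [E _]] := coordinate_mvt j (x + psum r v) (v 0 j) hd.
rewrite (_ : _ - h x = (h (x + psum r v + v 0 j *: delta_mx 0 j) - h (x + psum r v)) +
  (h (x + psum r v) - h x)); last by ring.
apply: le_trans (ler_normD _ _) _; apply: lerD => //.
by rewrite E normrM ler_piMr.
Qed.

Lemma norm1_psum r v : uniq r -> norm1 (psum r v) = \sum_(j <- r) `|v 0 j|.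
Proof.
move=> ur; rewrite big_uniq //= [RHS]big_mkcond /norm1; apply: eq_bigr => j _.
rewrite /psum big_uniq //= summxE.
case: ifP => jr; last first.
  rewrite big1 ?normr0 // => k kr; rewrite !mxE eqxx /= eq_sym.
  by case: eqP => [e|]; [rewrite e jr in kr|rewrite mulr0].
rewrite (bigD1 j) //= !mxE !eqxx mulr1 big1 ?addr0 // => k /andP[_ kj].
by rewrite !mxE eqxx /= eq_sym (negbTE kj) mulr0.
Qed.

Lemma norm1_delta c (j : 'I_d) : norm1 (c *: delta_mx 0 j) = `|c|.
Proof.
rewrite norm1Z /norm1 (bigD1 j) //= mxE !eqxx normr1 big1 ?addr0 ?mulr1 // => k kj.
by rewrite mxE eqxx /= (negbTE kj) normr0.
Qed.

Lemma norm1D u v : norm1 (u + v) <= norm1 u + norm1 v.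
Proof. by rewrite /norm1 -big_split; apply: ler_sum => j _; rewrite mxE ler_normD. Qed.

(** On the edge in direction j the mean value point is at l^1 distance at most [S + |v_j|] from x,
    where S is the length already covered. The edge errors [|v_j| (S + |v_j|)] add up to at most the
    square of the total length. *)
Lemma taylor1 h dh : has_partials h dh -> (forall i, lip1 (dh i)) ->
  forall x v, `|h (x + v) - h x - \sum_j v 0 j * dh j x| <= norm1 v ^+ 2.
Proof.
move=> hd dl x v; rewrite -{1}(psum_full v) /norm1.
have := index_enum_uniq ('I_d : finType).
elim: (index_enum _) => [|j r IH] /=.
  by move=> _; rewrite /psum !big_nil addr0 subrr subr0 normr0 expr0n.
move=> /andP[jr ur]; rewrite psum_cons !big_cons.
have [c [E cl]] := coordinate_mvt j (x + psum r v) (v 0 j) hd.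
set S := \sum_(i <- r) `|v 0 i| in IH *.
rewrite (_ : _ - _ - _ = v 0 j * (dh j (x + psum r v + c *: delta_mx 0 j) - dh j x) +
  (h (x + psum r v) - h x - \sum_(i <- r) v 0 i * dh i x)); last first.
  by rewrite mulrBr -E; ring.
apply: le_trans (ler_normD _ _) _.
have S0 : 0 <= S by apply: sumr_ge0.
apply: (@le_trans _ _ (`|v 0 j| * (S + `|v 0 j|) + S ^+ 2)); last first.
  by have := normr_ge0 (v 0 j); nra.
apply: lerD; last exact: IH.
rewrite normrM ler_wpM2l // -addrA.
apply: le_trans (dl j _ _) _; apply: le_trans (norm1D _ _) _.
by rewrite norm1_psum // norm1_delta lerD2l.
Qed.

Lemma is_derive_line h dh x v (t : R) : has_partials h dh -> (forall i, lip1 (dh i)) ->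
  is_derive t 1 (fun s : R => h (x + s *: v)) (\sum_j v 0 j * dh j (x + t *: v)).
Proof.
move=> hd dl; apply: (@is_derive_quadratic _ _ _ _ (norm1 v ^+ 2)) => s.
have := taylor1 hd dl (x + t *: v) (s *: v).
rewrite norm1Z exprMn real_normK ?num_real // mulrC => H.
apply: le_trans H; rewrite le_eqVlt; apply/orP; left; apply/eqP; congr `|_|.
rewrite scalerDl addrA; congr (_ - _); rewrite mulr_sumr.
by apply: eq_bigr => j _; rewrite mxE mulrA.
Qed.

Lemma trapezoid h (h1 : 'I_d -> 'rV[R]_d -> R) (h2 : 'I_d -> 'I_d -> 'rV[R]_d -> R) :
  has_partials h h1 -> (forall i, has_partials (h1 i) (h2 i)) ->
  (forall i, lip1 (h1 i)) -> (forall i j, lip1 (h2 i j)) -> forall x v,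
  `|h (x + v) - h x - 2^-1 * \sum_j v 0 j * (h1 j x + h1 j (x + v))|
  <= 2^-1 * norm1 v ^+ 3.
Proof.
move=> hd1 hd2 l1 l2 x v.
pose f (t : R) := h (x + t *: v).
pose f1 t := \sum_j v 0 j * h1 j (x + t *: v).
pose f2 t := \sum_j v 0 j * \sum_k v 0 k * h2 j k (x + t *: v).
have df (t : R) : is_derive t 1 f (f1 t) by exact: is_derive_line.
have df1 (t : R) : is_derive t 1 f1 (f2 t).
  have H j : is_derive t 1 (fun t => v 0 j * h1 j (x + t *: v))
      (v 0 j * \sum_k v 0 k * h2 j k (x + t *: v)).
    by apply: is_deriveZ; exact: is_derive_line.
  rewrite (_ : f1 = \sum_j (fun t => v 0 j * h1 j (x + t *: v))).
    exact: is_derive_sum.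
  by apply/funext => s; rewrite fct_sumE.
have f2l s t : `|f2 s - f2 t| <= `|s - t| * norm1 v ^+ 3.
  rewrite /f2 -sumrB.
  apply: (@le_trans _ _ (\sum_j `|v 0 j| * (norm1 v * (`|s - t| * norm1 v)))); last first.
    by rewrite -mulr_suml -/(norm1 v); rewrite le_eqVlt; apply/orP; left; apply/eqP; ring.
  apply: le_trans (ler_norm_sum _ _ _) _; apply: ler_sum => j _.
  rewrite -mulrBr normrM ler_wpM2l // -sumrB.
  rewrite {2}/norm1 mulr_suml; apply: le_trans (ler_norm_sum _ _ _) _; apply: ler_sum => k _.
  rewrite -mulrBr normrM ler_wpM2l // -norm1Z.
  apply: le_trans (lip1_sub _ _ (l2 j k)) _.
  by rewrite opprD addrACA subrr add0r scalerBl.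
(* The error of the rule on [0, t]. Its derivative is half of [f1 t - f1 0 - t * f2 t]; a second
   mean value writes this as [t * (f2 xi - f2 t)], so Lipschitz second derivatives suffice. Bounding
   both [c] and [|xi - c|] by 1 leaves the constant 1/2. *)
pose psi t := f t - f 0 - 2^-1 * (t * (f1 0 + f1 t)).
have dpsi (t : R) : is_derive t 1 psi (2^-1 * (f1 t - f1 0) - 2^-1 * (t * f2 t)).
  have H1 : is_derive t 1 (fun t => t * (f1 0 + f1 t)) (1 * (f1 0 + f1 t) + t * (0 + f2 t)).
    have H : is_derive t 1 (fun t => f1 0 + f1 t) (0 + f2 t).
      by apply: is_deriveD.
    have := is_deriveM (is_derive_id t 1) H.
    by rewrite (_ : _ *: _ + _ = 1 * (f1 0 + f1 t) + t * (0 + f2 t)) // /GRing.scale /= addrC mulrC.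
  have H2 : is_derive t 1 (fun t => 2^-1 * (t * (f1 0 + f1 t)))
      (2^-1 * (1 * (f1 0 + f1 t) + t * (0 + f2 t))) by apply: is_deriveZ.
  have H3 : is_derive t 1 (fun t => f t - f 0) (f1 t - 0) by apply: is_deriveB.
  have := is_deriveB H3 H2.
  rewrite (_ : f1 t - 0 - _ = 2^-1 * (f1 t - f1 0) - 2^-1 * (t * f2 t)) //.
  by rewrite subr0 mul1r add0r; field.
have [c [E c0 c1]] := mvt_segment 0 1 dpsi.
have {}c0 : 0 <= c by move: c0; rewrite minEle ler01.
have {}c1 : c <= 1 by move: c1; rewrite maxEle ler01.
have [xi [E2 x0 x1]] := mvt_segment 0 c df1.
have {}x0 : 0 <= xi by move: x0; rewrite minEle c0.
have {}x1 : xi <= c by move: x1; rewrite maxEle c0.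
move: E; rewrite subr0 mulr1 E2 subr0.
rewrite (_ : psi 0 = 0) ?subr0; last by rewrite /psi; ring.
rewrite (_ : psi 1 = h (x + v) - h x - 2^-1 * \sum_j v 0 j * (h1 j x + h1 j (x + v))); last first.
  rewrite /psi /f /f1 scale1r scale0r addr0 mul1r -big_split /=.
  by congr (_ - _ * _); apply: eq_bigr => j _; rewrite mulrDr.
move=> ->; rewrite (_ : _ - _ = 2^-1 * c * (f2 xi - f2 c)); last by ring.
rewrite normrM ger0_norm; last by rewrite mulr_ge0.
rewrite -mulrA ler_wpM2l //.
have N3 : 0 <= norm1 v ^+ 3 by rewrite exprn_ge0 // norm1_ge0.
apply: (@le_trans _ _ (1 * (1 * norm1 v ^+ 3))); last by rewrite !mul1r.
apply: ler_pM => //; apply: le_trans (f2l _ _) _; rewrite ler_wpM2r //.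
by rewrite ler_norml; apply/andP; split; lra.
Qed.

End coordinate_calculus.

Section test_functions.
Context {R : realType} (d : nat) (g : 'rV[R]_d -> R).
Hypothesis gC : C_upto 4 g.
Hypothesis gM : forall i, (1 <= i <= 4)%N -> (M i g <= 1)%E.

Lemma partial_has_partials s : (size s < 4)%N ->
  has_partials (partial s g) (fun i => partial (i :: s) g).
Proof. by move=> s4 i x; apply: derivableP; have [_] := gC (ltnW s4); apply. Qed.

Lemma partial_bound s : (1 <= size s <= 4)%N -> forall x, `|partial s g x| <= 1.
Proof.
move=> s4 x; have := gM s4; rewrite -lee_fin; apply: le_trans.
rewrite /M (bigmaxD1 (in_tuple s)) //= le_max; apply/orP; left.
by apply: ereal_sup_ubound; exists x.
Qed.

(** For partials of order three this spends the bound of order four; it is what the trapezoidal rule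
    for first derivatives of [g] consumes. *)
Lemma partial_lip1 s : (size s < 4)%N -> lip1 (partial s g).
Proof.
move=> s4; apply: (lip1_partials (partial_has_partials s4)) => i x.
exact: partial_bound.
Qed.

End test_functions.

(** * Trigonometric approximation of Lipschitz functions *)

Section sine.
Context {R : realType}.

Lemma cos_lip (x y : R) : `|cos x - cos y| <= `|x - y|.
Proof.
have [c [-> _ _]] := mvt_segment y x (fun t : R => is_derive_cos t).
by rewrite normrM normrN ler_piMl // ler_norml sin_geN1 sin_le1.
Qed.

Lemma sin_sub_le (u : R) : `|u - sin u| <= u ^+ 2.
Proof.
have H (t : R) : is_derive t (1 : R) (fun t => t - sin t) (1 - cos t).
  by apply: is_deriveB.
have [c []] := mvt_segment 0 u H.
rewrite sin0 !subr0 => -> c1 c2.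
rewrite normrM -[leRHS]real_normK ?num_real // expr2 ler_wpM2r //.
rewrite -[X in X - _](@cos0 R); apply: le_trans (cos_lip _ _) _.
rewrite sub0r normrN; move: c1 c2; rewrite minEle maxEle ler_norml.
case: (leP 0 u) => u0 c1 c2.
  by rewrite (ger0_norm u0); apply/andP; split; lra.
by rewrite (ltr0_norm u0); apply/andP; split; lra.
Qed.

End sine.

Section trigonometric_polynomials.
Context {R : realType} (d : nat).
Implicit Types (g h : 'rV[R]_d -> R) (a x v : 'rV[R]_d).

Definition dot a x : R := \sum_j a 0 j * x 0 j.

Lemma dotDl a b x : dot (a + b) x = dot a x + dot b x.
Proof. by rewrite /dot -big_split; apply: eq_bigr => j _; rewrite mxE mulrDl. Qed.

Lemma dotDr a x y : dot a (x + y) = dot a x + dot a y.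
Proof. by rewrite /dot -big_split; apply: eq_bigr => j _; rewrite mxE mulrDr. Qed.

Lemma dotZr a c x : dot a (c *: x) = c * dot a x.
Proof. by rewrite /dot mulr_sumr; apply: eq_bigr => j _; rewrite mxE; ring. Qed.

Lemma dotNl a x : dot (- a) x = - dot a x.
Proof. by rewrite /dot -sumrN; apply: eq_bigr => j _; rewrite mxE mulNr. Qed.

Lemma dotNr a x : dot a (- x) = - dot a x.
Proof. by rewrite /dot -sumrN; apply: eq_bigr => j _; rewrite mxE mulrN. Qed.

Lemma dot0l x : dot 0 x = 0.
Proof. by rewrite /dot big1 // => j _; rewrite mxE mul0r. Qed.

Lemma dot_delta c i x : dot (c *: delta_mx 0 i) x = c * x 0 i.
Proof.
rewrite /dot (bigD1 i) //= big1 => [|j ji].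
  by rewrite !mxE !eqxx mulr1 addr0.
by rewrite !mxE eqxx /= (negbTE ji) mulr0 mul0r.
Qed.

(** The phase [b] includes sines and makes the class stable under multiplication by a cosine.
    Averages of such functions are explicit both for random signs and for Gaussian vectors. *)
Inductive trig : ('rV[R]_d -> R) -> Prop :=
| trig_cos a b : trig (fun x => cos (dot a x + b))
| trigD f g : trig f -> trig g -> trig (fun x => f x + g x)
| trigZ c f : trig f -> trig (fun x => c * f x).

Lemma eq_trig f g : f =1 g -> trig f -> trig g.
Proof. by move=> /funext ->. Qed.

Lemma trig_cst c : trig (fun=> c).
Proof.
apply: eq_trig (trigZ c (trig_cos 0 0)) => x.
by rewrite dot0l addr0 cos0 mulr1.
Qed.

Lemma trig_sum (I : Type) (r : seq I) (f : I -> 'rV[R]_d -> R) :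
  (forall i, trig (f i)) -> trig (fun x => \sum_(i <- r) f i x).
Proof.
move=> H; elim: r => [|i r IH].
  by apply: eq_trig (trig_cst 0) => x; rewrite big_nil.
by apply: eq_trig (trigD (H i) IH) => x; rewrite big_cons.
Qed.

Lemma trig_mul_cos a b f : trig f -> trig (fun x => cos (dot a x + b) * f x).
Proof.
elim=> {f} [a' b'|f g _ IHf _ IHg|c f _ IH].
- apply: eq_trig (trigD (trigZ 2^-1 (trig_cos (a + a') (b + b')))
    (trigZ 2^-1 (trig_cos (a - a') (b - b')))) => x.
  rewrite !dotDl dotNl.
  rewrite (_ : dot a x + dot a' x + _ = (dot a x + b) + (dot a' x + b')); last by ring.
  rewrite (_ : dot a x - dot a' x + _ = (dot a x + b) - (dot a' x + b')); last by ring.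
  by rewrite cosD cosB; field.
- by apply: eq_trig (trigD IHf IHg) => x; ring.
- by apply: eq_trig (trigZ c IH) => x; ring.
Qed.

Lemma trig_mul_sin a c e f : trig f -> trig (fun x => (c + e * sin (dot a x)) * f x).
Proof.
move=> tf; apply: eq_trig (trigD (trigZ c tf)
  (trigZ e (trig_mul_cos a (- (pi / 2)) tf))) => x.
rewrite cosB cos_pihalf sin_pihalf; ring.
Qed.

Lemma trig_prod_sin (I : Type) (r : seq I) (a : I -> 'rV[R]_d) (c e : I -> R) :
  trig (fun x => \prod_(i <- r) (c i + e i * sin (dot (a i) x))).
Proof.
elim: r => [|i r IH].
  by apply: eq_trig (trig_cst 1) => x; rewrite big_nil.
by apply: eq_trig (trig_mul_sin (a i) (c i) (e i) IH) => x; rewrite big_cons.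
Qed.

End trigonometric_polynomials.

Section product_weights.
Context {R : realType} (I : finType) (w : I -> bool -> R).
Hypothesis w0 : forall i b, 0 <= w i b.
Hypothesis w1 : forall i, w i true + w i false = 1.

(** Expectation for independent signs with laws [w i]. Being a finite sum, it is a trigonometric
    polynomial in x as soon as each weight is one. *)
Definition wavg (F : {ffun I -> bool} -> R) : R :=
  \sum_(e : {ffun I -> bool}) (\prod_i w i (e i)) * F e.

Lemma wavg_prod (a : I -> bool -> R) :
  wavg (fun e => \prod_i a i (e i)) = \prod_i (w i true * a i true + w i false * a i false).
Proof.
rewrite /wavg (eq_bigr (fun e : {ffun I -> bool} => \prod_i (w i (e i) * a i (e i)))); last first.
  by move=> e _; rewrite big_split.
rewrite -(bigA_distr_bigA (fun i b => w i b * a i b)) /=.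
by apply: eq_bigr => i _; rewrite big_bool.
Qed.

Lemma wavg_cst c : wavg (fun=> c) = c.
Proof.
rewrite /wavg -mulr_suml -(bigA_distr_bigA (fun i b => w i b)) /= big1 ?mul1r // => i _.
by rewrite big_bool; exact: w1.
Qed.

Lemma wavg_le F G : (forall e, F e <= G e) -> wavg F <= wavg G.
Proof.
move=> FG; apply: ler_sum => e _; rewrite ler_wpM2l //.
by apply: prodr_ge0 => i _; exact: w0.
Qed.

Lemma wavgD F G : wavg (fun e => F e + G e) = wavg F + wavg G.
Proof. by rewrite /wavg -big_split; apply: eq_bigr => e _; rewrite mulrDr. Qed.

Lemma wavgZ c F : wavg (fun e => c * F e) = c * wavg F.
Proof. by rewrite /wavg mulr_sumr; apply: eq_bigr => e _; ring. Qed.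

Lemma wavg_sum (J : Type) (r : seq J) (F : J -> {ffun I -> bool} -> R) :
  wavg (fun e => \sum_(j <- r) F j e) = \sum_(j <- r) wavg (F j).
Proof.
rewrite /wavg exchange_big /=; apply: eq_bigr => e _.
by rewrite mulr_sumr.
Qed.

Lemma wavg_norm F : `|wavg F| <= wavg (fun e => `|F e|).
Proof.
apply: le_trans (ler_norm_sum _ _ _) _; apply: ler_sum => e _.
by rewrite normrM ger0_norm // prodr_ge0.
Qed.

Lemma wavg_mul2 (a : I -> bool -> R) i j :
  (forall i, w i true * a i true + w i false * a i false = 0) ->
  wavg (fun e => a i (e i) * a j (e j)) =
  if i == j then w i true * a i true ^+ 2 + w i false * a i false ^+ 2 else 0.
Proof.
move=> a0.
(* A function of one coordinate is written as a product over all coordinates, the form required by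
   [wavg_prod]. *)
have P1 k (b : bool -> R) (e : {ffun I -> bool}) :
    \prod_l (if l == k then b (e l) else 1) = b (e k).
  by rewrite (bigD1 k) //= eqxx big1 ?mulr1 // => l /negbTE ->.
case: eqVneq => [<-|ij].
  transitivity (wavg (fun e => \prod_l (if l == i then a i (e l) ^+ 2 else 1))).
    by apply: eq_bigr => e _; rewrite (P1 i (fun b => a i b ^+ 2)) expr2.
  rewrite (wavg_prod (fun l b => if l == i then a i b ^+ 2 else 1)) (bigD1 i) //= eqxx.
  by rewrite big1 ?mulr1 // => l /negbTE ->; rewrite !mulr1 w1.
transitivity (wavg (fun e => \prod_l ((if l == i then a i (e l) else 1) *
    (if l == j then a j (e l) else 1)))).
  by apply: eq_bigr => e _; rewrite big_split /= !P1.
rewrite (wavg_prod (fun l b => (if l == i then a i b else 1) * (if l == j then a j b else 1))).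
rewrite (bigD1 i) //= eqxx (negbTE ij) !mulr1 a0 mul0r //.
Qed.

End product_weights.

Section bernstein.
Context {R : realType} (d : nat).
Implicit Types (g : 'rV[R]_d -> R) (x : 'rV[R]_d).
Variables (L : R) (m : nat).
Hypotheses (L0 : 0 < L) (m0 : (0 < m)%N).

Definition sgn (b : bool) : R := if b then 1 else -1.

Definition sines x (i : 'I_d) : R := sin (dot (L^-1 *: delta_mx 0 i) x).

Lemma sinesE x i : sines x i = sin (x 0 i / L).
Proof. by rewrite /sines dot_delta mulrC. Qed.

(** The law of a random sign with mean [sines x p.1]; the m copies attached to each coordinate are
    averaged in [node]. *)
Definition sweight x (p : 'I_d * 'I_m) (b : bool) : R := 2^-1 + (sgn b / 2) * sines x p.1.

Lemma sweight_ge0 x p b : 0 <= sweight x p b.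
Proof.
rewrite /sweight; have := sin_geN1 (dot (L^-1 *: delta_mx 0 p.1) x).
have := sin_le1 (dot (L^-1 *: delta_mx 0 p.1) x); rewrite -/(sines x p.1) /sgn.
by case: b; lra.
Qed.

Lemma sweight_sum x p : sweight x p true + sweight x p false = 1.
Proof. by rewrite /sweight /sgn; field. Qed.

Definition node (e : {ffun 'I_d * 'I_m -> bool}) : 'rV[R]_d :=
  \row_i (L / m%:R * \sum_l sgn (e (i, l))).

(* Tensor product Bernstein polynomial of [g] on [-L, L]^d, at the point
   (L sin (x_i / L))_i, with the binomial weights written as a sum over signs. *)
Definition bernstein g x : R := wavg (sweight x) (fun e => g (node e)).

Lemma trig_bernstein g : trig (bernstein g).
Proof.
apply: trig_sum => e.
apply: (eq_trig _ (trigZ (g (node e)) (trig_prod_sin (index_enum ('I_d * 'I_m : finType)%type)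
  (fun p => L^-1 *: delta_mx 0 p.1) (fun=> 2^-1) (fun p => sgn (e p) / 2)))) => x.
by rewrite mulrC.
Qed.

(** Centred independent signs are uncorrelated, so only the diagonal covariances
    [1 - sines x i ^+ 2] remain. *)
Lemma node_variance x i :
  wavg (sweight x) (fun e => (sines x i - m%:R^-1 * \sum_l sgn (e (i, l))) ^+ 2) <= m%:R^-1.
Proof.
pose a (p : 'I_d * 'I_m) (b : bool) := sines x p.1 - sgn b.
have a0 p : sweight x p true * a p true + sweight x p false * a p false = 0.
  by rewrite /sweight /a /sgn; field.
have mR : m%:R != 0 :> R by rewrite pnatr_eq0 -lt0n.
apply: (@le_trans _ _ (m%:R^-2 * \sum_l \sum_l' wavg (sweight x)
    (fun e => a (i, l) (e (i, l)) * a (i, l') (e (i, l'))))).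
  rewrite le_eqVlt; apply/orP; left; apply/eqP.
  rewrite (eq_bigr (fun l => wavg (sweight x) (fun e => \sum_l' a (i, l) (e (i, l)) * a (i, l') (e (i, l'))))); last first.
    by move=> l _; rewrite wavg_sum.
  rewrite -wavg_sum -wavgZ; apply: eq_bigr => e _; congr (_ * _).
  have -> : \sum_l \sum_l' a (i, l) (e (i, l)) * a (i, l') (e (i, l')) =
      (\sum_l a (i, l) (e (i, l))) ^+ 2.
    by rewrite expr2 mulr_suml; apply: eq_bigr => l _; rewrite mulr_sumr.
  rewrite -exprVn -exprMn; congr (_ ^+ 2).
  by rewrite /a /= sumrB sumr_const card_ord -[sines x i *+ m]mulr_natl mulrBr mulKf.
rewrite (eq_bigr (fun l => 1 - sines x i ^+ 2)); last first.
  move=> l _; rewrite (bigD1 l) //= big1 ?addr0; last first.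
    move=> l' l'l; rewrite wavg_mul2 //; first by rewrite xpair_eqE eqxx eq_sym (negbTE l'l).
    exact: sweight_sum.
  rewrite wavg_mul2 //; last exact: sweight_sum.
  by rewrite eqxx /sweight /a /sgn /=; field.
rewrite sumr_const card_ord -[(1 - _) *+ m]mulr_natl.
rewrite (_ : _ * _ = m%:R^-1 * (1 - sines x i ^+ 2)); last by field.
by rewrite ler_piMr ?invr_ge0 // gerBl sqr_ge0.
Qed.

(** Replacing [x_i] by [L sin (x_i / L)] costs [x_i^2 / L]. The fluctuation z around it is handled
    by [|z| <= eta / 2 + z^2 / (2 eta)], which trades the first moment for the variance. *)
Lemma bernstein_error g x (eta : R) : lip1 g -> 0 < eta ->
  `|g x - bernstein g x| <=
  L^-1 * \sum_i x 0 i ^+ 2 + L * d%:R * (eta / 2 + (2 * eta * m%:R)^-1).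
Proof.
move=> lg e0.
have mR : m%:R != 0 :> R by rewrite pnatr_eq0 -lt0n.
rewrite /bernstein -{1}(wavg_cst (sweight_sum x) (g x)).
have -> : wavg (sweight x) (fun=> g x) - wavg (sweight x) (fun e => g (node e)) =
    wavg (sweight x) (fun e => g x - g (node e)).
  by rewrite wavgD; congr (_ + _); rewrite -mulN1r -wavgZ; apply: eq_bigr => e _; rewrite mulN1r.
apply: le_trans (wavg_norm (sweight_ge0 x) _) _.
apply: (@le_trans _ _ (wavg (sweight x) (fun e => \sum_i (L^-1 * x 0 i ^+ 2 +
   L * (eta / 2 + (2 * eta)^-1 * (sines x i - m%:R^-1 * \sum_l sgn (e (i, l))) ^+ 2))))).
  apply: wavg_le => [p b|e]; first exact: sweight_ge0.
  apply: le_trans (lip1_sub _ _ lg) _; apply: ler_sum => i _; rewrite !mxE.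
  set z := _ - m%:R^-1 * _.
  have -> : x 0 i - L / m%:R * (\sum_l sgn (e (i, l))) =
      L * (x 0 i / L - sin (x 0 i / L)) + L * z.
    by rewrite /z sinesE; field; rewrite mR gt_eqF.
  apply: le_trans (ler_normD _ _) _; rewrite !normrM (gtr0_norm L0); apply: lerD.
    rewrite (_ : L^-1 * _ = L * (x 0 i / L) ^+ 2); last by field; rewrite gt_eqF.
    by rewrite ler_wpM2l ?sin_sub_le // ltW.
  rewrite ler_wpM2l ?(ltW L0) //.
  rewrite -subr_ge0 (_ : _ - _ = (2 * eta)^-1 * (`|z| - eta) ^+ 2); last first.
    by rewrite -[in LHS](real_normK (num_real z)); field; rewrite gt_eqF.
  by rewrite mulr_ge0 ?sqr_ge0 // invr_ge0 mulr_ge0 // ltW.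
rewrite wavg_sum.
apply: (@le_trans _ _ (\sum_(i < d) (L^-1 * x 0 i ^+ 2 + L * (eta / 2 + (2 * eta)^-1 * m%:R^-1)))).
  apply: ler_sum => i _; rewrite wavgD wavg_cst; last exact: sweight_sum.
  rewrite lerD2l wavgZ ler_wpM2l ?(ltW L0) // wavgD wavg_cst; last exact: sweight_sum.
  rewrite lerD2l wavgZ ler_wpM2l ?node_variance // invr_ge0; apply: mulr_ge0 => //; exact: ltW.
rewrite big_split /= -mulr_sumr lerD2l sumr_const card_ord -[X in X <= _]mulr_natl.
rewrite le_eqVlt; apply/orP; left; apply/eqP; field; rewrite mR /= gt_eqF //.
Qed.

End bernstein.

Section lipschitz_functions.
Context {R : realType} (d : nat).
Implicit Types (g : 'rV[R]_d -> R).

(** A trigonometric polynomial cannot follow an unbounded function uniformly; the quadratic weight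
    is a price that second moments can pay. *)
Lemma trig_approx g (delta : R) : lip1 g -> 0 < delta ->
  exists2 h, trig h & forall x, `|g x - h x| <= delta * (1 + \sum_i x 0 i ^+ 2).
Proof.
move=> lg d0.
(* [1 / L = delta] settles the quadratic part, [L * d.+1 * eta = delta] the constant part, and
   [m >= eta^-2] makes the variance term at most [eta / 2]. Taking [d.+1] keeps [eta] meaningful for
   d = 0. *)
pose L := delta^-1; pose eta := delta / (L * d.+1%:R).
have L0 : 0 < L by rewrite invr_gt0.
have dS : 0 < d.+1%:R :> R by rewrite ltr0n.
have e0 : 0 < eta by rewrite divr_gt0 // mulr_gt0.
pose m := (Num.truncn (eta ^- 2)).+1.
exists (bernstein L m g) => [|x]; first exact: trig_bernstein.
apply: le_trans (bernstein_error L0 (ltn0Sn _) x lg e0) _.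
rewrite -/m (_ : L^-1 = delta) ?invrK // [delta * (1 + _)]mulrDr mulr1 addrC lerD2r.
have em : (2 * eta * m%:R)^-1 <= eta / 2.
  have p1 : 0 < 2 * eta * m%:R by rewrite mulr_gt0 ?ltr0n // mulr_gt0.
  have p2 : 0 < eta / 2 by rewrite divr_gt0.
  rewrite invf_ple ?posrE //.
  rewrite (_ : (eta / 2)^-1 = 2 * eta * eta ^- 2); last by field; rewrite gt_eqF.
  have hm : eta ^- 2 <= m%:R by apply/ltW; exact: truncnS_gt.
  by rewrite ler_wpM2l // mulr_ge0 // ltW.
apply: (@le_trans _ _ (L * d.+1%:R * (eta / 2 + eta / 2))).
  have q1 : 0 <= L * d%:R by rewrite mulr_ge0 // ltW.
  have q2 : 0 <= (2 * eta * m%:R)^-1.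
    by rewrite invr_ge0 mulr_ge0 // mulr_ge0 // ltW.
  apply: ler_pM => //.
  - by rewrite addr_ge0 // divr_ge0 // ltW.
  - by rewrite ler_wpM2l ?(ltW L0) // ler_nat.
  - by rewrite lerD2l.
rewrite (_ : _ * _ = L * d.+1%:R * eta); last by field.
by rewrite /eta mulrC divfK // gt_eqF // mulr_gt0.
Qed.

Context {dT : measure_display} {T : measurableType dT}.

Lemma measurable_trig h (Z : 'I_d -> T -> R) : trig h ->
  (forall i, measurable_fun setT (Z i)) ->
  measurable_fun setT (fun w => h (\row_i Z i w)).
Proof.
move=> th mZ; elim: th => [a b|f g _ IHf _ IHg|c f _ IH].
- apply: measurableT_comp; first by apply: continuous_measurable_fun; exact: continuous_cos.
  apply: measurable_funD => //.
  apply: measurable_sum => i; apply: measurable_funM => //.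
  by rewrite (_ : (fun w => _) = Z i) //; apply/funext => w; rewrite mxE.
- exact: measurable_funD.
- exact: measurable_funM.
Qed.

(** A pointwise limit of trigonometric polynomials, for which measurability is a matter of
    real-valued functions only. *)
Lemma measurable_lip1 g (Z : 'I_d -> T -> R) : lip1 g ->
  (forall i, measurable_fun setT (Z i)) ->
  measurable_fun setT (fun w => g (\row_i Z i w)).
Proof.
move=> lg mZ.
have [h Hh] : {h : nat -> 'rV[R]_d -> R & forall n, trig (h n) /\
   forall x, `|g x - h n x| <= n.+1%:R^-1 * (1 + \sum_i x 0 i ^+ 2)}.
  apply: (@choice _ _ (fun n h => trig h /\
   forall x, `|g x - h x| <= n.+1%:R^-1 * (1 + \sum_i x 0 i ^+ 2))) => n.
  have [|h th Hh] := trig_approx (delta := n.+1%:R^-1) lg; first by rewrite invr_gt0.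
  by exists h.
apply: (measurable_fun_cvg (h := fun n w => h n (\row_i Z i w))) => [n|w _].
  by apply: measurable_trig => //; have [] := Hh n.
set x := \row_i _.
have K : (fun n : nat => n.+1%:R^-1 * (1 + \sum_i x 0 i ^+ 2)) @ \oo --> (0 : R).
  by have := cvgnM (@cvg_harmonic R) (cvgnC (1 + \sum_i x 0 i ^+ 2)); rewrite mul0r.
apply/cvgrPdist_le => e e0; move/cvgrPdist_le : K => /(_ e e0) [N _ HN].
exists N => // n /= Nn; apply: le_trans ((Hh n).2 x) _.
by have := HN n Nn; rewrite sub0r normrN; apply: le_trans; exact: ler_norm.
Qed.

End lipschitz_functions.

(** * Gaussian vectors *)

Section normal_density.
Context {R : realType}.
Local Notation mu := (@lebesgue_measure R).

Lemma integral_normal_prob (m s : R) (f : R -> \bar R) : measurable_fun setT f ->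
  (\int[normal_prob m s]_x `|f x| < +oo)%E ->
  (\int[normal_prob m s]_x f x = \int[mu]_x (f x * (normal_pdf m s x)%:E))%E.
Proof.
move=> mf finf.
have dom := normal_prob_dominates m s.
rewrite -(Radon_Nikodym_change_of_variables dom) //=; last by apply/integrableP; split.
apply: ae_eq_integral => //.
- exact: emeasurable_funM.
- apply: emeasurable_funM => //; apply/measurable_EFinP; exact: measurable_normal_pdf.
- apply: ae_eqe_mul2l => /=.
  rewrite Radon_NikodymE //=.
  case: cid => /= h [h1 h2 h3].
  apply: integral_ae_eq => //=.
  + by apply/measurable_EFinP; exact: measurable_normal_pdf.
  + by move=> E E01 mE; rewrite -h3.
Qed.

Lemma continuousT_measurable (f : R -> R) : continuous f -> measurable_fun setT f.
Proof. exact: continuous_measurable_fun. Qed.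

Lemma normal_pdf_expR (m s : R) : s != 0 -> normal_pdf m s =
  fun x => normal_peak s * expR (- (x - m) ^+ 2 / (s ^+ 2 *+ 2)).
Proof. by move=> s0; rewrite normal_pdfE. Qed.

Lemma is_derive_normal_pdf (m s x : R) : s != 0 ->
  is_derive x (1 : R) (normal_pdf m s) (- ((x - m) / s ^+ 2) * normal_pdf m s x).
Proof.
move=> s0; rewrite normal_pdf_expR //.
have H : is_derive x (1 : R) (fun x => - (x - m) ^+ 2 / (s ^+ 2 *+ 2)) (- ((x - m) / s ^+ 2)).
  have H1 : is_derive x (1 : R) (fun x => x - m) (1 - 0) by apply: is_deriveB.
  have H2 := is_deriveX 1 H1.
  have H3 := is_deriveN H2.
  have H4 := is_deriveZ (s ^+ 2 *+ 2)^-1 H3.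
  apply: is_derive_eq.
  by rewrite /GRing.scale /=; field.
have H2 := is_derive1_comp (is_derive_expR _) H.
have H3 := is_deriveZ (normal_peak s) H2.
apply: is_derive_eq.
by rewrite /GRing.scale /=; ring.
Qed.

(** From [exp u >= 1 + u]. Quadratic decay beats the linear growth allowed for the test functions in
    Stein's identity. *)
Lemma normal_pdf_decay (m s x : R) : s != 0 ->
  normal_pdf m s x <= normal_peak s / (1 + (x - m) ^+ 2 / (s ^+ 2 *+ 2)).
Proof.
move=> s0; rewrite normal_pdf_expR //.
rewrite ler_wpM2l ?normal_peak_ge0 // mulNr expRN lef_pV2 ?posrE ?expR_gt0 //.
  exact: expR_ge1Dx.
by rewrite ltr_pwDl // mulr_ge0 ?sqr_ge0 // invr_ge0 mulrn_wge0 // sqr_ge0.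
Qed.

End normal_density.

(** * Stein's identity for the normal law on the line *)

Section normal_stein.
Context {R : realType}.
Local Notation mu := (@lebesgue_measure R).
Variables (m s : R) (s0 : s != 0) (f f' : R -> R).
Hypothesis df : forall x : R, is_derive x (1 : R) f (f' x).
Hypothesis cf' : continuous f'.
Hypothesis fb : forall x, `|f x| <= 1 + `|x|.

Let k x := f' x - (x - m) / s ^+ 2 * f x.
Let F x := f x * normal_pdf m s x.
Let dF x := k x * normal_pdf m s x.

Lemma stein_is_derive (x : R) : is_derive x (1 : R) F (dF x).
Proof.
have := is_deriveM (df x) (is_derive_normal_pdf m x s0).
by rewrite (_ : _ *: _ + _ = dF x) // /GRing.scale /= /dF /k; ring.
Qed.

Lemma is_derive_continuous (h h' : R -> R) :
  (forall x : R, is_derive x (1 : R) h (h' x)) -> continuous h.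
Proof.
by move=> H x; apply: differentiable_continuous; apply/derivable1_diffP; have [] := H x.
Qed.

Lemma stein_kernel_continuous : continuous k.
Proof.
have cf := is_derive_continuous df.
move=> x; apply: cvgB; first exact: cf'.
apply: cvgM; last exact: cf.
by apply: cvgM; [apply: cvgB; [exact: cvg_id|exact: cvg_cst]|exact: cvg_cst].
Qed.

Lemma stein_dF_continuous : continuous dF.
Proof.
move=> x; apply: cvgM; first exact: stein_kernel_continuous.
exact: continuous_normal_pdf.
Qed.

(** Beyond [2 |m| + 1] one has [|x - m| >= |x| / 2] and [1 + |x| <= 2 |x|]; the constant 16 is the
    product of 2 and the 8 from [x^2 / (8 s^2)]. *)
Lemma stein_decay (x : R) : 2 * `|m| + 1 <= `|x| ->
  `|F x| <= 16 * s ^+ 2 * normal_peak s / `|x|.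
Proof.
move=> mx; have x1 : 1 <= `|x|.
  by apply: le_trans mx; rewrite lerDr mulr_ge0.
have x0 : 0 < `|x| by lra.
have s2 : 0 < s ^+ 2 by rewrite exprn_even_gt0.
have pk : 0 <= normal_peak s := normal_peak_ge0 s.
rewrite /F normrM (ger0_norm (normal_pdf_ge0 _ _ _)).
apply: (@le_trans _ _ ((2 * `|x|) * (normal_peak s / (`|x| ^+ 2 / (8 * s ^+ 2))))); last first.
  by rewrite le_eqVlt; apply/orP; left; apply/eqP; field; rewrite s0 gt_eqF.
apply: ler_pM => //; first exact: normal_pdf_ge0.
  by apply: le_trans (fb x) _; lra.
apply: le_trans (normal_pdf_decay m x s0) _.
rewrite ler_wpM2l // lef_pV2 ?posrE; last 2 first.
- by rewrite ltr_pwDl // divr_ge0 ?sqr_ge0 // mulrn_wge0 // sqr_ge0.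
- by rewrite divr_gt0 ?exprn_gt0 // mulr_gt0.
have h : `|x| ^+ 2 / 4 <= (x - m) ^+ 2.
  have := ler_normB x m; have := lerB_dist x m => h1 h2.
  have h3 : `|x| / 2 <= `|x - m| by lra.
  rewrite -[leRHS]real_normK ?num_real //.
  rewrite (_ : `|x| ^+ 2 / 4 = (`|x| / 2) ^+ 2); last by field.
  by rewrite ler_pXn2r // nnegrE divr_ge0.
apply: (@le_trans _ _ ((x - m) ^+ 2 / (s ^+ 2 *+ 2))); last by rewrite lerDr.
rewrite -mulr_natr ler_pdivrMr; last by apply: mulr_gt0.
rewrite (_ : _ / _ * _ = 4 * (x - m) ^+ 2); last by field.
by rewrite mulrC; lra.
Qed.

Hypothesis ik : (normal_prob m s).-integrable setT (EFin \o k).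

Lemma stein_dF_integrable : mu.-integrable setT (EFin \o dF).
Proof.
have mk : measurable_fun setT k by exact: (continuousT_measurable stein_kernel_continuous).
apply/integrableP; split.
  by apply/measurable_EFinP; exact: (continuousT_measurable stein_dF_continuous).
have /integrableP[_ ki] := ik.
have := @integral_normal_prob R m s (fun x => `|(k x)%:E|%E).
rewrite (_ : (\int[mu]_x _)%E = \int[mu]_x (`|(k x)%:E| * (normal_pdf m s x)%:E))%E; last first.
  by apply: eq_integral => x _; rewrite /= normrM (ger0_norm (normal_pdf_ge0 _ _ _)).
move=> <- //.
- by apply: measurableT_comp => //; exact/measurable_EFinP.
- by under eq_integral do rewrite abse_id.
Qed.

Let I (n : nat) : set R := `[- n.+1%:R, n.+1%:R]%classic.

Lemma stein_ftc (n : nat) :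
  (\int[mu]_(x in I n) (dF x)%:E = (F n.+1%:R - F (- n.+1%:R))%:E)%E.
Proof.
have cF := is_derive_continuous stein_is_derive.
rewrite EFinB; apply: continuous_FTC2.
- by apply: lt_trans (_ : 0 < _); rewrite ?oppr_lt0 ltr0n.
- by apply: continuous_subspaceT; exact: stein_dF_continuous.
- split.
  + by move=> x _; have [] := stein_is_derive x.
  + by apply: cvg_at_right_filter; exact: cF.
  + by apply: cvg_at_left_filter; exact: cF.
- by move=> x _; rewrite derive1E; have [_ ->] := stein_is_derive x.
Qed.

Lemma stein_cvg_boundary : (fun n => F n.+1%:R - F (- n.+1%:R)) @ \oo --> (0 : R).
Proof.
pose C := 32 * s ^+ 2 * normal_peak s.
have K : (fun n => C * n.+1%:R^-1) @ \oo --> (0 : R).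
  by have := cvgnM (cvgnC C) (@cvg_harmonic R); rewrite mulr0.
apply/norm_cvg0P; apply: (squeeze_cvgr _ (cvgnC 0) K).
pose N := Num.truncn (2 * `|m| + 1).
exists N => // n /= Nn.
have hn : 2 * `|m| + 1 <= n.+1%:R.
  apply: le_trans (ltW (truncnS_gt _)) _; by rewrite ler_nat ltnS.
rewrite normr_ge0 /=; apply: le_trans (ler_normB _ _) _.
have n0 : 0 < n.+1%:R :> R by rewrite ltr0n.
have h1 := @stein_decay n.+1%:R; have h2 := @stein_decay (- n.+1%:R).
rewrite normrN (gtr0_norm n0) in h2; rewrite (gtr0_norm n0) in h1.
rewrite (_ : C * _ = 16 * s ^+ 2 * normal_peak s / n.+1%:R +
  16 * s ^+ 2 * normal_peak s / n.+1%:R); last by rewrite /C; ring.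
by apply: lerD; [exact: h1|exact: h2].
Qed.

(** The kernel times the density is the derivative of [f] times the density. Its integral over
    growing intervals is a boundary term tending to 0, and dominated convergence gives the whole
    line. *)
Lemma normal_stein : (\int[normal_prob m s]_x (k x)%:E = 0)%E.
Proof.
have mk : measurable_fun setT k by exact: (continuousT_measurable stein_kernel_continuous).
have mdF : measurable_fun setT (EFin \o dF).
  by apply/measurable_EFinP; exact: (continuousT_measurable stein_dF_continuous).
rewrite integral_normal_prob; last 2 first.
- exact/measurable_EFinP.
- by case/integrableP : ik.
rewrite (_ : (\int[mu]_x _)%E = \int[mu]_x (EFin \o dF) x)%E; last by apply: eq_integral.
have H1 n : measurable_fun setT ((EFin \o dF) \_ (I n)).
  have mI : measurable (I n) by exact: measurable_itv.
  by apply/(measurable_restrictT _ mI); exact: measurable_funTS mdF.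
have H2 : {ae mu, forall x, setT x ->
    ((EFin \o dF) \_ (I n)) x @[n --> \oo] --> (EFin \o dF) x}.
  apply: aeW => x _; apply: cvg_near_cst.
  exists (Num.truncn `|x|) => // n /= xn; rewrite patchE mem_set // /I /= in_itv /=.
  rewrite -ler_norml; apply: le_trans (ltW (truncnS_gt _)) _; by rewrite ler_nat ltnS.
have H3 := integrable_abse stein_dF_integrable.
have H4 : {ae mu, forall x n, setT x ->
    (`|((EFin \o dF) \_ (I n)) x| <= (abse \o (EFin \o dF)) x)%E}.
  by apply: aeW => x n _; rewrite /= patchE; case: ifP => // _; rewrite abse0.
have [_ _ H] := @dominated_convergence _ _ R mu setT measurableT _ _ _ H1 mdF H2 H3 H4.
have E n : (\int[mu]_x ((EFin \o dF) \_ (I n)) x = (F n.+1%:R - F (- n.+1%:R))%:E)%E.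
  by rewrite -stein_ftc -integral_mkcond.
have {}H : ((F n.+1%:R - F (- n.+1%:R))%:E @[n --> \oo] --> \int[mu]_x (EFin \o dF) x)%E.
  rewrite (_ : (fun n => (F n.+1%:R - F (- n.+1%:R))%:E) =
    (fun n => (\int[mu]_x ((EFin \o dF) \_ (I n)) x)%E)); first exact: H.
  by apply/funext => n; rewrite E.
have K : ((F n.+1%:R - F (- n.+1%:R))%:E @[n --> \oo] --> 0%:E)%E.
  by apply/fine_cvgP; split; [exact: nearW|exact: stein_cvg_boundary].
by rewrite -(cvg_lim _ H) // (cvg_lim _ K).
Qed.

End normal_stein.

(** * Characteristic function of a centred Gaussian variable *)

Section gaussian_characteristic_function.
Context {R : realType} {dT : measure_display} {T : measurableType dT}.
Variables (Q : probability T R) (Y : T -> R) (m s : R).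
Hypothesis mY : measurable_fun setT Y.
Hypothesis hlaw : forall A : set R, measurable A -> Q (Y @^-1` A) = normal_law m s A.
Hypothesis LY : L2 Q Y.
Hypothesis Y0 : mean Q Y = 0.

(* The library's normal law lives on [measurableTypeR R] rather than on [R]. *)
Let Y' : T -> measurableTypeR R := Y.
Let mY' : measurable_fun setT Y' := mY.
Let mY_mixin := isMeasurableFun.Build _ _ _ _ _ mY'.
Let mY_pack : {mfun T >-> measurableTypeR R} := HB.pack Y' mY_mixin.

Lemma law_integral (f : R -> R) : s != 0 -> measurable_fun setT f ->
  itg Q (f \o Y) ->
  (normal_prob m s).-integrable setT (EFin \o f) /\
  (\int[normal_prob m s]_x (f x)%:E = (mean Q (f \o Y))%:E)%E.
Proof.
move=> s0 mf fY.
have E (h : measurableTypeR R -> \bar R) : measurable_fun setT h ->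
    (\int[normal_prob m s]_x h x = \int[pushforward Q mY_pack]_x h x)%E.
  move=> mh; apply: eq_measure_integral => A mA _.
  by rewrite /pushforward -[RHS]/(Q (Y @^-1` A)) hlaw // /normal_law (negbTE s0).
have mfE : measurable_fun [set: measurableTypeR R] (EFin \o f) by exact/measurable_EFinP.
have fY' : Q.-integrable (Y' @^-1` setT) ((EFin \o f) \o Y') by rewrite preimage_setT.
have := integrable_pushforward mY' mfE fY' measurableT.
move=> /integrableP[_ fi]; split.
  apply/integrableP; split => //; rewrite E //.
  by apply: measurableT_comp.
rewrite -mean_EFin // E //.
by have := integral_pushforward mY' mfE fY' measurableT; rewrite preimage_setT.
Qed.

Lemma gaussian_stein (f f' : R -> R) : s != 0 ->
  (forall x : R, is_derive x (1 : R) f (f' x)) -> continuous f' ->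
  (forall x, `|f x| <= 1 + `|x|) -> (forall x, `|f' x| <= 1) ->
  mean Q (fun w => f' (Y w)) = (s ^+ 2)^-1 * mean Q (fun w => (Y w - m) * f (Y w)).
Proof.
move=> s0 df cf' fb fb'.
have cf := is_derive_continuous df.
have mf : measurable_fun setT f by exact: continuousT_measurable.
have mf' : measurable_fun setT f' by exact: continuousT_measurable.
have mfY : measurable_fun setT (f \o Y) by exact: measurableT_comp.
have mfY' : measurable_fun setT (f' \o Y) by exact: measurableT_comp.
have LfY : L2 Q (fun w => f (Y w)).
  apply: (L2_le (P := Q) mfY _ (L2D (L2cst Q 1) (L2_norm LY))) => w /=.
  by rewrite [X in _ <= X]ger0_norm ?addr_ge0.
have LfY' : L2 Q (fun w => f' (Y w)).
  by apply: (L2_le (P := Q) mfY' _ (L2cst Q 1)) => w /=; rewrite normr1.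
have iYf : itg Q (fun w => (Y w - m) * f (Y w)).
  by apply: L2M => //; apply: L2B => //; exact: L2cst.
pose k x := f' x - (x - m) / s ^+ 2 * f x.
have kE w : k (Y w) = f' (Y w) - (s ^+ 2)^-1 * ((Y w - m) * f (Y w)).
  by rewrite /k; ring.
have ik : itg Q (k \o Y).
  by apply: eq_itg (itgB (L2_itg LfY') (itgZ (s ^+ 2)^-1 iYf)) => w; rewrite /= kE.
have mk : measurable_fun setT k.
  exact: continuousT_measurable (stein_kernel_continuous df cf').
have [inu E] := law_integral s0 mk ik.
have := normal_stein s0 df cf' fb inu; rewrite E => -[] H.
apply/eqP; rewrite -subr_eq0 -meanZ // -meanB; [|exact: L2_itg|exact: itgZ].
by rewrite -H; apply/eqP/eq_mean => w; rewrite /= kE.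
Qed.

(** [gaussian_vector] leaves the parameters [m] and [s] unspecified. Stein's identity for the
    constant 1 and for the identity function reads them off the moments. *)
Lemma gaussian_mean_var : s != 0 -> m = 0 /\ s ^+ 2 = n2 Q Y.
Proof.
move=> s0; have s2 : s ^+ 2 != 0 by rewrite expf_neq0.
have m0 : m = 0.
  have := @gaussian_stein (fun=> 1) (fun=> 0) s0.
  rewrite mean_cst => H; apply/eqP.
  have {}H : 0 = (s ^+ 2)^-1 * mean Q (fun w => (Y w - m) * 1).
    apply: H => [x|x|x].
    - exact: cvg_cst.
    - by rewrite normr1 lerDl.
    - by rewrite normr0.
  move/eqP : H; rewrite eq_sym mulf_eq0 invr_eq0 (negbTE s2) /=.
  rewrite (eq_mean Q (g := fun w => Y w - m)); last by move=> w; rewrite mulr1.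
  rewrite meanB ?mean_cst ?Y0 ?sub0r ?oppr_eq0 //; first exact: L2_itg.
  exact: itg_cst.
split => //.
have := @gaussian_stein id (fun=> 1) s0.
rewrite mean_cst => H.
have {}H : 1 = (s ^+ 2)^-1 * mean Q (fun w => (Y w - m) * Y w).
  apply: H => [x|x|x].
  - exact: cvg_cst.
  - by rewrite lerDr.
  - by rewrite normr1.
rewrite (_ : n2 Q Y = mean Q (fun w => (Y w - m) * Y w)).
  by rewrite -[LHS]mulr1 H mulrA divff // mul1r.
by apply: eq_mean => w; rewrite m0 subr0 expr2.
Qed.

Lemma gaussian_degenerate : s = 0 -> n2 Q Y = 0.
Proof.
move=> s0; apply: ae_n2_eq0 => //.
have ae_m : {ae Q, forall w, Y w = m}.
  exists (Y @^-1` (~` [set m])); split.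
  - by rewrite -[X in measurable X]setTI; apply: mY => //; apply: measurableC; exact: measurable_set1.
  - rewrite hlaw; last by apply: measurableC; exact: measurable_set1.
    by rewrite /normal_law s0 eqxx diracE memNset // => H; apply: H.
  - by move=> w /= Hw; exact: Hw.
have := ae_eq_mean mY (measurable_cst m) ae_m; rewrite Y0 mean_cst => m0.
by apply: filterS ae_m => w ->.
Qed.

Lemma itg_cos (t b : R) : itg Q (fun w => cos (t * Y w + b)).
Proof.
have mc : measurable_fun setT (fun w => cos (t * Y w + b)).
  apply: measurableT_comp; first by apply: continuous_measurable_fun; exact: continuous_cos.
  by apply: measurable_funD => //; exact: measurable_funM.
by apply: itg_le mc _ (itg_cst Q 1) => w; exact: cos_max.
Qed.

Lemma L2_sin (t b : R) : L2 Q (fun w => sin (t * Y w + b)).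
Proof.
have mc : measurable_fun setT (fun w => sin (t * Y w + b)).
  apply: measurableT_comp; first by apply: continuous_measurable_fun; exact: continuous_sin.
  by apply: measurable_funD => //; exact: measurable_funM.
by apply: L2_le mc _ (L2cst Q 1) => w; rewrite normr1; exact: sin_max.
Qed.

Lemma gaussian_sin (t b : R) : mean Q (fun w => Y w * sin (t * Y w + b)) =
  n2 Q Y * t * mean Q (fun w => cos (t * Y w + b)).
Proof.
have [s0|s0] := eqVneq s 0.
  have q0 := gaussian_degenerate s0; rewrite q0 !mul0r.
  have aeY := n2_eq0 LY q0.
  rewrite -(mean_cst Q 0); apply: ae_eq_mean => //.
    by apply: itg_mf; apply: L2M LY (L2_sin t b).
  by apply: filterS aeY => w ->; rewrite mul0r.
have [m0 sE] := gaussian_mean_var s0.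
have [t0|t0] := eqVneq t 0.
  rewrite t0 mulr0 mul0r (eq_mean Q (g := fun w => sin b * Y w)).
    by rewrite meanZ ?Y0 ?mulr0 //; exact: L2_itg.
  by move=> w; rewrite mul0r add0r mulrC.
(* This scaling puts the sine and its derivative within the bounds required by [gaussian_stein]; it
   is divided out at the end. *)
pose c := (1 + `|t|)^-1.
have c0 : 0 < c by rewrite invr_gt0 ltr_pwDl.
have ct : c * `|t| <= 1 by rewrite /c mulrC ler_pdivrMr ?mul1r ?lerDr // ltr_pwDl.
have c1 : c <= 1 by rewrite /c invf_le1 ?lerDl // ltr_pwDl.
have dlin (x : R) : is_derive x (1 : R) (fun x => t * x + b) t.
  have H1 := is_deriveZ t (is_derive_id x (1 : R)).
  have H2 := is_deriveD H1 (is_derive_cst b x (1 : R)).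
  by apply: is_derive_eq; rewrite /GRing.scale /= mulr1 addr0.
have df (x : R) : is_derive x (1 : R) (fun x => c * sin (t * x + b)) (c * (t * cos (t * x + b))).
  have H1 := is_derive1_comp (is_derive_sin _) (dlin x).
  have H2 := is_deriveZ c H1.
  by apply: is_derive_eq; rewrite /GRing.scale /=; ring.
have cf' : continuous (fun x => c * (t * cos (t * x + b))).
  move=> x; apply: cvgM; first exact: cvg_cst.
  apply: cvgM; first exact: cvg_cst.
  apply: (@continuous_comp _ _ _ (fun x => t * x + b) (@cos R)); last exact: continuous_cos.
  by apply: cvgD; [apply: cvgM; [exact: cvg_cst|exact: cvg_id]|exact: cvg_cst].
have := gaussian_stein s0 df cf' _ _.
have iYs := L2M LY (L2_sin t b).
rewrite (eq_mean Q (f := fun w => c * (t * cos (t * Y w + b))) (g := fun w => (c * t) * cos (t * Y w + b))); last by move=> w; rewrite mulrA.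
rewrite (eq_mean Q (f := fun w => (Y w - m) * _) (g := fun w => c * (Y w * sin (t * Y w + b)))); last first.
  by move=> w; rewrite m0 subr0; ring.
rewrite !meanZ //; last exact: itg_cos.
rewrite sE => H.
have q0 : n2 Q Y != 0 by rewrite -sE expf_neq0.
have {}H := H _ _; rewrite -[LHS](mulKf q0).
have E : c * t * mean Q (fun w => cos (t * Y w + b)) =
    (n2 Q Y)^-1 * (c * mean Q (fun w => Y w * sin (t * Y w + b))).
  apply: H => x.
    rewrite normrM (gtr0_norm c0); apply: le_trans (_ : 1 * 1 <= _).
      by apply: ler_pM => //; [exact: ltW|exact: sin_max].
    by rewrite mulr1 lerDl.
  rewrite mulrA normrM normrM (gtr0_norm c0) -[leRHS]mulr1.
  by apply: ler_pM => //; [rewrite mulr_ge0 // ltW|exact: cos_max].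
rewrite -mulrA; apply/eqP; rewrite -(inj_eq (mulfI (lt0r_neq0 c0))); apply/eqP.
transitivity (n2 Q Y * ((n2 Q Y)^-1 * (c * mean Q (fun w => Y w * sin (t * Y w + b))))).
  by rewrite mulVKf // mulKf.
by rewrite -E; ring.
Qed.

(** The derivative under the expectation is [- E (Y sin (t Y + b))], which [gaussian_sin] expresses
    by the cosine mean itself: a linear differential equation in t. *)
Lemma is_derive_mean_cos (b t : R) :
  is_derive t (1 : R) (fun t => mean Q (fun w => cos (t * Y w + b)))
    (- (n2 Q Y * t * mean Q (fun w => cos (t * Y w + b)))).
Proof.
apply: (@is_derive_quadratic _ _ _ _ (n2 Q Y)) => h.
rewrite -gaussian_sin.
have iYs := L2M LY (L2_sin t b).
have -> : mean Q (fun w => cos ((t + h) * Y w + b)) - mean Q (fun w => cos (t * Y w + b)) -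
    h * - mean Q (fun w => Y w * sin (t * Y w + b)) =
  mean Q (fun w => (cos ((t + h) * Y w + b) - cos (t * Y w + b)) + h * (Y w * sin (t * Y w + b))).
  rewrite meanD; [|by apply: itgB; exact: itg_cos|exact: itgZ].
  by rewrite meanB; [rewrite meanZ // mulrN opprK|exact: itg_cos|exact: itg_cos].
have iD : itg Q (fun w => (cos ((t + h) * Y w + b) - cos (t * Y w + b)) + h * (Y w * sin (t * Y w + b))).
  by apply: itgD; [apply: itgB; exact: itg_cos|exact: itgZ].
apply: le_trans (ler_norm_mean iD) _.
rewrite mulrC /n2 -meanZ; last exact: LY.2.
apply: le_mean => [||w]; [exact: itg_norm|by apply: itgZ; exact: LY.2|].
rewrite -exprMn; set u := t * Y w + b.
rewrite (_ : (t + h) * Y w + b = u + h * Y w); last by rewrite /u; ring.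
rewrite mulrA; set v := h * Y w.
have Hc (x : R) : is_derive x (1 : R) (@cos R) (- sin x) by exact: is_derive_cos.
have [c [E c1 c2]] := mvt_segment u (u + v) Hc.
rewrite E (_ : - sin c * (u + v - u) + v * sin u = v * (sin u - sin c)); last by ring.
rewrite normrM -[leRHS]real_normK ?num_real // expr2 ler_wpM2l //.
apply: le_trans (_ : `|u - c| <= _).
  have := cos_lip (u - pi / 2) (c - pi / 2); rewrite !cosBpihalf.
  by rewrite (_ : u - pi / 2 - (c - pi / 2) = u - c); [|ring].
move: c1 c2; rewrite minEle maxEle lerDl ler_norml.
case: (leP 0 v) => v0 c1 c2.
  by rewrite (ger0_norm v0); apply/andP; split; lra.
by rewrite (ltr0_norm v0); apply/andP; split; lra.
Qed.

(** The function [phi t * expR (q / 2 * t ^+ 2)] has zero derivative, so its values at 0 and 1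
    coincide. *)
Lemma gaussian_cos (b : R) :
  mean Q (fun w => cos (Y w + b)) = cos b * expR (- (n2 Q Y / 2)).
Proof.
pose q := n2 Q Y.
pose phi t := mean Q (fun w => cos (t * Y w + b)).
have dq (t : R) : is_derive t (1 : R) (fun t => q / 2 * t ^+ 2) (q * t).
  have H1 := is_deriveX 1 (is_derive_id t (1 : R)).
  have H2 := is_deriveZ (q / 2) H1.
  by apply: is_derive_eq; rewrite /GRing.scale /=; field.
have de (t : R) := is_derive1_comp (is_derive_expR _) (dq t).
have H (t : R) : is_derive t (1 : R) (fun t => phi t * expR (q / 2 * t ^+ 2)) 0.
  have := is_deriveM (is_derive_mean_cos b t) (de t).
  rewrite (_ : _ *: _ + _ = 0) // /GRing.scale /= -/(phi t) -/q.
  by ring.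
have [c [E _ _]] := mvt_segment 0 1 H.
move: E; rewrite mul0r expr0n expr1n mulr0 mulr1 expR0 mulr1 => /eqP.
rewrite subr_eq0 => /eqP E.
have p0 : phi 0 = cos b.
  by rewrite -[RHS](mean_cst Q); apply: eq_mean => w; rewrite mul0r add0r.
rewrite expRN -p0 -E mulfK ?gt_eqF ?expR_gt0 //.
by apply: eq_mean => w; rewrite mul1r.
Qed.

End gaussian_characteristic_function.

Section psd_decomposition.
Context {R : realType} (d : nat).
Implicit Types (S : 'M[R]_d) (u v w : 'rV[R]_d).

Definition form S u v : R := (u *m S *m v^T) 0 0.

Lemma formDl S u v w : form S (u + v) w = form S u w + form S v w.
Proof. by rewrite /form !mulmxDl mxE. Qed.

Lemma formDr S u v w : form S w (u + v) = form S w u + form S w v.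
Proof. by rewrite /form linearD /= mulmxDr mxE. Qed.

Lemma formZl S c u v : form S (c *: u) v = c * form S u v.
Proof. by rewrite /form -!scalemxAl mxE. Qed.

Lemma formZr S c u v : form S u (c *: v) = c * form S u v.
Proof. by rewrite /form linearZ /= -scalemxAr mxE. Qed.

Lemma form_sym S u v : S^T = S -> form S u v = form S v u.
Proof.
move=> sS; rewrite /form -[LHS]trace_mx11 -[RHS]trace_mx11 -mxtrace_tr.
by rewrite !trmx_mul trmxK sS mulmxA.
Qed.

Lemma form_delta S i j : form S (delta_mx 0 i) (delta_mx 0 j) = S i j.
Proof.
rewrite /form -rowE trmx_delta; transitivity ((row i S) 0 j); last by rewrite mxE.
by rewrite mxE (bigD1 j) //= !mxE !eqxx mulr1 big1 ?addr0 // => k kj; rewrite !mxE (negbTE kj) mulr0.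
Qed.

Lemma form_deltal S i w : form S (delta_mx 0 i) w = \sum_j S i j * w 0 j.
Proof.
by rewrite /form -rowE mxE; apply: eq_bigr => j _; rewrite !mxE.
Qed.

(** The discriminant of the form along the line through w in direction i. *)
Lemma form_cauchy S i w : S^T = S -> psd S ->
  form S (delta_mx 0 i) w ^+ 2 <= form S w w * S i i.
Proof.
move=> sS pS; apply: discr_le; first exact: pS.
  by rewrite -form_delta; exact: pS.
move=> t; have := pS (w + t *: delta_mx 0 i).
rewrite -/(form S _ _) !(formDl, formDr, formZl, formZr) form_delta.
rewrite (form_sym w (delta_mx 0 i) sS) => H; apply: le_trans H _.
by rewrite le_eqVlt; apply/orP; left; apply/eqP; ring.
Qed.

Lemma psd_diag_ge0 S i : psd S -> 0 <= S i i.
Proof. by move=> pS; rewrite -form_delta; exact: pS. Qed.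

Lemma psd_diag0 S i j : S^T = S -> psd S -> S i i = 0 -> S i j = 0.
Proof.
move=> sS pS Sii; have := form_cauchy i (delta_mx 0 j) sS pS.
rewrite form_delta Sii mulr0 => H; apply/eqP; rewrite -sqrf_eq0 eq_le H.
exact: sqr_ge0.
Qed.

(* Each step of the symmetric Gaussian elimination clears a diagonal entry. *)
Lemma psd_decomp S : S^T = S -> psd S ->
  exists vs : seq 'rV[R]_d, forall i j, S i j = \sum_(v <- vs) v 0 i * v 0 j.
Proof.
have [n] := ubnP #|[pred i | S i i != 0]|; elim: n S => // n IH S; rewrite ltnS => Sn sS pS.
have [[i /= Si]|H] := pselect (exists i, S i i != 0); last first.
  exists [::] => i j; rewrite big_nil; apply: psd_diag0 => //; apply/eqP.
  by apply/negPn/negP => Si; apply: H; exists i.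
have Sp : 0 < S i i by rewrite lt_def Si psd_diag_ge0.
(* The Schur complement of the entry (i, i). It stays positive semi-definite by [form_cauchy], and
   the rank-one part removed is the square of the scaled row i. *)
pose S' : 'M[R]_d := \matrix_(j, k) (S j k - S i j * S i k / S i i).
have S'jk j k : S' j k = S j k - S i j * S i k / S i i by rewrite mxE.
have S'E w : form S' w w = form S w w - form S (delta_mx 0 i) w ^+ 2 / S i i.
  rewrite form_deltal expr2.
  have -> : form S' w w = \sum_k \sum_j (w 0 j * S j k * w 0 k -
      (S i j * w 0 j) * (S i k * w 0 k) / S i i).
    rewrite /form mxE; apply: eq_bigr => k _; rewrite !mxE mulr_suml.
    by apply: eq_bigr => j _; rewrite !mxE; ring.
  have -> : form S w w = \sum_k \sum_j w 0 j * S j k * w 0 k.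
    by rewrite /form mxE; apply: eq_bigr => k _; rewrite !mxE mulr_suml.
  rewrite mulr_suml mulr_suml -sumrB exchange_big /=.
  rewrite [in RHS](eq_bigr (fun k => \sum_j (w 0 j * S j k * w 0 k) -
     (S i k * w 0 k) * (\sum_j S i j * w 0 j) / S i i)) //.
  rewrite exchange_big /=; apply: eq_bigr => k _.
  rewrite sumrB; congr (_ - _); rewrite mulrAC mulr_sumr.
  by apply: eq_bigr => j _; ring.
have sS' : S'^T = S'.
  by apply/matrixP => j k; rewrite !mxE -{1}sS mxE; ring.
have pS' : psd S'.
  move=> w; rewrite -/(form S' w w) S'E subr_ge0 ler_pdivrMr //.
  exact: form_cauchy.
(* The entry (i, i) becomes 0. A diagonal entry that was 0 can only decrease, and positivity keeps
   it at 0. *)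
have S'n : (#|[pred j | S' j j != 0%R]| < n)%N.
  apply: leq_trans Sn; apply: proper_card; apply/properP; split.
    apply/fintype.subsetP => j; rewrite !inE; apply: contra => /eqP Sj.
    have := psd_diag_ge0 j pS'; rewrite S'jk Sj sub0r oppr_ge0 => H.
    rewrite oppr_eq0; apply/eqP/le_anti; rewrite H.
    by rewrite divr_ge0 ?(ltW Sp) // -expr2 sqr_ge0.
  exists i; first by rewrite inE.
  by rewrite inE negbK S'jk mulfK // subrr.
have [vs Hvs] := IH S' S'n sS' pS'.
exists ((Num.sqrt (S i i))^-1 *: row i S :: vs) => j k.
rewrite big_cons -Hvs S'jk !mxE.
rewrite (_ : (Num.sqrt (S i i))^-1 * S i j * ((Num.sqrt (S i i))^-1 * S i k) = S i j * S i k * (Num.sqrt (S i i))^-1 ^+ 2); last by ring.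
by rewrite exprVn sqr_sqrtr ?(ltW Sp) //; ring.
Qed.

End psd_decomposition.

(** * The central limit theorem for random signs *)

Section sign_averages.
Context {R : realType} (d : nat).
Implicit Types (u y z a : 'rV[R]_d) (us vs : seq 'rV[R]_d) (phi psi : 'rV[R]_d -> R).

(** All signed sums of [us], with repetitions, so that [avg] is the expectation over independent
    fair signs without any underlying probability space. *)
Fixpoint sign_sums us : seq 'rV[R]_d :=
  if us is u :: us' then
    [seq y + u | y <- sign_sums us'] ++ [seq y - u | y <- sign_sums us']
  else [:: 0].

Definition avg us phi : R := 2^-1 ^+ size us * \sum_(y <- sign_sums us) phi y.

Lemma avg_nil phi : avg [::] phi = phi 0.
Proof. by rewrite /avg /= big_seq1 expr0 mul1r. Qed.

Lemma avg_cons u us phi :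
  avg (u :: us) phi = 2^-1 * (avg us (fun y => phi (y + u)) + avg us (fun y => phi (y - u))).
Proof. by rewrite /avg /= big_cat !big_map exprS -mulrA -mulrDr. Qed.

Lemma eq_avg us phi psi : phi =1 psi -> avg us phi = avg us psi.
Proof. by move=> /funext ->. Qed.

Lemma avgD us phi psi : avg us (fun y => phi y + psi y) = avg us phi + avg us psi.
Proof. by rewrite /avg big_split mulrDr. Qed.

Lemma avgZ us c phi : avg us (fun y => c * phi y) = c * avg us phi.
Proof. by rewrite /avg -mulr_sumr mulrCA. Qed.

Lemma avgB us phi psi : avg us (fun y => phi y - psi y) = avg us phi - avg us psi.
Proof. by rewrite /avg sumrB mulrBr. Qed.

Lemma avg_le us phi psi : (forall y, phi y <= psi y) -> avg us phi <= avg us psi.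
Proof. by move=> H; rewrite /avg ler_wpM2l ?exprn_ge0 // ler_sum. Qed.

Lemma avg_norm us phi : `|avg us phi| <= avg us (fun y => `|phi y|).
Proof.
by rewrite /avg normrM ger0_norm ?exprn_ge0 // ler_wpM2l ?exprn_ge0 // ler_norm_sum.
Qed.

Lemma avg_cst us c : avg us (fun=> c) = c.
Proof.
elim: us => [|u us IH]; first by rewrite avg_nil.
by rewrite avg_cons !IH; field.
Qed.

Lemma avg_sum us (I : Type) (r : seq I) (phi : I -> 'rV[R]_d -> R) :
  avg us (fun y => \sum_(i <- r) phi i y) = \sum_(i <- r) avg us (phi i).
Proof. by rewrite /avg exchange_big mulr_sumr. Qed.

(** Averaging over one sign cancels the sine part of the addition formula. The free phase [b] makes
    the induction possible. *)
Lemma avg_cos us a b :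
  avg us (fun y => cos (dot a y + b)) = (\prod_(u <- us) cos (dot a u)) * cos b.
Proof.
elim: us b => [|u us IH] b.
  by rewrite avg_nil big_nil mul1r /dot big1 ?add0r // => j _; rewrite mxE mulr0.
rewrite avg_cons big_cons.
rewrite (eq_avg us (psi := fun y => cos (dot a y + (b + dot a u)))); last first.
  by move=> y; rewrite dotDr; congr cos; ring.
rewrite (eq_avg us (phi := fun y => cos (dot a (y - u) + b)) (psi := fun y => cos (dot a y + (b - dot a u)))); last first.
  by move=> y; rewrite dotDr dotNr; congr cos; ring.
by rewrite !IH cosD cosB; field.
Qed.

Lemma avg_sqr us a c :
  avg us (fun y => (dot a y + c) ^+ 2) = \sum_(u <- us) dot a u ^+ 2 + c ^+ 2.
Proof.
elim: us c => [|u us IH] c.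
  by rewrite avg_nil big_nil /dot big1 ?add0r // => j _; rewrite mxE mulr0.
rewrite avg_cons big_cons.
rewrite (eq_avg us (psi := fun y => (dot a y + (c + dot a u)) ^+ 2)); last first.
  by move=> y; rewrite dotDr; congr (_ ^+ 2); ring.
rewrite (eq_avg us (phi := fun y => (dot a (y - u) + c) ^+ 2) (psi := fun y => (dot a y + (c - dot a u)) ^+ 2)); last first.
  by move=> y; rewrite dotDr dotNr; congr (_ ^+ 2); ring.
by rewrite !IH; field.
Qed.

Lemma avg_coord_sqr us i : avg us (fun y => y 0 i ^+ 2) = \sum_(u <- us) u 0 i ^+ 2.
Proof.
have := avg_sqr us (1 *: delta_mx 0 i) 0; rewrite expr0n addr0 => H.
transitivity (avg us (fun y => (dot (1 *: delta_mx 0 i) y + 0) ^+ 2)).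
  by apply: eq_avg => y; rewrite dot_delta mul1r addr0.
by rewrite H; apply: eq_bigr => u _; rewrite dot_delta mul1r.
Qed.

Definition walk_scale n : R := Num.sqrt (n.+1%:R^-1).

(* Steps of a scaled random walk with [n + 1] independent copies of the signed
   sum of [vs]. *)
Definition walk vs n : seq 'rV[R]_d :=
  flatten (nseq n.+1 [seq walk_scale n *: v | v <- vs]).

Lemma walk_scale_sqr n : walk_scale n ^+ 2 = n.+1%:R^-1.
Proof. by rewrite sqr_sqrtr // invr_ge0. Qed.

Lemma walk_scale_ge0 n : 0 <= walk_scale n.
Proof. exact: sqrtr_ge0. Qed.

Lemma sum_walk vs n (F : 'rV[R]_d -> R) :
  \sum_(u <- walk vs n) F u = n.+1%:R * \sum_(v <- vs) F (walk_scale n *: v).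
Proof. by rewrite /walk big_flatten big_nseq iter_addr_0 big_map mulr_natl. Qed.

Lemma prod_walk vs n (F : 'rV[R]_d -> R) :
  \prod_(u <- walk vs n) F u = \prod_(v <- vs) F (walk_scale n *: v) ^+ n.+1.
Proof.
rewrite /walk big_flatten big_nseq big_map prodrXl.
by rewrite iter_mulr_1.
Qed.

Lemma sum_walk_mul vs n i j :
  \sum_(u <- walk vs n) u 0 i * u 0 j = \sum_(v <- vs) v 0 i * v 0 j.
Proof.
rewrite sum_walk mulr_sumr; apply: eq_bigr => v _; rewrite !mxE.
rewrite (_ : _ * (_ * _) = n.+1%:R * walk_scale n ^+ 2 * (v 0 i * v 0 j)); last by ring.
by rewrite walk_scale_sqr divff ?pnatr_eq0 // mul1r.
Qed.

End sign_averages.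

Section cosine_powers.
Context {R : realType}.

Lemma cos_quadratic (u : R) : `|cos u - (1 - u ^+ 2 / 2)| <= `|u| ^+ 3.
Proof.
have H (t : R) : is_derive t (1 : R) (fun t => cos t - (1 - t ^+ 2 / 2)) (- sin t + t).
  have H1 := is_derive_cos t.
  have H2 := is_deriveX 2 (is_derive_id t (1 : R)).
  have H3 := is_deriveZ (2^-1 : R) H2.
  have H4 := is_deriveB (is_derive_cst (1 : R) t (1 : R)) H3.
  have H5 := is_deriveB H1 H4.
  rewrite (_ : (fun t => _) = cos - (cst 1 - 2^-1 \*: (fun t => t ^+ 2))).
    by apply: is_derive_eq; rewrite /GRing.scale /=; field.
  by apply/funext => s /=; congr (_ - (_ - _)); exact: mulrC.
have [c [E c1 c2]] := mvt_segment 0 u H.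
move: E; rewrite cos0 expr0n /= mul0r !subr0 subrr subr0 => ->.
rewrite normrM exprSr ler_wpM2r // addrC.
apply: le_trans (sin_sub_le c) _.
rewrite -[leLHS]real_normK ?num_real // ler_pXn2r ?nnegrE //.
move: c1 c2; rewrite minEle maxEle ler_norml.
case: (leP 0 u) => u0 c1 c2.
  by rewrite (ger0_norm u0); apply/andP; split; lra.
by rewrite (ltr0_norm u0); apply/andP; split; lra.
Qed.

Lemma expR_linear (v : R) : 0 <= v -> `|expR (- v) - (1 - v)| <= v ^+ 2.
Proof.
move=> v0; have h1 := expR_ge1Dx (- v).
rewrite ger0_norm; last by lra.
rewrite expRN; have h2 := expR_ge1Dx v.
have h3 : (expR v)^-1 <= (1 + v)^-1 by rewrite lef_pV2 ?posrE ?expR_gt0 //; lra.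
have h4 : (1 + v)^-1 <= 1 - v + v ^+ 2.
  have p : 0 < 1 + v by lra.
  rewrite -[leLHS]mul1r ler_pdivrMr //.
  have := mulr_ge0 (mulr_ge0 v0 v0) v0; rewrite !expr2; lra.
lra.
Qed.

Lemma exprn_diff_le (a b : R) n : `|a| <= 1 -> `|b| <= 1 ->
  `|a ^+ n - b ^+ n| <= n%:R * `|a - b|.
Proof.
move=> a1 b1; elim: n => [|n IH]; first by rewrite !expr0 subrr normr0 mul0r.
rewrite !exprS (_ : _ - _ = a * (a ^+ n - b ^+ n) + (a - b) * b ^+ n); last by ring.
apply: le_trans (ler_normD _ _) _; rewrite -natr1 [leRHS]mulrDl mul1r; apply: lerD.
  by rewrite normrM; apply: le_trans IH; rewrite ler_piMl.
by rewrite normrM ler_piMr // normrX exprn_ile1.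
Qed.

Lemma cvg_walk_scale : (fun n => @walk_scale R n) @ \oo --> (0 : R).
Proof. by have := cvgn_sqrt (@cvg_harmonic R); rewrite sqrtr0. Qed.

(** With [h ^+ 2 = 1 / (n + 1)], each factor differs from the Gaussian one by a multiple of
    [h ^+ 3], and n + 1 factors of modulus at most 1 leave an error [C * h]. *)
Lemma cvg_cos_pow (x : R) :
  (fun n => cos (@walk_scale R n * x) ^+ n.+1) @ \oo --> expR (- (x ^+ 2 / 2)).
Proof.
pose C := `|x| ^+ 3 + x ^+ 4 / 4.
have K : (fun n => C * @walk_scale R n) @ \oo --> (0 : R).
  by have := cvgnM (cvgnC C) cvg_walk_scale; rewrite mulr0.
apply/cvgrPdist_le => e e0; move/cvgrPdist_le : K => /(_ e e0) [N _ HN].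
exists N => // n Nn; apply: le_trans (HN n Nn); rewrite sub0r normrN.
apply: le_trans (ler_norm _).
set h := walk_scale n; set u := h * x.
have h0 : 0 <= h := walk_scale_ge0 n.
have h2 : h ^+ 2 = n.+1%:R^-1 := walk_scale_sqr n.
have nh : n.+1%:R * h ^+ 2 = 1 by rewrite h2 divff // pnatr_eq0.
have h1 : h <= 1.
  rewrite -(@ler_pXn2r _ 2) ?nnegrE // expr1n h2 invf_le1 ?ltr0n // ler1n //.
have -> : expR (- (x ^+ 2 / 2)) = expR (- (u ^+ 2 / 2)) ^+ n.+1.
  rewrite -expRM_natl; congr expR.
  rewrite /u exprMn (_ : _ * - _ = - (n.+1%:R * h ^+ 2 * x ^+ 2 / 2)); last by ring.
  by rewrite nh mul1r.
rewrite distrC; apply: le_trans (exprn_diff_le _ _ _) _.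
- exact: cos_max.
- rewrite ger0_norm ?expR_ge0 // -expR0 ler_expR oppr_le0 divr_ge0 ?sqr_ge0 //.
have u2 : 0 <= u ^+ 2 / 2 by rewrite divr_ge0 ?sqr_ge0.
have := expR_linear u2; have := cos_quadratic u => b1 b2.
have b3 : `|cos u - expR (- (u ^+ 2 / 2))| <= `|u| ^+ 3 + (u ^+ 2 / 2) ^+ 2.
  rewrite (_ : _ - _ = (cos u - (1 - u ^+ 2 / 2)) - (expR (- (u ^+ 2 / 2)) - (1 - u ^+ 2 / 2))); last by ring.
  by apply: le_trans (ler_normB _ _) _; exact: lerD.
apply: (@le_trans _ _ (n.+1%:R * (`|u| ^+ 3 + (u ^+ 2 / 2) ^+ 2))).
  by rewrite ler_wpM2l.
rewrite /u normrM (ger0_norm h0).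
rewrite (_ : n.+1%:R * _ = (n.+1%:R * h ^+ 2) * (h * `|x| ^+ 3 + h ^+ 2 * (x ^+ 4 / 4))); last by field.
rewrite nh mul1r /C mulrDl lerD //; first by rewrite mulrC.
rewrite mulrC ler_wpM2l // ?divr_ge0 ?exprn_even_ge0 //.
by rewrite expr2 ler_piMl.
Qed.

End cosine_powers.

Lemma L2_lip1 (R : realType) d (dT : measure_display) (T : measurableType dT)
    (Q : probability T R) (Z : 'I_d -> T -> R) (g : 'rV[R]_d -> R) :
  (forall i, L2 Q (Z i)) -> lip1 g -> L2 Q (fun w => g (\row_i Z i w)).
Proof.
move=> LZ lg; have mg : measurable_fun setT (fun w => g (\row_i Z i w)).
  by apply: measurable_lip1 => // i; exact: (LZ i).1.
apply: (L2_le mg _ (L2D (L2cst Q `|g 0|) (L2_sum (index_enum _) (fun i (_ : true) => L2_norm (LZ i))))) => w.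
rewrite [leRHS]ger0_norm; last by rewrite addr_ge0 // sumr_ge0.
rewrite -lerBlDl; apply: le_trans (lerB_dist _ _) _.
apply: le_trans (lip1_sub _ _ lg) _; rewrite subr0 /norm1.
by apply: ler_sum => i _; rewrite mxE.
Qed.

(** * Convergence of the scaled random walk to the Gaussian vector *)

Section gaussian_limit.
Context {R : realType} (d : nat).
Context {dT : measure_display} {T : measurableType dT} (Q : probability T R).
Variables (N : 'I_d -> {RV Q >-> R}) (Sigma : 'M[R]_d) (vs : seq 'rV[R]_d).
Hypothesis hgauss : gaussian_vector Q (fun i => N i).
Hypothesis hNmean : forall i, ('E_Q[N i] = 0)%E.
Hypothesis hNcov : forall i j, covariance Q (N i) (N j) = (Sigma i j)%:E.
Hypothesis Hvs : forall i j, Sigma i j = \sum_(v <- vs) v 0 i * v 0 j.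

Lemma covariance_integral i j :
  (\int[Q]_w (N i w * N j w)%:E = (Sigma i j)%:E)%E.
Proof.
rewrite -hNcov covariance.unlock expectation.unlock.
have E0 k : (\int[Q]_w (N k w)%:E = 0)%E by have := hNmean k; rewrite expectation.unlock.
rewrite !E0; apply: eq_integral => w _ /=; congr EFin.
by rewrite -[in LHS](subr0 (N i w)) -[in LHS](subr0 (N j w)).
Qed.

Lemma measurable_N i : measurable_fun setT (N i).
Proof. exact: measurable_funP. Qed.

Lemma L2_N i : L2 Q (N i).
Proof.
split; first exact: measurable_N.
apply: ge0_itg => [|w|]; [exact/measurable_funX/measurable_N|exact: sqr_ge0|].
under eq_integral do rewrite expr2.
by rewrite covariance_integral ltry.
Qed.

Lemma mean_N i : mean Q (N i) = 0.
Proof. by have := hNmean i; rewrite unlock /mean /Rintegral => ->. Qed.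

Lemma mean_N2 i j : mean Q (fun w => N i w * N j w) = Sigma i j.
Proof. by rewrite /mean /Rintegral covariance_integral. Qed.

Lemma n2_dot_N a : n2 Q (fun w => dot a (\row_i N i w)) = \sum_(v <- vs) dot a v ^+ 2.
Proof.
transitivity (mean Q (fun w => \sum_i \sum_j (a 0 i * a 0 j) * (N i w * N j w))).
  apply: eq_mean => w; rewrite expr2 /dot mulr_suml; apply: eq_bigr => i _.
  rewrite mulr_sumr; apply: eq_bigr => j _; rewrite !mxE; ring.
have iN i j : itg Q (fun w => (a 0 i * a 0 j) * (N i w * N j w)).
  by apply: itgZ; apply: L2M; exact: L2_N.
rewrite mean_sum => [|i _]; last by apply: itg_sum => j _; exact: iN.
rewrite (eq_bigr (fun i => \sum_j \sum_(v <- vs) (a 0 i * v 0 i) * (a 0 j * v 0 j))); last first.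
  move=> i _; rewrite mean_sum => [|j _]; last exact: iN.
  apply: eq_bigr => j _; rewrite meanZ; last by apply: L2M; exact: L2_N.
  by rewrite mean_N2 Hvs mulr_sumr; apply: eq_bigr => v _; ring.
under eq_bigr do rewrite exchange_big /=.
rewrite exchange_big /=; apply: eq_bigr => v _.
rewrite expr2 /dot mulr_suml; apply: eq_bigr => i _.
by rewrite mulr_sumr.
Qed.

(** Only the law of the linear combination [dot a N] is involved, which is exactly what
    [gaussian_vector] provides. *)
Lemma mean_cos_N a b : mean Q (fun w => cos (dot a (\row_i N i w) + b)) =
  \prod_(v <- vs) expR (- (dot a v ^+ 2 / 2)) * cos b.
Proof.
have [m [s law]] := hgauss (fun i => a 0 i).
pose Y w := dot a (\row_i N i w).
have YE w : Y w = \sum_i a 0 i * N i w.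
  by apply: eq_bigr => i _; rewrite mxE.
have LY : L2 Q Y.
  by apply: (eq_L2 (fun w => esym (YE w))); apply: L2_sum => i _; apply/L2Z/L2_N.
have Y0 : mean Q Y = 0.
  rewrite (eq_mean Q YE) mean_sum => [|i _]; last exact/itgZ/L2_itg/L2_N.
  by rewrite big1 // => i _; rewrite meanZ ?mean_N ?mulr0 //; exact/L2_itg/L2_N.
have lawY A : measurable A -> Q (Y @^-1` A) = normal_law m s A.
  by move=> mA; rewrite -(law A mA); congr (Q _); apply/seteqP; split => w /=; rewrite YE.
have := gaussian_cos LY.1 lawY LY Y0 b; rewrite /Y n2_dot_N => ->.
rewrite mulrC; congr (_ * _); rewrite mulr_suml -sumrN.
elim: vs => [|v r IH]; first by rewrite !big_nil expR0.
by rewrite !big_cons expRD IH.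
Qed.

Lemma cvgn_prod (I : Type) (r : seq I) (u : I -> nat -> R) (a : I -> R) :
  (forall i, u i @ \oo --> a i) ->
  (fun n => \prod_(i <- r) u i n) @ \oo --> \prod_(i <- r) a i.
Proof.
move=> ua; elim: r => [|i r IH].
  by rewrite big_nil; apply: eq_cvgn (cvgnC 1) => n; rewrite big_nil.
rewrite big_cons; apply: eq_cvgn (cvgnM (ua i) IH) => n.
by rewrite big_cons.
Qed.

Lemma measurable_comp_N h : trig h -> measurable_fun setT (fun w => h (\row_i N i w)).
Proof. by move=> th; apply: measurable_trig => // i; exact: measurable_N. Qed.

Lemma trig_bounded (h : 'rV[R]_d -> R) : trig h -> exists C, forall x, `|h x| <= C.
Proof.
elim=> {h} [a b|f g _ [C HC] _ [D HD]|c f _ [C HC]].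
- by exists 1 => x; exact: cos_max.
- by exists (C + D) => x; apply: le_trans (ler_normD _ _) _; exact: lerD.
- by exists (`|c| * C) => x; rewrite normrM ler_wpM2l.
Qed.

Lemma itg_trig h : trig h -> itg Q (fun w => h (\row_i N i w)).
Proof.
move=> th; have [C HC] := trig_bounded th.
by apply: itg_le (measurable_comp_N th) _ (itg_cst Q C) => w.
Qed.

Lemma cvg_avg_trig h : trig h ->
  (fun n => avg (walk vs n) h) @ \oo --> mean Q (fun w => h (\row_i N i w)).
Proof.
move=> th; elim: th => {h} [a b|f g tf IHf tg IHg|c f tf IHf].
- rewrite mean_cos_N.
  have K := @cvgn_prod _ vs _ _ (fun v => @cvg_cos_pow R (dot a v)).
  apply: eq_cvgn (cvgnM K (cvgnC (cos b))) => n.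
  by rewrite avg_cos prod_walk; congr (_ * _); apply: eq_bigr => v _; rewrite dotZr.
- rewrite meanD; [|exact: itg_trig|exact: itg_trig].
  by apply: eq_cvgn (cvgnD IHf IHg) => n; rewrite avgD.
- rewrite meanZ; last exact: itg_trig.
  by apply: eq_cvgn (cvgnM (cvgnC c) IHf) => n; rewrite avgZ.
Qed.

(** The walk has the covariance of [N] for every n, so one trigonometric approximation costs
    [delta * V = e / 3] on both sides uniformly in n; the remaining third is the convergence for
    cosines. *)
Lemma cvg_avg_lip1 g : lip1 g ->
  (fun n => avg (walk vs n) g) @ \oo --> mean Q (fun w => g (\row_i N i w)).
Proof.
move=> lg; apply/cvgrPdist_le => e e0.
pose V := 1 + \sum_i Sigma i i.
have Sii i : 0 <= Sigma i i by rewrite Hvs sumr_ge0 // => v _; rewrite -expr2 sqr_ge0.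
have V0 : 0 < V by rewrite ltr_pwDl // sumr_ge0.
pose delta := e / (3 * V).
have d0 : 0 < delta by rewrite divr_gt0 // mulr_gt0.
have [h th Hh] := trig_approx lg d0.
have dV : delta * V = e / 3 by rewrite /delta; field; rewrite gt_eqF.
have e3 : 0 < e / 3 by rewrite divr_gt0.
move/cvgrPdist_le : (cvg_avg_trig th) => /(_ _ e3) [n0 _ Hn].
exists n0 => // n nn.
have {Hn nn} E1 := Hn n nn.
have E2 : `|mean Q (fun w => g (\row_i N i w)) - mean Q (fun w => h (\row_i N i w))| <= e / 3.
  have ig := L2_itg (L2_lip1 L2_N lg); have ih := itg_trig th.
  rewrite -meanB //; apply: le_trans (ler_norm_mean (itgB ig ih)) _.
  have iq : itg Q (fun w => \sum_i N i w ^+ 2).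
    by apply: itg_sum => i _; exact: (L2_N i).2.
  have iq1 : itg Q (fun w => 1 + \sum_i N i w ^+ 2) by apply: itgD => //; exact: itg_cst.
  apply: le_trans (_ : mean Q (fun w => delta * (1 + \sum_i N i w ^+ 2)) <= _).
    apply: le_mean => [||w]; [exact/itg_norm/itgB|exact: itgZ|].
    apply: le_trans (Hh _) _; rewrite ler_wpM2l ?(ltW d0) // lerD2l.
    by apply: ler_sum => i _; rewrite mxE.
  rewrite meanZ // meanD //; last exact: itg_cst.
  rewrite mean_cst mean_sum => [|i _]; last exact: (L2_N i).2.
  rewrite (eq_bigr (fun i => Sigma i i)) ?dV // => i _.
  by rewrite -mean_N2; apply: eq_mean => w; rewrite expr2.
have E3 : `|avg (walk vs n) h - avg (walk vs n) g| <= e / 3.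
  rewrite -avgB; apply: le_trans (avg_norm _ _) _.
  apply: le_trans (_ : avg (walk vs n) (fun y => delta * (1 + \sum_i y 0 i ^+ 2)) <= _).
    by apply: avg_le => y; rewrite distrC; exact: Hh.
  rewrite avgZ avgD avg_cst avg_sum.
  rewrite (eq_bigr (fun i => Sigma i i)) ?dV // => i _.
  rewrite avg_coord_sqr Hvs -(sum_walk_mul vs n i i).
  by apply: eq_bigr => u _; rewrite expr2.
set A := mean Q _; set B := avg _ g.
rewrite (_ : A - B = (A - mean Q (fun w => h (\row_i N i w))) +
  (mean Q (fun w => h (\row_i N i w)) - avg (walk vs n) h) + (avg (walk vs n) h - B)); last by ring.
apply: le_trans (ler_normD _ _) _; apply: le_trans (lerD (ler_normD _ _) (lexx _)) _.
by move: E1 E2 E3; rewrite -/A -/B; lra.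
Qed.

End gaussian_limit.

(** * Pairings of gradients *)

Section lower_integral.
Context {dT : measure_display} {T : measurableType dT} {R : realType}.
Variable P : probability T R.

(* The integral of a nonnegative function is a supremum over the simple
   functions below it, so that [g] need not be measurable. *)
Lemma ae_le_integral_lower (f g : T -> \bar R) : measurable_fun setT f ->
  (forall w, 0 <= f w)%E -> (forall w, 0 <= g w)%E ->
  {ae P, forall w, (f w <= g w)%E} -> (\int[P]_w f w <= \int[P]_w g w)%E.
Proof.
move=> mf f0 g0 [A [mA PA HA]].
have AC w : w \in ~` A -> (f w <= g w)%E.
  by rewrite inE => Aw; apply: contrapT => H; apply: Aw; exact: HA.
rewrite (_ : (\int[P]_w f w)%E = \int[P]_w (f \_ (~` A)) w)%E; last first.
  apply: ae_eq_integral => //.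
    apply/(measurable_restrictT f (measurableC mA)); exact: measurable_funS mf.
  exists A; split=> // w /= H; apply: contrapT => Aw; apply: H => _.
  by rewrite patchE mem_set.
rewrite !ge0_integralTE //; last by move=> w; rewrite patchE; case: ifP.
apply: le_ereal_sup => _ [h /= Hh <-]; exists h => //= w.
apply: le_trans (Hh w) _; rewrite patchE; case: ifPn => // H.
exact: AC.
Qed.

End lower_integral.

Section pairing.
Context {dT : measure_display} {T : measurableType dT} {R : realType}.
Variable P : probability T R.
Variables (u v : nat -> T -> R) (C1 C2 : R).
Hypothesis (Lu : forall k, L2 P (u k)) (Lv : forall k, L2 P (v k)).
Hypothesis (u1 : forall K, \sum_(0 <= k < K) n2 P (u k) <= C1).
Hypothesis (v2 : forall K, \sum_(0 <= k < K) n2 P (v k) <= C2).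

(** Since [|u v| <= u^2 + v^2], the two energy bounds make the series absolutely convergent in L^1,
    with the sum of absolute values as dominating function. *)
Lemma l2inner_L1 : exists2 f, itg P f &
  {ae P, forall w, f w = l2inner (u ^~ w) (v ^~ w)} /\
  (fun K => mean P (fun w => `|f w - \sum_(0 <= k < K) u k w * v k w|)) @ \oo --> (0 : R).
Proof.
pose H w : \bar R := (\sum_(0 <= k <oo) (`|u k w * v k w|)%:E)%E.
have iuv k : itg P (fun w => u k w * v k w) by exact: L2M.
have mk k : measurable_fun setT (fun w => (`|u k w * v k w|)%:E).
  by apply/measurable_EFinP; apply: measurableT_comp => //; exact: itg_mf (iuv k).
have H0 w : (0 <= H w)%E by apply: nneseries_ge0 => k _ _; rewrite lee_fin.
have mH : measurable_fun setT H by apply: ge0_emeasurable_sum => // k w _ _; rewrite lee_fin.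
have iH : (\int[P]_w H w < +oo)%E.
  rewrite integral_nneseries //.
  apply: (@le_lt_trans _ _ ((C1 + C2)%:E)); last exact: ltry.
  apply: nneseries_le_bnd => [k|K]; first by apply: integral_ge0 => w _; rewrite lee_fin.
  under eq_bigr do rewrite mean_EFin ?itg_norm //.
  rewrite sumEFin lee_fin; apply: le_trans (lerD (u1 K) (v2 K)); rewrite -big_split /=.
  apply: ler_sum => k _; rewrite -meanD; [|exact: (Lu k).2|exact: (Lv k).2].
  apply: le_mean => [||w]; [exact: itg_norm|by apply: itgD; [exact: (Lu k).2|exact: (Lv k).2]|].
  by rewrite ler_norml; apply/andP; split; nra.
have integH : P.-integrable setT H.
  by apply/integrableP; split=> //; under eq_integral do rewrite gee0_abs //.
(* Off this set the series may diverge and [limn] carries no information. Cutting [f] by its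
   indicator makes it a pointwise limit of measurable functions. *)
pose B := [set w | (H w < +oo)%E].
have mB : measurable B by rewrite -[B]setTI; exact: emeasurable_fun_infty_o.
have aeB : {ae P, forall w, B w}.
  have := integrable_ae measurableT integH => -[N [mN PN HN]].
  exists N; split=> // w /= Bw; apply: HN => /= /(_ I); rewrite ge0_fin_numE //.
pose s K w := \sum_(0 <= k < K) u k w * v k w.
pose f w := \1_B w * l2inner (u ^~ w) (v ^~ w).
have cB w : B w -> s ^~ w @ \oo --> l2inner (u ^~ w) (v ^~ w).
  move=> Bw; apply: (@is_cvg_series_abs_bnd _ (fun k => u k w * v k w) (fine (H w))) => n.
  rewrite -lee_fin fineK ?ge0_fin_numE // -sumEFin.
  by apply: nneseries_lim_ge => k _ _; rewrite lee_fin.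
have ms K : measurable_fun setT (s K).
  by apply: measurable_sum => k; exact: itg_mf (iuv k).
have fB w : B w -> f w = l2inner (u ^~ w) (v ^~ w).
  by move=> Bw; rewrite /f indicE mem_set // mul1r.
have mf : measurable_fun setT f.
  apply: (@measurable_fun_cvg _ _ _ _ (fun K w => \1_B w * s K w)) => [K|w _].
    by apply: measurable_funM; [exact: measurable_indic|exact: ms].
  have [wB|wB] := pselect (B w).
    by rewrite fB //; apply: eq_cvgn (cB _ wB) => n; rewrite indicE mem_set // mul1r.
  rewrite /f indicE memNset // mul0r.
  by apply: eq_cvgn (cvgnC 0) => n; rewrite mul0r.
have sH w K : (`|(s K w)%:E| <= H w)%E.
  apply: (@le_trans _ _ (\sum_(0 <= k < K) (`|u k w * v k w|)%:E)%E).
    by rewrite sumEFin lee_fin ler_norm_sum.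
  by apply: nneseries_lim_ge => k _ _; rewrite lee_fin.
have cvgf : {ae P, forall w, setT w -> (fun K => (s K w)%:E) @ \oo --> (f w)%:E}.
  apply: filterS aeB => w Bw _; rewrite fB //.
  by apply: cvg_EFin (cB w Bw); exact: nearW.
have mEs K : measurable_fun setT (EFin \o s K) by exact/measurable_EFinP.
have mEf : measurable_fun setT (EFin \o f) by exact/measurable_EFinP.
have [itf cf _] := @dominated_convergence _ _ _ P setT measurableT
  (fun K => EFin \o s K) (EFin \o f) H mEs mEf cvgf integH (aeW _ (fun w K _ => sH w K)).
exists f => //; split; first exact: filterS aeB.
have isK K : itg P (s K) by apply: itg_sum.
apply: eq_cvgn (fine_cvg cf) => K /=.
rewrite /mean /Rintegral; congr fine; apply: eq_integral => w _.
by rewrite distrC.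
Qed.

End pairing.

Section sums_of_norms.
Context {dT : measure_display} {T : measurableType dT} {R : realType}.
Variable P : probability T R.

(** Cauchy-Schwarz against the constant 1 over the [d^2] pairs (i, j), whence the factor d. *)
Lemma sum_mean_norm_le d (x : 'I_d -> 'I_d -> T -> R) : (forall i j, L2 P (x i j)) ->
  \sum_i \sum_j mean P (fun w => `|x i j w|) <=
  d%:R * Num.sqrt (\sum_i \sum_j n2 P (x i j)).
Proof.
move=> Lx; rewrite !pair_big /=.
set B := \sum_p n2 P _.
have B0 : 0 <= B by apply: sumr_ge0 => p _; exact: n2_ge0.
rewrite -(@ler_pXn2r _ 2) // ?nnegrE; last first.
- by rewrite mulr_ge0 ?sqrtr_ge0.
- by apply: sumr_ge0 => p _; exact: mean_ge0.
rewrite exprMn sqr_sqrtr //.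
have := cauchy_schwarz_sum (P := P) (index_enum ('I_d * 'I_d)%type)
  (u := fun p w => `|x p.1 p.2 w|) (v := fun _ _ => 1) (fun p => L2_norm (Lx p.1 p.2)) (fun p => L2cst P 1).
rewrite /=; under eq_bigr do under eq_mean do rewrite mulr1.
move=> H; apply: le_trans H _.
rewrite [X in X * _ <= _](_ : _ = B); last first.
  by apply: eq_bigr => p _; apply: eq_mean => w; rewrite real_normK ?num_real.
rewrite mulrC ler_wpM2r // (eq_bigr (fun=> 1)); last first.
  by move=> p _; rewrite -[RHS](mean_cst P); apply: eq_mean => w; rewrite expr1n.
by rewrite sumr_const card_prod card_ord natrM expr2.
Qed.

End sums_of_norms.

Section increments.
Context {R : realType}.

(** Replaces differentiation along the path: cutting [0, 1] into m + 1 equal steps, the quadratic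
    errors add up to [C / (m + 1)]. *)
Lemma increment_bound (f phi : R -> R) (C : R) :
  (forall s t, 0 <= s -> s <= t -> t <= 1 ->
     `|f t - f s| <= phi t - phi s + C * (t - s) ^+ 2) ->
  `|f 1 - f 0| <= phi 1 - phi 0.
Proof.
move=> H.
have C0 : 0 <= C + `|phi 1 - phi 0|.
  have := H 0 1 (lexx _) ler01 (lexx _); rewrite subr0 expr1n mulr1.
  have := normr_ge0 (f 1 - f 0); have := ler_norm (phi 1 - phi 0); lra.
have step (m : nat) : `|f 1 - f 0| <= phi 1 - phi 0 + C / m.+1%:R.
  have m0 : (m.+1%:R : R) != 0 by rewrite pnatr_eq0.
  pose t (l : nat) : R := l%:R / m.+1%:R.
  have t0 : t 0%N = 0 by rewrite /t mul0r.
  have t1 : t m.+1 = 1 by rewrite /t divff.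
  have tel (g : R -> R) : g 1 - g 0 = \sum_(0 <= l < m.+1) (g (t l.+1) - g (t l)).
    by rewrite telescope_sumr // t0 t1.
  have -> : C / m.+1%:R = \sum_(0 <= l < m.+1) C * m.+1%:R^-1 ^+ 2.
    by rewrite big_const_nat subn0 iter_addr_0 -mulr_natr; field; rewrite addrC natr1.
  rewrite !tel; apply: le_trans (ler_norm_sum _ _ _) _.
  rewrite -big_split /= big_nat [leRHS]big_nat; apply: ler_sum => l /andP[_ lm].
  rewrite (_ : m.+1%:R^-1 = t l.+1 - t l); last by rewrite /t -natr1; field.
  apply: H; rewrite /t.
  - by rewrite divr_ge0.
  - by rewrite ler_wpM2r ?invr_ge0 // ler_nat.
  - by rewrite ler_pdivrMr ?ltr0n // mul1r ler_nat.
have K : (fun m => phi 1 - phi 0 + C * m.+1%:R^-1) @ \oo --> phi 1 - phi 0.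
  have := cvgnD (cvgnC (phi 1 - phi 0)) (cvgnM (cvgnC C) (@cvg_harmonic R)).
  by rewrite mulr0 addr0.
by apply: (ler_cvg_to (cvgnC _) K); exact: nearW.
Qed.

End increments.

Section Linv_gradient.
Context {R : realType} (P : probability Omega R) (hP : is_rademacher P).

Lemma Linv_grad_bound F f : chaos P F f ->
  exists C, forall K, \sum_(0 <= k < K) n2 P (grad k (fun w => - Linv P F w)) <= C.
Proof.
move=> cF; have LF := (chaos_cvL2 hP cF).2.1.
have LV : L2 P (fun w => - Linv P F w) by apply: L2N; exact: (Linv_cvL2 hP cF).1.
have LG : L2 P (fun w => F w - mean P F) by apply: L2B => //; exact: L2cst.
exists (6 + 4 * n2 P (fun w => F w - mean P F)) => K.
(* This precision depends on K so that the errors of the K gradients sum to at most 1, whatever K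
   is. *)
have e0 : 0 < (K.+1%:R : R)^-1 by rewrite invr_gt0.
have e1 : (K.+1%:R : R)^-1 <= 1 by rewrite invf_le1 ?ltr0n // ler1n.
have [r [c [wr _ h1 h2]]] := walsh_approx hP cF e0.
set e := _^-1 in e0 e1 h1 h2.
have Lp := L2_walsh P r c; have Lpt := L2_walsh P r (invsize c).
have Ld : L2 P (fun w => - Linv P F w - walsh r (invsize c) w) by exact: L2B.
apply: (@le_trans _ _ (\sum_(0 <= k < K) (2 * e + 2 * n2 P (grad k (walsh r (invsize c)))))).
  apply: ler_sum => k _.
  rewrite (eq_n2 P (g := fun w => grad k (fun w => - Linv P F w - walsh r (invsize c) w) w +
    grad k (walsh r (invsize c)) w)); last by move=> w; rewrite -gradD; rewrite /grad; ring.
  apply: le_trans (n2D_le (L2_grad hP k Ld) (L2_grad hP k Lpt)) _.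
  rewrite lerD2r ler_wpM2l //; apply: le_trans (n2_grad_le hP k Ld) _; exact: ltW.
rewrite big_split /= -!mulr_sumr big_const_nat subn0 iter_addr_0.
have h3 : e *+ K <= 1.
  by rewrite -mulr_natr /e mulrC ler_pdivrMr ?ltr0n // mul1r ler_nat.
have h4 := sum_n2_grad_invsize hP K c wr.
have h5 : n2 P (walsh r c) <= 2 * n2 P (fun w => F w - mean P F) + 2 * e.
  have := n2D_le LG (L2N (L2B LG Lp)); rewrite n2N.
  rewrite (eq_n2 P (f := fun w => _ + _) (g := walsh r c)); last by move=> w; ring.
  move: h1; lra.
lra.
Qed.

End Linv_gradient.

(** * Interpolation *)

Section sign_average_ibp.
Context {R : realType} (d : nat).

(* Discrete counterpart of [E (N_i phi_i N) = sum_j sigma_ij E (dphi_ij N)]. *)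
Lemma avg_stein us (phi : 'I_d -> 'rV[R]_d -> R) dphi (L : R) :
  (forall i y v, `|phi i (y + v) - phi i y - \sum_j v 0 j * dphi i j y| <= L * norm1 v ^+ 2) ->
  (forall i j y v, `|dphi i j (y + v) - dphi i j y| <= L * norm1 v) ->
  `|avg us (fun y => \sum_i y 0 i * phi i y) -
    \sum_i \sum_j (\sum_(u <- us) u 0 i * u 0 j) * avg us (dphi i j)| <=
  2 * L * \sum_(u <- us) norm1 u ^+ 3.
Proof.
elim: us phi dphi => [|u us IH] phi dphi H1 H2.
  rewrite avg_nil !big_nil mulr0 big1 => [|i _]; last by rewrite mxE mul0r.
  by rewrite big1 ?subrr ?normr0 // => i _; rewrite big1 // => j _; rewrite big_nil mul0r.
(* The sign of the first step is averaged out. The averaged functions satisfy the same two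
   hypotheses, so the induction applies to them. *)
pose psi i y := 2^-1 * (phi i (y + u) + phi i (y - u)).
pose dpsi i j y := 2^-1 * (dphi i j (y + u) + dphi i j (y - u)).
have K1 i y v : `|psi i (y + v) - psi i y - \sum_j v 0 j * dpsi i j y| <= L * norm1 v ^+ 2.
  have h1 := H1 i (y + u) v; have h2 := H1 i (y - u) v.
  rewrite (_ : _ - _ = 2^-1 * ((phi i (y + u + v) - phi i (y + u) - \sum_j v 0 j * dphi i j (y + u)) +
    (phi i (y - u + v) - phi i (y - u) - \sum_j v 0 j * dphi i j (y - u)))).
    rewrite normrM ger0_norm //; have := ler_normD (phi i (y + u + v) - phi i (y + u) -
      \sum_j v 0 j * dphi i j (y + u)) (phi i (y - u + v) - phi i (y - u) -
      \sum_j v 0 j * dphi i j (y - u)); lra.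
  rewrite (_ : \sum_j _ = 2^-1 * (\sum_j v 0 j * dphi i j (y + u) + \sum_j v 0 j * dphi i j (y - u))).
    by rewrite /psi (addrAC y v u) (addrAC y v (- u)); ring.
  by rewrite -big_split mulr_sumr; apply: eq_bigr => j _; rewrite /dpsi /=; ring.
have K2 i j y v : `|dpsi i j (y + v) - dpsi i j y| <= L * norm1 v.
  have h1 := H2 i j (y + u) v; have h2 := H2 i j (y - u) v.
  rewrite (_ : _ - _ = 2^-1 * ((dphi i j (y + u + v) - dphi i j (y + u)) +
    (dphi i j (y - u + v) - dphi i j (y - u)))).
    rewrite normrM ger0_norm //; have := ler_normD (dphi i j (y + u + v) - dphi i j (y + u))
      (dphi i j (y - u + v) - dphi i j (y - u)); lra.
  by rewrite /dpsi (addrAC y v u) (addrAC y v (- u)); ring.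
(* Contribution of the first step: a centred difference against its linearization. Two Taylor
   remainders, halved, give [L * norm1 u ^+ 2], and the averaging of the derivative costs as much
   again, whence the factor 2. *)
pose E y := \sum_i u 0 i * (2^-1 * (phi i (y + u) - phi i (y - u)) - \sum_j u 0 j * dpsi i j y).
have EE : avg (u :: us) (fun y => \sum_i y 0 i * phi i y) -
    \sum_i \sum_j (\sum_(u <- u :: us) u 0 i * u 0 j) * avg (u :: us) (dphi i j) =
  (avg us (fun y => \sum_i y 0 i * psi i y) -
    \sum_i \sum_j (\sum_(u <- us) u 0 i * u 0 j) * avg us (dpsi i j)) + avg us E.
  have e1 : avg (u :: us) (fun y => \sum_i y 0 i * phi i y) =
    avg us (fun y => \sum_i y 0 i * psi i y) +
    avg us (fun y => \sum_i u 0 i * (2^-1 * (phi i (y + u) - phi i (y - u)))).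
    rewrite avg_cons -avgD -avgZ -avgD; apply: eq_avg => y.
    rewrite -!big_split mulr_sumr; apply: eq_bigr => i _ /=; rewrite !mxE /psi; ring.
  have e2 i j : avg (u :: us) (dphi i j) = avg us (dpsi i j).
    by rewrite avg_cons -avgD -avgZ.
  have e3 : avg us E = avg us (fun y => \sum_i u 0 i * (2^-1 * (phi i (y + u) - phi i (y - u)))) -
      \sum_i \sum_j u 0 i * u 0 j * avg us (dpsi i j).
    rewrite /E (_ : \sum_i _ = avg us (fun y => \sum_i \sum_j u 0 i * u 0 j * dpsi i j y)).
      rewrite -avgB; apply: eq_avg => y; rewrite -sumrB; apply: eq_bigr => i _.
      by rewrite mulrBr mulr_sumr; congr (_ - _); apply: eq_bigr => j _; rewrite mulrA.
    rewrite avg_sum; apply: eq_bigr => i _; rewrite avg_sum; apply: eq_bigr => j _.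
    by rewrite avgZ.
  have e4 : \sum_i \sum_j (\sum_(u <- u :: us) u 0 i * u 0 j) * avg (u :: us) (dphi i j) =
      \sum_i \sum_j u 0 i * u 0 j * avg us (dpsi i j) +
      \sum_i \sum_j (\sum_(u <- us) u 0 i * u 0 j) * avg us (dpsi i j).
    rewrite -big_split; apply: eq_bigr => i _ /=; rewrite -big_split; apply: eq_bigr => j _ /=.
    by rewrite big_cons e2 mulrDl.
  by rewrite e1 e4 e3; ring.
rewrite EE big_cons mulrDr addrC; apply: le_trans (ler_normD _ _) _; apply: lerD; last exact: IH.
apply: le_trans (avg_norm _ _) _; rewrite -[leRHS](avg_cst us); apply: avg_le => y.
have nS x : norm1 u * x = \sum_j `|u 0 j| * x by rewrite mulr_suml.
rewrite exprS mulrCA nS; apply: le_trans (ler_norm_sum _ _ _) _.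
apply: ler_sum => i _; rewrite normrM ler_wpM2l //.
have h1 := H1 i y u; have h2 := H1 i y (- u).
have nN : norm1 (- u) = norm1 u by rewrite -scaleN1r norm1Z normrN normr1 mul1r.
have sN : \sum_j (- u) 0 j * dphi i j y = - \sum_j u 0 j * dphi i j y.
  by rewrite -sumrN; apply: eq_bigr => j _; rewrite mxE mulNr.
rewrite nN sN in h2.
have h3 : `|\sum_j u 0 j * (dphi i j y - dpsi i j y)| <= L * norm1 u ^+ 2.
  rewrite (_ : L * _ = norm1 u * (L * norm1 u)); last by ring.
  rewrite nS; apply: le_trans (ler_norm_sum _ _ _) _.
  apply: ler_sum => j _; rewrite normrM ler_wpM2l //.
  have k1 := H2 i j y u; have k2 := H2 i j y (- u); rewrite nN in k2.
  rewrite (_ : _ - _ = - (2^-1 * ((dphi i j (y + u) - dphi i j y) + (dphi i j (y - u) - dphi i j y)))).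
    rewrite normrN normrM ger0_norm //.
    have := ler_normD (dphi i j (y + u) - dphi i j y) (dphi i j (y - u) - dphi i j y); lra.
  by rewrite /dpsi; field.
have E3 : \sum_j u 0 j * (dphi i j y - dpsi i j y) =
    \sum_j u 0 j * dphi i j y - \sum_j u 0 j * dpsi i j y.
  by rewrite -sumrB; apply: eq_bigr => j _; rewrite mulrBr.
move: h1 h2 h3; rewrite E3 !ler_norml => /andP[? ?] /andP[? ?] /andP[? ?].
by apply/andP; split; lra.
Qed.

End sign_average_ibp.

(** * Gradients of functions of [a F + y] *)

Section smart_path.
Context {R : realType} (P : probability Omega R) (hP : is_rademacher P) (d : nat).
Variables (F : 'I_d -> Omega -> R) (a : R) (y : 'rV[R]_d).
Hypothesis LF : forall i, L2 P (F i).

Definition shifted w : 'rV[R]_d := a *: (\row_i F i w) + y.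

Definition grad_norm1 k w := \sum_j `|grad k (F j) w|.

Lemma shifted_flip k w : shifted (flip k w) =
  shifted w + (\row_j (- 2 * a * (X R k w * grad k (F j) w))).
Proof.
apply/rowP => j; rewrite /shifted !mxE /grad.
have := @X_sqr R k w => XX.
rewrite (_ : X R k w * _ = (X R k w * X R k w) * (2^-1 * (F j w - F j (flip k w)))); last by ring.
by rewrite XX; field.
Qed.

Lemma norm1_shift k w :
  norm1 (\row_j (- 2 * a * (X R k w * grad k (F j) w))) = 2 * `|a| * grad_norm1 k w.
Proof.
rewrite /norm1 /grad_norm1 mulr_sumr; apply: eq_bigr => j _.
by rewrite mxE !normrM normrN normX mul1r normr_nat mulrA.
Qed.

Lemma grad_lip1 g k w : lip1 g -> `|grad k (g \o shifted) w| <= `|a| * grad_norm1 k w.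
Proof.
move=> lg; rewrite /grad /= shifted_flip !normrM normX mul1r ger0_norm // distrC.
have := lg (shifted w) (\row_j (- 2 * a * (X R k w * grad k (F j) w))).
rewrite norm1_shift; lra.
Qed.

(** The displacement under a flip has l^1 norm [2 |a|] times [grad_norm1]. Its cube gives 8, and the
    two factors 1/2, of the rule and of [grad], leave 2. *)
Lemma grad_trapezoid g (g1 : 'I_d -> 'rV[R]_d -> R) (g2 : 'I_d -> 'I_d -> 'rV[R]_d -> R) k w :
  has_partials g g1 -> (forall i, has_partials (g1 i) (g2 i)) ->
  (forall i, lip1 (g1 i)) -> (forall i j, lip1 (g2 i j)) ->
  `|grad k (g \o shifted) w - 2^-1 * a * \sum_j grad k (F j) w *
      (g1 j (shifted w) + g1 j (shifted (flip k w)))| <=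
  2 * `|a| ^+ 3 * grad_norm1 k w ^+ 3.
Proof.
move=> hg hg1 l1 l2.
have := trapezoid hg hg1 l1 l2 (shifted w) (\row_j (- 2 * a * (X R k w * grad k (F j) w))).
rewrite norm1_shift -shifted_flip.
have XX := @X_sqr R k w.
set S := \sum_j _; set S' := \sum_j _ => H.
have SS : S = - 2 * a * X R k w * S'.
  by rewrite /S /S' mulr_sumr; apply: eq_bigr => j _; rewrite mxE; ring.
have -> : grad k (g \o shifted) w - 2^-1 * a * S' =
    - 2^-1 * X R k w * (g (shifted (flip k w)) - g (shifted w) - 2^-1 * S).
  rewrite SS /grad /=.
  transitivity (2^-1 * (X R k w * (g (shifted w) - g (shifted (flip k w)))) -
    2^-1 * (X R k w * X R k w) * a * S'); first by rewrite XX mulr1.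
  by field.
rewrite !normrM normX mulr1 normrN [`|2^-1|]ger0_norm //.
rewrite (_ : _ * grad_norm1 k w ^+ 3 = 2^-1 * (2^-1 * (2 * `|a| * grad_norm1 k w) ^+ 3)); last by field.
by rewrite ler_wpM2l.
Qed.

Lemma measurable_shifted g : lip1 g -> measurable_fun setT (g \o shifted).
Proof.
move=> lg; have := measurable_lip1 lg (Z := fun i w => a * F i w + y 0 i).
rewrite (_ : (fun w => g _) = g \o shifted); last first.
  by apply/funext => w /=; congr g; apply/rowP => j; rewrite /shifted !mxE.
by apply=> i; apply: measurable_funD => //; apply: measurable_funM => //; exact: (LF i).1.
Qed.

End smart_path.

Lemma sqr_sum_le (R : realType) d (x : 'I_d -> R) :
  (\sum_i x i) ^+ 2 <= d%:R * \sum_i x i ^+ 2.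
Proof.
rewrite mulrC; apply: discr_le => // [|t]; first by apply: sumr_ge0 => i _; exact: sqr_ge0.
rewrite (_ : _ + _ = \sum_i (x i + t) ^+ 2); first by apply: sumr_ge0 => i _; exact: sqr_ge0.
have -> : t ^+ 2 * d%:R = \sum_(i < d) t ^+ 2 by rewrite sumr_const card_ord mulr_natr.
rewrite mulr_sumr -!big_split /=.
by apply: eq_bigr => i _; ring.
Qed.

Section stein_bound.
Context {R : realType} (P : probability Omega R) (hP : is_rademacher P) (d : nat).
Variables (F V : 'I_d -> Omega -> R) (a : R) (y : 'rV[R]_d).
Hypothesis (LF : forall i, L2 P (F i)) (LV : forall i, L2 P (V i)).
Variables (f : 'I_d -> 'rV[R]_d -> R) (h : 'I_d -> 'I_d -> 'rV[R]_d -> R).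
Variable h3 : 'I_d -> 'I_d -> 'I_d -> 'rV[R]_d -> R.
Hypothesis (f_h : forall i, has_partials (f i) (h i)).
Hypothesis (h_h3 : forall i j, has_partials (h i j) (h3 i j)).
Hypothesis (f_lip : forall i, lip1 (f i)) (h_lip : forall i j, lip1 (h i j)).
Hypothesis (h3_lip : forall i j l, lip1 (h3 i j l)).
Hypothesis (f_bnd : forall i x, `|f i x| <= 1) (h_bnd : forall i j x, `|h i j x| <= 1).

Definition third_moment k w := grad_norm1 F k w ^+ 3 * grad_norm1 V k w.

Hypothesis iT : forall k, itg P (third_moment k).

Local Notation U := (shifted F a y).

Lemma mean_grad_bound k :
  `|\sum_i mean P (fun w => grad k (f i \o U) w * grad k (V i) w) -
    a * \sum_i \sum_j mean P (fun w => h i j (U w) * (grad k (F j) w * grad k (V i) w))| <=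
  2 * `|a| ^+ 3 * mean P (third_moment k).
Proof.
have Lg i : L2 P (grad k (F i)) by exact: L2_grad.
have Lv i : L2 P (grad k (V i)) by exact: L2_grad.
have mU g : lip1 g -> measurable_fun setT (g \o U) by move=> lg; exact: measurable_shifted.
have ifv i j : itg P (fun w => grad k (F j) w * grad k (V i) w) by exact: L2M.
have ih i j : itg P (fun w => h i j (U w) * (grad k (F j) w * grad k (V i) w)).
  by apply: (itg_bnd (C := 1)) => //; exact: (mU _ (h_lip i j)).
have ihf i j : itg P (fun w => h i j (U (flip k w)) * (grad k (F j) w * grad k (V i) w)).
  apply: (itg_bnd (C := 1)) => //.
  exact: measurable_fun_flip (mU _ (h_lip i j)).
have iG i : itg P (fun w => grad k (f i \o U) w * grad k (V i) w).
  apply: L2M => //; apply: L2_grad => //.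
  by apply: (L2_le (mU _ (f_lip i)) _ (L2cst P 1)) => w; rewrite normr1; exact: f_bnd.
(* The gradients are invariant under the flip, so it can be undone on the Hessian factor; the two
   endpoints of the rule thus merge into one mean. *)
have flipped i j : mean P (fun w => h i j (U (flip k w)) * (grad k (F j) w * grad k (V i) w)) =
    mean P (fun w => h i j (U w) * (grad k (F j) w * grad k (V i) w)).
  rewrite -[RHS](mean_flip hP k (itg_mf (ih i j))); apply: eq_mean => w /=.
  by rewrite !grad_flip.
pose r i w := grad k (f i \o U) w - 2^-1 * a * \sum_j grad k (F j) w *
      (h i j (U w) + h i j (U (flip k w))).
have rE i w : r i w * grad k (V i) w = grad k (f i \o U) w * grad k (V i) w -
  2^-1 * a * \sum_j (h i j (U w) * (grad k (F j) w * grad k (V i) w) +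
                     h i j (U (flip k w)) * (grad k (F j) w * grad k (V i) w)).
  rewrite /r mulrBl; congr (_ - _); rewrite -[LHS]mulrA; congr (_ * _).
  by rewrite mulr_suml; apply: eq_bigr => j _; ring.
have is2 i : itg P (fun w => \sum_j (h i j (U w) * (grad k (F j) w * grad k (V i) w) +
                     h i j (U (flip k w)) * (grad k (F j) w * grad k (V i) w))).
  by apply: itg_sum => j _; exact: itgD.
have ir i : itg P (fun w => r i w * grad k (V i) w).
  by apply: eq_itg (itgB (iG i) (itgZ (2^-1 * a) (is2 i))) => w; rewrite rE.
have -> : \sum_i mean P (fun w => grad k (f i \o U) w * grad k (V i) w) -
    a * \sum_i \sum_j mean P (fun w => h i j (U w) * (grad k (F j) w * grad k (V i) w)) =
    mean P (fun w => \sum_i r i w * grad k (V i) w).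
  rewrite mean_sum; last by move=> i _; exact: ir.
  rewrite mulr_sumr -sumrB; apply: eq_bigr => i _.
  rewrite (eq_mean P (rE i)) meanB //; last exact: itgZ.
  rewrite meanZ // mean_sum; last by move=> j _; exact: itgD.
  congr (_ - _); rewrite -mulrA mulrCA; congr (_ * _); rewrite mulr_sumr.
  apply: eq_bigr => j _; rewrite meanD // flipped; by field.
have isr : itg P (fun w => \sum_i r i w * grad k (V i) w) by apply: itg_sum => i _; exact: ir.
apply: le_trans (ler_norm_mean isr) _; rewrite -meanZ //.
apply: le_mean => [||w]; [exact: itg_norm|exact: itgZ|].
apply: le_trans (ler_norm_sum _ _ _) _; rewrite /third_moment mulrA mulr_sumr.
apply: ler_sum => i _; rewrite normrM ler_wpM2r //.
exact: grad_trapezoid (f_h i) (h_h3 i) (h_lip i) (h3_lip i).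
Qed.

Variables (T A : R) (sigma : 'I_d -> 'I_d -> R).
Hypothesis HT : forall K, \sum_(0 <= k < K) mean P (third_moment k) <= T.
Hypothesis HA : (fun K => \sum_i \sum_j mean P (fun w =>
  `|sigma i j - \sum_(0 <= k < K) grad k (F j) w * grad k (V i) w|)) @ \oo --> A.
Hypothesis HF : forall i, exists C, forall K, \sum_(0 <= k < K) n2 P (grad k (F i)) <= C.
Hypothesis Fibp : forall i G C, L2 P G ->
  (forall K, \sum_(0 <= k < K) n2 P (grad k G) <= C) ->
  (fun K => \sum_(0 <= k < K) mean P (fun w => grad k G w * grad k (V i) w)) @ \oo -->
  mean P (fun w => F i w * G w).

(** The energy bound that [Fibp] demands of its test function, inherited from the [F j] by the
    Lipschitz property. *)
Lemma grad_shifted_bound g : lip1 g -> L2 P (g \o U) ->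
  exists C, forall K, \sum_(0 <= k < K) n2 P (grad k (g \o U)) <= C.
Proof.
move=> lg Lg; have [C HC] := choice HF.
exists (a ^+ 2 * d%:R * \sum_j C j) => K.
apply: (@le_trans _ _ (\sum_(0 <= k < K) a ^+ 2 * d%:R * \sum_j n2 P (grad k (F j)))); last first.
  rewrite -mulr_sumr exchange_big /=; apply: ler_wpM2l; first by apply: mulr_ge0; [exact: sqr_ge0|].
  by apply: ler_sum => j _; exact: HC.
apply: ler_sum => k _.
have Lj j : L2 P (grad k (F j)) by exact: L2_grad.
have i2 : itg P (fun w => \sum_j grad k (F j) w ^+ 2) by apply: itg_sum => j _; exact: (Lj j).2.
rewrite -mean_sum => [|j _]; last exact: (Lj j).2.
rewrite -meanZ //; apply: le_mean => [||w]; [exact: (L2_grad hP k Lg).2|exact: itgZ|].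
have := grad_lip1 F a y k w lg; rewrite -(ler_pXn2r (isT : (0 < 2)%N)) ?nnegrE; last first.
- by rewrite mulr_ge0 // sumr_ge0.
- exact: normr_ge0.
rewrite [(`|a| * _) ^+ 2]exprMn !real_normK ?num_real // => H.
apply: le_trans H _; rewrite -mulrA ler_wpM2l ?sqr_ge0 //.
apply: le_trans (sqr_sum_le _) _; rewrite ler_wpM2l //; apply: ler_sum => j _.
by rewrite real_normK ?num_real.
Qed.

(** All identities are between sums truncated at K. Only the two sides of the final inequality pass
    to the limit, which is why [A] enters as a limit of truncated L^1 errors. *)
Lemma mean_stein_bound :
  `|\sum_i mean P (fun w => F i w * f i (U w)) -
    a * \sum_i \sum_j sigma i j * mean P (fun w => h i j (U w))| <=
  `|a| * A + 2 * `|a| ^+ 3 * T.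
Proof.
have mU g : lip1 g -> measurable_fun setT (g \o U) by move=> lg; exact: measurable_shifted.
have LG i : L2 P (f i \o U).
  by apply: (L2_le (mU _ (f_lip i)) _ (L2cst P 1)) => w; rewrite normr1; exact: f_bnd.
pose I K := \sum_i \sum_(0 <= k < K) mean P (fun w => grad k (f i \o U) w * grad k (V i) w).
have cI : I @ \oo --> \sum_i mean P (fun w => F i w * f i (U w)).
  apply: cvgn_sum => i; have [C HC] := grad_shifted_bound (f_lip i) (LG i).
  exact: Fibp (LG i) HC.
set W := a * _.
have cL : (fun K => `|I K - W|) @ \oo -->
    `|\sum_i mean P (fun w => F i w * f i (U w)) - W|.
  by apply: cvg_norm; apply: cvgnB cI (cvgnC W).
have cR := cvgnD (cvgnM (cvgnC `|a|) HA) (cvgnC (2 * `|a| ^+ 3 * T)).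
apply: (ler_cvg_to cL cR); apply: nearW => K.
have ifv k i j : itg P (fun w => grad k (F j) w * grad k (V i) w).
  by apply: L2M; exact: L2_grad.
have isum i j : itg P (fun w => \sum_(0 <= k < K) grad k (F j) w * grad k (V i) w).
  by apply: itg_sum.
have mh i j := mU _ (h_lip i j).
have ih i j : itg P (fun w => h i j (U w)).
  by apply: (itg_le (mh i j) _ (itg_cst P 1)) => w; exact: h_bnd.
have isg i j : itg P (fun w => sigma i j - \sum_(0 <= k < K) grad k (F j) w * grad k (V i) w).
  by apply: itgB => //; exact: itg_cst.
have ihb i j x : itg P x -> itg P (fun w => h i j (U w) * x w).
  exact: (itg_bnd (mh i j) (fun w => h_bnd i j (U w))).
pose M := \sum_i \sum_j mean P (fun w => h i j (U w) *
  (sigma i j - \sum_(0 <= k < K) grad k (F j) w * grad k (V i) w)).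
have dec : I K - W = \sum_(0 <= k < K)
   (\sum_i mean P (fun w => grad k (f i \o U) w * grad k (V i) w) -
    a * \sum_i \sum_j mean P (fun w => h i j (U w) * (grad k (F j) w * grad k (V i) w))) - a * M.
  rewrite sumrB /I exchange_big /= -addrA; congr (_ + _).
  rewrite -mulr_sumr -opprD -mulrDr /W; congr (- (a * _)).
  rewrite [X in _ = X + _]exchange_big /= /M -big_split; apply: eq_bigr => i _ /=.
  rewrite [X in _ = X + _]exchange_big /= -big_split; apply: eq_bigr => j _ /=.
  rewrite -mean_sum => [|k _]; last first.
    exact: ihb (ifv k i j).
  rewrite -meanD; last first.
  - exact: ihb (isg i j).
  - by apply: itg_sum => k _; exact: ihb (ifv k i j).
  by rewrite -meanZ //; apply: eq_mean => w; rewrite -mulr_sumr -mulrDr addrC subrK mulrC.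
rewrite dec [leRHS]addrC; apply: le_trans (ler_normB _ _) _; apply: lerD.
  apply: le_trans (ler_norm_sum _ _ _) _.
  apply: le_trans (ler_sum _ (fun k _ => mean_grad_bound k)) _.
  by rewrite -mulr_sumr ler_wpM2l // mulr_ge0 // exprn_ge0.
rewrite normrM ler_wpM2l //; apply: le_trans (ler_norm_sum _ _ _) _.
apply: ler_sum => i _; apply: le_trans (ler_norm_sum _ _ _) _; apply: ler_sum => j _.
have ihs : itg P (fun w => h i j (U w) *
    (sigma i j - \sum_(0 <= k < K) grad k (F j) w * grad k (V i) w)).
  exact: ihb (isg i j).
apply: le_trans (ler_norm_mean ihs) _.
apply: le_mean => [||w]; [exact: itg_norm|exact: itg_norm|].
by rewrite normrM ler_piMl.
Qed.

End stein_bound.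

Section circle_path.
Context {R : realType}.

(** Rational parametrization of the quarter circle from (0, 1) to (1, 0): every fact about it is an
    identity of fractions or a polynomial inequality. *)
Definition circle_a (t : R) : R := 2 * t / (1 + t ^+ 2).
Definition circle_b (t : R) : R := (1 - t ^+ 2) / (1 + t ^+ 2).

Lemma circle_denom (t : R) : 0 < 1 + t ^+ 2.
Proof. by rewrite ltr_pwDl // sqr_ge0. Qed.

Lemma circle_norm t : circle_a t ^+ 2 + circle_b t ^+ 2 = 1.
Proof. by rewrite /circle_a /circle_b; field; rewrite gt_eqF // circle_denom. Qed.

Lemma circle_dist s t :
  (circle_a t - circle_a s) ^+ 2 + (circle_b t - circle_b s) ^+ 2 <= 4 * (t - s) ^+ 2.
Proof.
have ds := circle_denom s; have dt := circle_denom t.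
rewrite (_ : _ + _ = 4 * (t - s) ^+ 2 / ((1 + s ^+ 2) * (1 + t ^+ 2))); last first.
  by rewrite /circle_a /circle_b; field; rewrite !gt_eqF.
rewrite ler_pdivrMr ?mulr_gt0 // ler_peMr //; first by rewrite mulr_ge0 ?sqr_ge0.
by have := sqr_ge0 s; have := sqr_ge0 t; nra.
Qed.

Lemma circle_a_mono s t : 0 <= s -> s <= t -> t <= 1 -> circle_a s <= circle_a t.
Proof.
move=> s0 st t1; have ds := circle_denom s; have dt := circle_denom t.
rewrite -subr_ge0 (_ : _ - _ = 2 * ((t - s) * (1 - s * t)) / ((1 + s ^+ 2) * (1 + t ^+ 2))); last first.
  by rewrite /circle_a; field; rewrite !gt_eqF.
by rewrite divr_ge0 ?mulr_ge0 ?(ltW ds) ?(ltW dt) //; nra.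
Qed.

Lemma circle_b_mono s t : 0 <= s -> s <= t -> circle_b t <= circle_b s.
Proof.
move=> s0 st; have ds := circle_denom s; have dt := circle_denom t.
rewrite -subr_ge0 (_ : _ - _ = 2 * ((t - s) * (t + s)) / ((1 + s ^+ 2) * (1 + t ^+ 2))); last first.
  by rewrite /circle_b; field; rewrite !gt_eqF.
by rewrite divr_ge0 ?mulr_ge0 ?(ltW ds) ?(ltW dt) //; nra.
Qed.

Lemma circle_a_ge0 t : 0 <= t -> 0 <= circle_a t.
Proof. by move=> t0; rewrite divr_ge0 ?mulr_ge0 // ltW // circle_denom. Qed.

Lemma circle_b_bnd t : 0 <= t -> t <= 1 -> 0 <= circle_b t <= 1.
Proof.
move=> t0 t1; have dt := circle_denom t; apply/andP; split.
  by rewrite divr_ge0 ?(ltW dt) //; nra.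
by rewrite ler_pdivrMr // mul1r; nra.
Qed.

End circle_path.

Section path.
Context {R : realType} (P : probability Omega R) (hP : is_rademacher P) (d : nat).
Variables (F V : 'I_d -> Omega -> R).
Hypothesis (LF : forall i, L2 P (F i)) (LV : forall i, L2 P (V i)).
Variables (g : 'rV[R]_d -> R) (f : 'I_d -> 'rV[R]_d -> R) (h : 'I_d -> 'I_d -> 'rV[R]_d -> R).
Variable h3 : 'I_d -> 'I_d -> 'I_d -> 'rV[R]_d -> R.
Hypothesis (g_f : has_partials g f) (f_h : forall i, has_partials (f i) (h i)).
Hypothesis (h_h3 : forall i j, has_partials (h i j) (h3 i j)).
Hypothesis (g_lip : lip1 g) (f_lip : forall i, lip1 (f i)) (h_lip : forall i j, lip1 (h i j)).
Hypothesis (h3_lip : forall i j l, lip1 (h3 i j l)).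
Hypothesis (f_bnd : forall i x, `|f i x| <= 1) (h_bnd : forall i j x, `|h i j x| <= 1).
Variables (us : seq 'rV[R]_d) (T A : R).
Local Notation sigma i j := (\sum_(u <- us) u 0 i * u 0 j).
Hypothesis iT : forall k, itg P (third_moment F V k).
Hypothesis HT : forall K, \sum_(0 <= k < K) mean P (third_moment F V k) <= T.
Hypothesis HA : (fun K => \sum_i \sum_j mean P (fun w =>
  `|sigma i j - \sum_(0 <= k < K) grad k (F j) w * grad k (V i) w|)) @ \oo --> A.
Hypothesis HF : forall i, exists C, forall K, \sum_(0 <= k < K) n2 P (grad k (F i)) <= C.
Hypothesis Fibp : forall i G C, L2 P G ->
  (forall K, \sum_(0 <= k < K) n2 P (grad k G) <= C) ->
  (fun K => \sum_(0 <= k < K) mean P (fun w => grad k G w * grad k (V i) w)) @ \oo -->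
  mean P (fun w => F i w * G w).

Lemma mean_avg (phi : 'rV[R]_d -> Omega -> R) : (forall y, itg P (phi y)) ->
  mean P (fun w => avg us (phi ^~ w)) = avg us (fun y => mean P (phi y)).
Proof.
move=> iphi; rewrite /avg meanZ; last by apply: itg_sum.
by rewrite mean_sum.
Qed.

Local Notation U a b y := (shifted F a (b *: y)).

(** The outer finite average over the walk makes it independent of [F] without a product space. *)
Definition interpolation a b := avg us (fun y => mean P (g \o U a b y)).

Let Fvec w : 'rV[R]_d := \row_i F i w.

Let mU a b y q : lip1 q -> measurable_fun setT (q \o U a b y).
Proof. by move=> lq; exact: measurable_shifted. Qed.

Let L2_norm1 : L2 P (fun w => norm1 (Fvec w)).
Proof.
apply: (eq_L2 (f := fun w => \sum_i `|F i w|)) => [w|].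
  by apply: eq_bigr => i _; rewrite mxE.
by apply: L2_sum => i _; exact: L2_norm.
Qed.

Let itg_g a b y : itg P (g \o U a b y).
Proof.
apply: (itg_le (mU a b y g_lip) (g := fun w => `|g (b *: y)| + `|a| * norm1 (Fvec w))) => [w|].
  rewrite /= -lerBlDl; apply: le_trans (lerB_dist _ _) _.
  by apply: le_trans (lip1_sub _ _ g_lip) _; rewrite /shifted addrK norm1Z.
by apply: itgD; [exact: itg_cst|apply: itgZ; exact: L2_itg].
Qed.

Let itg_bndU a b y q X : lip1 q -> (forall x, `|q x| <= 1) -> itg P X ->
  itg P (fun w => X w * q (U a b y w)).
Proof.
move=> lq bq iX; apply: eq_itg (itg_bnd (mU a b y lq) (fun w => bq (U a b y w)) iX) => w /=.
by rewrite mulrC.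
Qed.

(** [Y1] and [Y2] play the part of the partial derivatives of [interpolation] in a and b. Up to
    controlled errors they are [a * S] and [b * S], with the same Hessian term [S]. *)
Let W a b i j := avg us (fun y => mean P (fun w => h i j (U a b y w))).
Let S a b := \sum_i \sum_j sigma i j * W a b i j.
Let Y1 a b := avg us (fun y => mean P (fun w => \sum_i F i w * f i (U a b y w))).
Let Y2 a b := avg us (fun y => mean P (fun w => \sum_i y 0 i * f i (U a b y w))).
Let B := mean P (fun w => norm1 (Fvec w) ^+ 2) + avg us (fun y => norm1 y ^+ 2).
Let kappa := \sum_(u <- us) norm1 u ^+ 3.

Let Y1_bound a b : `|Y1 a b - a * S a b| <= `|a| * A + 2 * `|a| ^+ 3 * T.
Proof.
have -> : a * S a b = avg us (fun y => a * \sum_i \sum_j sigma i j * mean P (fun w => h i j (U a b y w))).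
  rewrite avgZ avg_sum; congr (_ * _); apply: eq_bigr => i _.
  by rewrite avg_sum; apply: eq_bigr => j _; rewrite avgZ.
rewrite -avgB; apply: le_trans (avg_norm _ _) _; rewrite -[leRHS](avg_cst us); apply: avg_le => y.
rewrite mean_sum => [|i _]; last exact: itg_bndU (f_lip i) (f_bnd i) (L2_itg (LF i)).
exact: (mean_stein_bound hP a (b *: y) LF LV f_h h_h3 f_lip h_lip h3_lip f_bnd h_bnd iT HT HA HF Fibp).
Qed.

Let itg_h a b i j y : itg P (fun w => h i j (U a b y w)).
Proof.
by apply: (itg_le (mU a b y (h_lip i j)) _ (itg_cst P 1)) => w; exact: h_bnd.
Qed.

Let Y2_bound a b : `|Y2 a b - b * S a b| <= 2 * b ^+ 2 * kappa.
Proof.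
have iY (y : 'rV[R]_d) : itg P (fun w => \sum_i y 0 i * f i (U a b y w)).
  by apply: itg_sum => i _; exact: itg_bndU (f_lip i) (f_bnd i) (itg_cst P _).
have iWw i j : itg P (fun w => avg us (fun y => h i j (U a b y w))).
  by rewrite /avg; apply: itgZ; apply: itg_sum => y _; exact: itg_h.
have iWs : itg P (fun w => \sum_i \sum_j sigma i j * (b * avg us (fun y => h i j (U a b y w)))).
  by apply: itg_sum => i _; apply: itg_sum => j _; apply: itgZ; exact: itgZ.
have iYa : itg P (fun w => avg us (fun y => \sum_i y 0 i * f i (U a b y w))).
  by rewrite /avg; apply: itgZ; apply: itg_sum.
have -> : Y2 a b - b * S a b = mean P (fun w =>
    avg us (fun y => \sum_i y 0 i * f i (U a b y w)) -
    \sum_i \sum_j sigma i j * (b * avg us (fun y => h i j (U a b y w)))).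
  rewrite meanB // mean_avg //; congr (_ - _).
  rewrite mean_sum => [|i _]; last by apply: itg_sum => j _; apply: itgZ; exact: itgZ.
  rewrite mulr_sumr; apply: eq_bigr => i _.
  rewrite mean_sum => [|j _]; last by apply: itgZ; exact: itgZ.
  rewrite mulr_sumr; apply: eq_bigr => j _.
  rewrite meanZ; last exact: itgZ.
  by rewrite meanZ // mean_avg // mulrCA.
have iD := itgB iYa iWs.
apply: le_trans (ler_norm_mean iD) _.
rewrite -[leRHS](mean_cst P); apply: le_mean => [||w]; [exact: itg_norm|exact: itg_cst|].
have UD y v : U a b (y + v) w = U a b y w + b *: v by rewrite /shifted scalerDr addrA.
have K1 i (y v : 'rV[R]_d) : `|f i (U a b (y + v) w) - f i (U a b y w) - \sum_j v 0 j * (b * h i j (U a b y w))|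
    <= b ^+ 2 * norm1 v ^+ 2.
  have := taylor1 (f_h i) (h_lip i) (U a b y w) (b *: v).
  rewrite norm1Z exprMn real_normK ?num_real //.
  rewrite -UD (eq_bigr (fun j => v 0 j * (b * h i j (U a b y w)))) // => j _.
  by rewrite mxE mulrCA mulrA.
have K2 i j (y v : 'rV[R]_d) : `|b * h i j (U a b (y + v) w) - b * h i j (U a b y w)| <= b ^+ 2 * norm1 v.
  rewrite -mulrBr normrM -[b ^+ 2]real_normK ?num_real // expr2 -mulrA ler_wpM2l //.
  by rewrite -norm1Z UD; exact: h_lip.
have := avg_stein us K1 K2; rewrite -/kappa.
rewrite (eq_bigr (fun i => \sum_j sigma i j * (b * avg us (fun y => h i j (U a b y w))))) // => i _.
by apply: eq_bigr => j _; rewrite avgZ.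
Qed.

Let S_bound a b : `|S a b| <= \sum_i \sum_j `|sigma i j|.
Proof.
rewrite /S; apply: le_trans (ler_norm_sum _ _ _) _; apply: ler_sum => i _.
apply: le_trans (ler_norm_sum _ _ _) _; apply: ler_sum => j _.
rewrite normrM ler_piMr //; apply: le_trans (avg_norm _ _) _.
rewrite -[leRHS](avg_cst us); apply: avg_le => y.
apply: le_trans (ler_norm_mean (itg_h a b i j y)) _.
rewrite -[leRHS](mean_cst P); apply: le_mean => [||w]; [exact/itg_norm/itg_h|exact: itg_cst|].
exact: h_bnd.
Qed.

Let interpolation_step a b a' b' :
  `|interpolation a' b' - interpolation a b - (a' - a) * Y1 a b - (b' - b) * Y2 a b| <=
  2 * ((a' - a) ^+ 2 + (b' - b) ^+ 2) * B.
Proof.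
set e := (a' - a) ^+ 2 + (b' - b) ^+ 2.
have e0 : 0 <= e by rewrite addr_ge0 ?sqr_ge0.
pose r (y : 'rV[R]_d) w := g (U a' b' y w) - g (U a b y w) -
  ((a' - a) * \sum_i F i w * f i (U a b y w) + (b' - b) * \sum_i y 0 i * f i (U a b y w)).
have i1 y : itg P (fun w => \sum_i F i w * f i (U a b y w)).
  by apply: itg_sum => i _; exact: itg_bndU (f_lip i) (f_bnd i) (L2_itg (LF i)).
have i2 (y : 'rV[R]_d) : itg P (fun w => \sum_i y 0 i * f i (U a b y w)).
  by apply: itg_sum => i _; exact: itg_bndU (f_lip i) (f_bnd i) (itg_cst P _).
have ir y : itg P (r y).
  by apply: itgB; [exact: itgB (itg_g a' b' y) (itg_g a b y)|apply: itgD; exact: itgZ].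
have -> : interpolation a' b' - interpolation a b - (a' - a) * Y1 a b - (b' - b) * Y2 a b =
    avg us (fun y => mean P (r y)).
  rewrite /interpolation /Y1 /Y2 -!avgZ -!avgB; apply: eq_avg => y.
  rewrite /r meanB; [|exact: itgB (itg_g a' b' y) (itg_g a b y)|by apply: itgD; exact: itgZ].
  rewrite [X in _ = _ - X]meanD; [|exact: itgZ|exact: itgZ].
  by rewrite meanB; [|exact: itg_g|exact: itg_g]; rewrite !meanZ // opprD addrA.
apply: le_trans (avg_norm _ _) _.
have -> : 2 * e * B = avg us (fun y => 2 * e * (mean P (fun w => norm1 (Fvec w) ^+ 2) + norm1 y ^+ 2)).
  by rewrite avgZ avgD avg_cst.
apply: avg_le => y; apply: le_trans (ler_norm_mean (ir y)) _.
have iN : itg P (fun w => norm1 (Fvec w) ^+ 2 + norm1 y ^+ 2).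
  by apply: itgD; [exact: L2_norm1.2|exact: itg_cst].
rewrite -[X in _ + X](mean_cst P) -meanD; [|exact: L2_norm1.2|exact: itg_cst].
rewrite -meanZ //; apply: le_mean => [||w]; [exact: itg_norm|exact: itgZ|].
set v := (a' - a) *: Fvec w + (b' - b) *: y.
have := taylor1 g_f f_lip (U a b y w) v.
have -> : U a b y w + v = U a' b' y w.
  by rewrite /shifted /v addrACA -!scalerDl !(addrC _ (_ - _)) !subrK.
rewrite (_ : \sum_j _ = (a' - a) * (\sum_i F i w * f i (U a b y w)) +
    (b' - b) * \sum_i y 0 i * f i (U a b y w)); last first.
  rewrite !mulr_sumr -big_split; apply: eq_bigr => i _ /=.
  by rewrite /v !mxE; ring.
rewrite -/(r y w) => H; apply: le_trans H _.
have h1 : norm1 v <= `|a' - a| * norm1 (Fvec w) + `|b' - b| * norm1 y.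
  by apply: le_trans (norm1D _ _) _; rewrite !norm1Z.
have nv := norm1_ge0 v; have n1 := norm1_ge0 (Fvec w); have n2 := norm1_ge0 y.
have : norm1 v ^+ 2 <= (`|a' - a| * norm1 (Fvec w) + `|b' - b| * norm1 y) ^+ 2.
  by rewrite ler_pXn2r ?nnegrE // addr_ge0 ?mulr_ge0.
rewrite /e -[(a' - a) ^+ 2]real_normK ?num_real // -[(b' - b) ^+ 2]real_normK ?num_real //.
move: (norm1 (Fvec w)) (norm1 y) `|a' - a| `|b' - b| => x z p q H; apply: le_trans H _.
have s1 := sqr_ge0 (p * x - q * z).
have s2 := sqr_ge0 (p * z); have s3 := sqr_ge0 (q * x).
rewrite -subr_ge0 (_ : _ - _ = (p * x - q * z) ^+ 2 + 2 * (p * z) ^+ 2 + 2 * (q * x) ^+ 2); last by ring.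
by apply: addr_ge0; [apply: addr_ge0 => //|]; exact: mulr_ge0.
Qed.

Hypothesis T0 : 0 <= T.

Lemma interpolation_bound :
  `|mean P (fun w => g (Fvec w)) - avg us g| <= 2^-1 * (A + T) + 2 * kappa.
Proof.
have A0 : 0 <= A.
  apply: (ler_cvg_to (cvgnC 0) HA); apply: nearW => K.
  by apply: sumr_ge0 => i _; apply: sumr_ge0 => j _; exact: mean_ge0.
have k0 : 0 <= kappa by apply: sumr_ge0 => u _; rewrite exprn_ge0 ?norm1_ge0.
set s := \sum_i \sum_j `|sigma i j|.
have s0 : 0 <= s by apply: sumr_ge0 => i _; apply: sumr_ge0.
pose ft t := interpolation (circle_a t) (circle_b t).
(* Primitive of the error rates: [a A + 2 a^3 T] for the motion in a, from [Y1_bound], and [2 kappa]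
   for the decrease of b, from [Y2_bound] with [b ^+ 2 <= 1]. *)
pose phi (t : R) := 2^-1 * circle_a t ^+ 2 * A + 2^-1 * circle_a t ^+ 4 * T - 2 * kappa * circle_b t.
have a1 : circle_a 1 = 1 :> R by rewrite /circle_a; field.
have b1 : circle_b 1 = 0 :> R by rewrite /circle_b expr1n subrr mul0r.
have a0 : circle_a 0 = 0 :> R by rewrite /circle_a mulr0 mul0r.
have b0 : circle_b 0 = 1 :> R by rewrite /circle_b expr0n /= subr0 addr0 divr1.
have f1 : ft 1 = mean P (fun w => g (Fvec w)).
  rewrite /ft a1 b1 -[RHS](avg_cst us); apply: eq_avg => y; apply: eq_mean => w.
  by rewrite /= /shifted scale1r scale0r addr0.
have f0 : ft 0 = avg us g.
  rewrite /ft a0 b0; apply: eq_avg => y; rewrite -[RHS](mean_cst P); apply: eq_mean => w.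
  by rewrite /= /shifted scale1r scale0r add0r.
rewrite -f1 -f0.
have -> : 2^-1 * (A + T) + 2 * kappa = phi 1 - phi 0.
  by rewrite /phi a1 b1 a0 b0; field.
apply: (@increment_bound _ _ _ (4 * (2^-1 * s + 2 * B))) => x t x0 xt t1.
have ha := circle_a_mono x0 xt t1; have hb := circle_b_mono x0 xt.
have a_ge0 := circle_a_ge0 x0.
have /andP[b_ge0 b_le1] := circle_b_bnd x0 (le_trans xt t1).
have hn := circle_norm x; have hn' := circle_norm t; have hd := circle_dist x t.
rewrite /ft /phi.
move: (circle_a x) (circle_b x) (circle_a t) (circle_b t) ha hb a_ge0 b_ge0 b_le1 hn hn' hd.
move=> a b a' b' aa bb a_ge0 b_ge0 b_le1 hn hn' hd.
set I' := interpolation a' b'; set I := interpolation a b.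
have r1 := interpolation_step a b a' b'.
have r2 := Y1_bound a b; have r3 := Y2_bound a b; have r4 := S_bound a b.
set e := (a' - a) ^+ 2 + (b' - b) ^+ 2 in r1 hd.
have e0 : 0 <= e by rewrite addr_ge0 ?sqr_ge0.
have B0 : 0 <= B.
  apply: addr_ge0; first by apply: mean_ge0 => w; exact: sqr_ge0.
  by rewrite -(avg_cst us 0); apply: avg_le => y; exact: sqr_ge0.
(* Both points lie on the unit circle, so [a (a' - a) + b (b' - b)] is [- e / 2]: the Hessian term
   survives only at second order in the step. *)
have -> : I' - I = (I' - I - (a' - a) * Y1 a b - (b' - b) * Y2 a b) +
    (a' - a) * (Y1 a b - a * S a b) + (b' - b) * (Y2 a b - b * S a b) -
    2^-1 * e * S a b.
  have : e = 2 - 2 * (a * a' + b * b') by rewrite /e; move: hn hn'; lra.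
  move=> ee; have -> : 2^-1 * e = - (a * (a' - a) + b * (b' - b)) by rewrite ee; move: hn; lra.
  by ring.
apply: le_trans (ler_normB _ _) _.
apply: le_trans (lerD (ler_normD _ _) (lexx _)) _.
apply: le_trans (lerD (lerD (ler_normD _ _) (lexx _)) (lexx _)) _.
(* The primitive is convex in a, so its increment dominates the rate at the left end times the step;
   [q1] and [q2] are the signs of the gaps. *)
have t2 : `|(a' - a) * (Y1 a b - a * S a b)| <=
    2^-1 * a' ^+ 2 * A + 2^-1 * a' ^+ 4 * T - (2^-1 * a ^+ 2 * A + 2^-1 * a ^+ 4 * T).
  rewrite normrM ger0_norm ?subr_ge0 //.
  apply: le_trans (ler_wpM2l _ r2) _; first by rewrite subr_ge0.
  rewrite ger0_norm //.
  have q1 : 0 <= (a' - a) ^+ 2 * A by rewrite mulr_ge0 ?sqr_ge0.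
  have q2 : 0 <= ((a' - a) ^+ 2 * ((a' + a) ^+ 2 + 2 * a ^+ 2)) * T.
    apply: mulr_ge0 => //; apply: mulr_ge0; first exact: sqr_ge0.
    by apply: addr_ge0; [exact: sqr_ge0|apply: mulr_ge0 => //; exact: sqr_ge0].
  rewrite -subr_ge0 (_ : _ - _ = 2^-1 * ((a' - a) ^+ 2 * A) + 2^-1 * (((a' - a) ^+ 2 * ((a' + a) ^+ 2 + 2 * a ^+ 2)) * T)).
    by apply: addr_ge0; exact: mulr_ge0.
  by field.
have t3 : `|(b' - b) * (Y2 a b - b * S a b)| <= 2 * kappa * b - 2 * kappa * b'.
  rewrite normrM ler0_norm ?subr_le0 // opprB.
  apply: le_trans (ler_wpM2l _ r3) _; first by rewrite subr_ge0.
  rewrite -mulrBr mulrC ler_wpM2r ?subr_ge0 // -mulrA ler_wpM2l // ler_piMl //.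
  by rewrite expr_le1.
have t4 : `|2^-1 * e * S a b| <= 2^-1 * e * s.
  by rewrite normrM ger0_norm ?mulr_ge0 // ler_wpM2l // mulr_ge0.
have t5 : 2 * e * B + 2^-1 * e * s <= 4 * (2^-1 * s + 2 * B) * (t - x) ^+ 2.
  rewrite (_ : _ + _ = e * (2^-1 * s + 2 * B)); last by ring.
  rewrite (_ : _ * (t - x) ^+ 2 = 4 * (t - x) ^+ 2 * (2^-1 * s + 2 * B)); last by ring.
  by rewrite ler_wpM2r // addr_ge0 // mulr_ge0.
move: r1 t2 t3 t4 t5; lra.
Qed.

End path.

(** * The fourth order distance *)

Lemma ae_ord (dT : measure_display) (T : measurableType dT) (R : realType)
    (P : probability T R) d (A : 'I_d -> T -> Prop) :
  (forall i, {ae P, forall w, A i w}) -> {ae P, forall w, forall i, A i w}.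
Proof.
move=> H; pose B n w := forall i : 'I_d, val i = n -> A i w.
have HB n : {ae P, forall w, B n w}.
  have [nd|dn] := ltnP n d.
    by apply: filterS (H (Ordinal nd)) => w Aw i ni; rewrite (_ : i = Ordinal nd) //; exact: val_inj.
  by apply: aeW => w i ni; move: (ltn_ord i); rewrite [nat_of_ord i]ni ltnNge dn.
by apply: filterS (ae_forall HB) => w Bw i; exact: (Bw _ i erefl).
Qed.

Section normal_approximation.
Context {R : realType} (P : probability Omega R) (hP : is_rademacher P) (d : nat).
Variables (F : 'I_d -> {RV P >-> R}).
Hypothesis hdom : forall i, dom_D P (F i).
Hypothesis hmean : forall i, ('E_P[F i] = 0)%E.
Variables (Sigma : 'M[R]_d) (vs : seq 'rV[R]_d).
Hypothesis Hvs : forall i j, Sigma i j = \sum_(v <- vs) v 0 i * v 0 j.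
Context {dT : measure_display} {T : measurableType dT} (Q : probability T R).
Variable N : 'I_d -> {RV Q >-> R}.
Hypothesis hgauss : gaussian_vector Q (fun i => N i).
Hypothesis hNmean : forall i, ('E_Q[N i] = 0)%E.
Hypothesis hNcov : forall i j, covariance Q (N i) (N j) = (Sigma i j)%:E.

Let V i := fun w => - Linv P (F i) w.

Let hchaos i : exists f, chaos P (F i) f.
Proof. by have [f cf _] := hdom i; exists f. Qed.

Let L2_F i : L2 P (F i).
Proof. by have [f cf] := hchaos i; exact: (chaos_cvL2 hP cf).2.1. Qed.

Let L2_V i : L2 P (V i).
Proof. by have [f cf] := hchaos i; apply: L2N; exact: (Linv_cvL2 hP cf).1. Qed.

Let mean_F i : mean P (F i) = 0.
Proof. by rewrite -fine_expectation hmean. Qed.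

Let F_ibp i G C : L2 P G -> (forall K, \sum_(0 <= k < K) n2 P (grad k G) <= C) ->
  (fun K => \sum_(0 <= k < K) mean P (fun w => grad k G w * grad k (V i) w)) @ \oo -->
  mean P (fun w => F i w * G w).
Proof. by move=> LG HC; have [f cf] := hchaos i; exact (ibp hP cf (mean_F i) LG HC). Qed.

Lemma normal_approximation g (A t : R) :
  C_upto 4 g -> (forall i, (1 <= i <= 4)%N -> (M i g <= 1)%E) ->
  (forall k, itg P (third_moment (fun i => F i) V k)) ->
  (forall K, \sum_(0 <= k < K) mean P (third_moment (fun i => F i) V k) <= t) ->
  (fun K => \sum_i \sum_j mean P (fun w =>
    `|Sigma i j - \sum_(0 <= k < K) grad k (F j) w * grad k (V i) w|)) @ \oo --> A ->
  `|mean P (fun w => g (\row_i F i w)) - mean Q (fun w => g (\row_i N i w))| <= 2^-1 * (A + t).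
Proof.
move=> gC gM iT HT HA.
have t0 : 0 <= t by have := HT 0%N; rewrite big_geq.
have lip s : (size s < 4)%N -> lip1 (partial s g) by exact: partial_lip1.
have bnd s : (1 <= size s <= 4)%N -> forall x, `|partial s g x| <= 1 by exact: partial_bound.
have der s : (size s < 4)%N -> has_partials (partial s g) (fun i => partial (i :: s) g).
  exact: partial_has_partials.
pose kappa := \sum_(v <- vs) norm1 v ^+ 3.
(* There are n + 1 copies of each step, scaled by h with [(n + 1) h^2 = 1]; their third moments
   therefore carry a factor h and vanish in the limit. *)
have kwalk n : \sum_(u <- walk vs n) norm1 u ^+ 3 = walk_scale n * kappa.
  rewrite sum_walk /kappa !mulr_sumr; apply: eq_bigr => v _.
  rewrite norm1Z ger0_norm ?walk_scale_ge0 //.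
  rewrite (_ : _ * _ = n.+1%:R * walk_scale n ^+ 2 * (walk_scale n * norm1 v ^+ 3)); last by ring.
  by rewrite walk_scale_sqr divff ?pnatr_eq0 // mul1r.
have main n : `|mean P (fun w => g (\row_i F i w)) - avg (walk vs n) g| <=
    2^-1 * (A + t) + 2 * (walk_scale n * kappa).
  rewrite -kwalk.
  have HA' : (fun K => \sum_i \sum_j mean P (fun w =>
    `|\sum_(u <- walk vs n) u 0 i * u 0 j -
      \sum_(0 <= k < K) grad k (F j) w * grad k (V i) w|)) @ \oo --> A.
    by under eq_fun do under eq_bigr do under eq_bigr do rewrite sum_walk_mul -Hvs.
  exact: (interpolation_bound hP L2_F L2_V (g := g) (f := fun i => partial [:: i] g)
    (h := fun i j => partial [:: j; i] g) (h3 := fun i j l => partial [:: l; j; i] g)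
    (der [::] isT) (fun i => der [:: i] isT) (fun i j => der [:: j; i] isT)
    (lip [::] isT) (fun i => lip [:: i] isT) (fun i j => lip [:: j; i] isT)
    (fun i j l => lip [:: l; j; i] isT) (fun i => bnd [:: i] isT) (fun i j => bnd [:: j; i] isT)
    iT HT HA' (fun i => dom_D_grad_bound hP (hdom i)) F_ibp t0).
have cL : (fun n => `|mean P (fun w => g (\row_i F i w)) - avg (walk vs n) g|) @ \oo -->
    `|mean P (fun w => g (\row_i F i w)) - mean Q (fun w => g (\row_i N i w))|.
  by apply: cvg_norm; apply: cvgnB (cvgnC _) (cvg_avg_lip1 hgauss hNmean hNcov Hvs (lip [::] isT)).
have cR := cvgnD (cvgnC (2^-1 * (A + t))) (cvgnM (cvgnC 2) (cvgnM (@cvg_walk_scale R) (cvgnC kappa))).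
rewrite mul0r mulr0 addr0 in cR.
by apply: (ler_cvg_to cL cR); exact: nearW.
Qed.

Lemma d4_le (A t : R) :
  (forall k, itg P (third_moment (fun i => F i) V k)) ->
  (forall K, \sum_(0 <= k < K) mean P (third_moment (fun i => F i) V k) <= t) ->
  (fun K => \sum_i \sum_j mean P (fun w =>
    `|Sigma i j - \sum_(0 <= k < K) grad k (F j) w * grad k (V i) w|)) @ \oo --> A ->
  (d4 P Q (fun i => F i) (fun i => N i) <= (2^-1 * (A + t))%:E)%E.
Proof.
move=> iT HT HA; apply: ge_ereal_sup => _ [g [gC gM] <-].
have lg : lip1 g := partial_lip1 gC gM (isT : (size [::] < 4)%N).
have iF := L2_itg (L2_lip1 L2_F lg).
have iN := L2_itg (L2_lip1 (L2_N hNmean hNcov) lg).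
rewrite !expectation.unlock !mean_EFin // lee_fin.
exact: normal_approximation gC gM iT HT HA.
Qed.

End normal_approximation.

Lemma lee_term_sum (R : realType) d (x : 'I_d -> \bar R) i :
  (forall j, 0 <= x j)%E -> (x i <= \sum_(j < d) x j)%E.
Proof. by move=> x0; rewrite (bigD1 i) //= leeDl // sume_ge0. Qed.

Section discrete_gradients.
Context {R : realType} (P : probability Omega R) (hP : is_rademacher P) (d : nat).
Variables (F : 'I_d -> {RV P >-> R}).
Hypothesis hdom : forall i, dom_D P (F i).

Let V i := fun w => - Linv P (F i) w.

(** A single null set for all i and k, so that whole series in k can be compared at a given
    point. *)
Lemma ae_D_grad : {ae P, forall w, forall i k,
  D P (F i) k w = grad k (F i) w /\ - D P (Linv P (F i)) k w = grad k (V i) w}.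
Proof.
apply: ae_ord => i; apply: ae_forall => k; have [f cf _] := hdom i.
have [LD nD] := D_grad hP k cf; have [LI nI] := D_Linv_grad hP k cf.
have LF := (chaos_cvL2 hP cf).2.1; have LV := (Linv_cvL2 hP cf).1.
have h1 := n2_eq0 (L2B LD (L2_grad hP k LF)) nD.
have h2 := n2_eq0 (L2B LI (L2_grad hP k LV)) nI.
apply: filterS (ae_and h1 h2) => w [/eqP e1 /eqP e2]; split.
  by apply/eqP; rewrite -subr_eq0.
by rewrite /V gradN; congr (- _); apply/eqP; rewrite -subr_eq0.
Qed.

Lemma carre_du_champ : exists G : 'I_d -> 'I_d -> Omega -> R, forall i j,
  [/\ itg P (G i j),
    {ae P, forall w, G i j w = l2inner (fun k => grad k (F j) w) (fun k => grad k (V i) w)} &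
    (fun K => mean P (fun w => `|G i j w - \sum_(0 <= k < K) grad k (F j) w * grad k (V i) w|))
      @ \oo --> (0 : R)].
Proof.
have H i j : exists G, [/\ itg P G,
    {ae P, forall w, G w = l2inner (fun k => grad k (F j) w) (fun k => grad k (V i) w)} &
    (fun K => mean P (fun w => `|G w - \sum_(0 <= k < K) grad k (F j) w * grad k (V i) w|))
      @ \oo --> (0 : R)].
  have [fj cfj _] := hdom j; have [fi cfi _] := hdom i.
  have [C1 HC1] := dom_D_grad_bound hP (hdom j); have [C2 HC2] := Linv_grad_bound hP cfi.
  have LF := (chaos_cvL2 hP cfj).2.1; have LV := L2N (Linv_cvL2 hP cfi).1.
  have [G iG [aeG cG]] := l2inner_L1 (fun k => L2_grad hP k LF) (fun k => L2_grad hP k LV) HC1 HC2.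
  by exists G.
have [G HG] := choice (fun p : 'I_d * 'I_d => H p.1 p.2).
by exists (fun i j => G (i, j)) => i j; exact: HG (i, j).
Qed.

End discrete_gradients.

Theorem theorem5p1 (R : realType) (P : probability Omega R)
    (hP : is_rademacher P)
    (d : nat) (hd : (2 <= d)%N)
    (F : 'I_d -> {RV P >-> R})
    (hdom : forall i, dom_D P (F i))
    (hmean : forall i, ('E_P[F i] = 0)%E)
    (hD4 : forall i,
      (\int[P]_w \sum_(0 <= k <oo) (`|D P (F i) k w| ^+ 4)%:E < +oo)%E)
    (Sigma : 'M[R]_d) (hsym : Sigma^T = Sigma) (hpsd : psd Sigma)
    (dT : measure_display) (T : measurableType dT) (Q : probability T R)
    (N : 'I_d -> {RV Q >-> R})
    (hgauss : gaussian_vector Q (fun i => N i))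
    (hNmean : forall i, ('E_Q[N i] = 0)%E)
    (hNcov : forall i j, covariance Q (N i) (N j) = (Sigma i j)%:E) :
  (d4 P Q (fun i => F i) (fun i => N i) <=
    (d%:R / 2)%:E * sqrte (\sum_(i < d) \sum_(j < d)
      'E_P[fun w => ((Sigma i j -
         l2inner (fun k => D P (F j) k w)
                 (fun k => - D P (Linv P (F i)) k w)) ^+ 2)%R])
    + (5 / 3)%:E * \int[P]_w
        l2inner_ge0 (fun k => ((\sum_(j < d) `|D P (F j) k w|) ^+ 3)%R)
                    (fun k => (\sum_(i < d) `|D P (Linv P (F i)) k w|)%R))%E.
Proof.
have [vs Hvs] := psd_decomp hsym hpsd.
pose V i := fun w => - Linv P (F i) w.
have [G HG] := carre_du_champ hP hdom.
have aeD := ae_D_grad hP hdom.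
set E := (\sum_(i < d) _)%E; set TT := (\int[P]_w _)%E.
have E_ge0 i j : (0 <= 'E_P[fun w => ((Sigma i j - l2inner (fun k => D P (F j) k w)
    (fun k => - D P (Linv P (F i)) k w)) ^+ 2)%R])%E.
  by rewrite expectation.unlock; apply: integral_ge0 => w _; rewrite lee_fin sqr_ge0.
have Es_ge0 i : (0 <= \sum_(j < d) 'E_P[fun w => ((Sigma i j - l2inner (fun k => D P (F j) k w)
    (fun k => - D P (Linv P (F i)) k w)) ^+ 2)%R])%E by exact: sume_ge0.
have E0 : (0 <= E)%E by exact: sume_ge0.
have D0 w : (0 <= l2inner_ge0 (fun k => ((\sum_(j < d) `|D P (F j) k w|) ^+ 3)%R)
    (fun k => (\sum_(i < d) `|D P (Linv P (F i)) k w|)%R))%E.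
  apply: nneseries_ge0 => k _ _; rewrite lee_fin mulr_ge0 ?exprn_ge0 //; exact: sumr_ge0.
have TT0 : (0 <= TT)%E by exact: integral_ge0.
have d0 : 0 < d%:R / 2 :> R by rewrite divr_gt0 // ltr0n (ltn_trans _ hd).
(* If either term on the right is infinite the bound is trivial, the other being nonnegative. In the
   remaining case the computation is one with real numbers. *)
have [TTy|TTfin] := eqVneq TT +oo%E.
  by rewrite TTy gt0_muley ?lte_fin ?addey ?leey // gt_eqF // (lt_le_trans (ltNyr 0)) // mule_ge0 ?sqrte_ge0 ?lee_fin ?ltW.
have [Ey|Efin] := eqVneq E +oo%E.
  rewrite Ey /= gt0_muley ?lte_fin // addye ?leey // gt_eqF //.
  by rewrite (lt_le_trans (ltNyr 0)) // mule_ge0 // lee_fin.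
have {TTfin} TTfin : TT \is a fin_num by rewrite ge0_fin_numE // lt_neqAle TTfin leey.
have {Efin} Efin : E \is a fin_num by rewrite ge0_fin_numE // lt_neqAle Efin leey.
have LF i : L2 P (F i) by have [f cf _] := hdom i; exact: (chaos_cvL2 hP cf).2.1.
have LV i : L2 P (V i) by have [f cf _] := hdom i; apply: L2N; exact: (Linv_cvL2 hP cf).1.
have mg k (Z : 'I_d -> Omega -> R) : (forall i, L2 P (Z i)) -> measurable_fun setT (grad_norm1 Z k).
  move=> LZ; apply: (itg_mf (P := P)); apply: itg_sum => i _; apply: itg_norm.
  exact: L2_itg (L2_grad hP k (LZ i)).
have mt k : measurable_fun setT (third_moment (fun i => F i) V k).
  by apply: measurable_funM; [apply: measurable_funX; exact: mg|exact: mg].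
have mtE k : measurable_fun setT (fun w => (third_moment (fun i => F i) V k w)%:E).
  exact/measurable_EFinP.
have t0 k w : 0 <= third_moment (fun i => F i) V k w.
  by rewrite mulr_ge0 ?exprn_ge0 ?sumr_ge0.
(* The integrands agree almost surely. One inequality is enough, and as a comparison from below it
   asks for measurability only on the gradient side. *)
have HT : (\sum_(0 <= k <oo) \int[P]_w (third_moment (fun i => F i) V k w)%:E <= TT)%E.
  rewrite -integral_nneseries //; last by move=> k w _; rewrite lee_fin.
  apply: ae_le_integral_lower => //.
  - by apply: ge0_emeasurable_sum => // k w _ _; rewrite lee_fin.
  - by move=> w; apply: nneseries_ge0 => k _ _; rewrite lee_fin.
  apply: filterS aeD => w Hw; rewrite /l2inner_ge0 le_eqVlt; apply/orP; left; apply/eqP.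
  apply: eq_eseriesr => k _; congr (_ ^+ 3 * _)%:E; apply: eq_bigr => i _.
    by rewrite (Hw i k).1.
  by rewrite -[in RHS]normrN (Hw i k).2.
have sT K : (\sum_(0 <= k < K) \int[P]_w (third_moment (fun i => F i) V k w)%:E <= TT)%E.
  by apply: le_trans HT; apply: nneseries_lim_ge => k _ _; apply: integral_ge0 => w _; rewrite lee_fin.
have iT k : itg P (third_moment (fun i => F i) V k).
  apply: ge0_itg => //; apply: (@le_lt_trans _ _ TT); last by rewrite -ge0_fin_numE.
  apply: le_trans (sT k.+1); rewrite big_nat_recr //= leeDr //.
  by apply: sume_ge0 => l _; apply: integral_ge0 => w _; rewrite lee_fin.
have mT K : \sum_(0 <= k < K) mean P (third_moment (fun i => F i) V k) <= fine TT.
  rewrite -lee_fin fineK //; apply: le_trans (sT K); rewrite -sumEFin.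
  by rewrite le_eqVlt; apply/orP; left; apply/eqP/eq_bigr => k _; rewrite mean_EFin.
have iG i j : itg P (G i j) by have [] := HG i j.
have mG i j : measurable_fun setT (fun w => Sigma i j - G i j w).
  by apply: measurable_funB => //; exact: itg_mf (iG i j).
have EG i j : (\int[P]_w ((Sigma i j - G i j w) ^+ 2)%:E <=
    'E_P[fun w => ((Sigma i j - l2inner (fun k => D P (F j) k w)
    (fun k => - D P (Linv P (F i)) k w)) ^+ 2)%R])%E.
  rewrite expectation.unlock; apply: ae_le_integral_lower => [||w|].
  - by apply/measurable_EFinP; exact: measurable_funX.
  - by move=> w; rewrite lee_fin sqr_ge0.
  - by rewrite lee_fin sqr_ge0.
  have [_ aeG _] := HG i j.
  apply: filterS (ae_and aeD aeG) => w [Hw ->].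
  rewrite (_ : (fun k => D P (F j) k w) = (fun k => grad k (F j) w)); last first.
    by apply/funext => k; rewrite (Hw j k).1.
  rewrite (_ : (fun k => - D P (Linv P (F i)) k w) = (fun k => grad k (V i) w)) //.
  by apply/funext => k; rewrite (Hw i k).2.
have EijE i j : ('E_P[fun w => ((Sigma i j - l2inner (fun k => D P (F j) k w)
    (fun k => - D P (Linv P (F i)) k w)) ^+ 2)%R] <= E)%E.
  exact: le_trans (lee_term_sum j (E_ge0 i)) (lee_term_sum i Es_ge0).
have LG i j : L2 P (fun w => Sigma i j - G i j w).
  split=> //; apply: ge0_itg; [exact: measurable_funX|by move=> w; exact: sqr_ge0|].
  by apply: le_lt_trans (EG i j) _; apply: le_lt_trans (EijE i j) _; rewrite -ge0_fin_numE.
have nG : \sum_i \sum_j n2 P (fun w => Sigma i j - G i j w) <= fine E.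
  rewrite -lee_fin fineK // -sumEFin; apply: lee_sum => i _; rewrite -sumEFin.
  by apply: lee_sum => j _; rewrite -mean_EFin; [exact: EG|exact: (LG i j).2].
pose A := \sum_i \sum_j mean P (fun w => `|Sigma i j - G i j w|).
have HA : (fun K => \sum_i \sum_j mean P (fun w =>
    `|Sigma i j - \sum_(0 <= k < K) grad k (F j) w * grad k (V i) w|)) @ \oo --> A.
  apply: cvgn_sum => i; apply: cvgn_sum => j; apply/cvgrPdist_le => e e0.
  have [_ _ /cvgrPdist_le /(_ _ e0) [K0 _ HK]] := HG i j; exists K0 => // K KK0.
  apply: le_trans (HK K KK0); rewrite sub0r normrN [leRHS]ger0_norm ?mean_ge0 //.
  have iS : itg P (fun w => \sum_(0 <= k < K) grad k (F j) w * grad k (V i) w).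
    by apply: itg_sum => k _; apply: L2M; exact: L2_grad.
  have iGS := itgB (iG i j) iS.
  have i1 := itgB (itg_cst P (Sigma i j)) (iG i j).
  have i2 := itgB (itg_cst P (Sigma i j)) iS.
  rewrite -meanB; [|exact: itg_norm|exact: itg_norm].
  apply: le_trans (ler_norm_mean (itgB (itg_norm i1) (itg_norm i2))) _.
  apply: le_mean => [||w]; [by apply/itg_norm/itgB; exact: itg_norm|exact: itg_norm|].
  apply: le_trans (ler_dist_dist _ _) _.
  by rewrite opprB addrC addrA subrK distrC.
have dA := d4_le hP hdom hmean Hvs hgauss hNmean hNcov iT mT HA.
apply: le_trans dA _; rewrite -(fineK TTfin) -(fineK Efin) /= -!EFinM -EFinD lee_fin.
(* With this, half of [A] becomes the first term of the theorem, and half of [TT] is below [5 / 3]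
   of it. *)
have A1 : A <= d%:R * Num.sqrt (fine E).
  apply: le_trans (sum_mean_norm_le LG) _; rewrite ler_wpM2l // ler_sqrt //.
  by rewrite fine_ge0.
have := fine_ge0 TT0; move: A1; rewrite (mulrAC d%:R); lra.
Qed.
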